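(* For the bulk-parallel priority queue described in the context, the operation deleteMin$^*$ can be implemented to run in the following expected times. (i) With fixed batch size $k$, expected time $O(\alpha\log^2 (kp))$ suffices. (ii) For flexible batch size $k\in\{\underline{k},\dots,\overline{k}\}$, where $\overline{k}-\underline{k}=\Omega(\overline{k})$, expected time $O(\alpha\log (kp))$ suffices. (iii) If $\overline{k}-\underline{k}=\Omega(\overline{k}/d)$, expected time $O(d\log\overline{k}+\beta d+\alpha\log p)$ is sufficient for flexible batch size in $\{\underline{k},\dots,\overline{k}\}$.
   Context: Machine model: $p$ processing elements (PEs) are connected by a network. Each PE can send and receive at most one message at a time (full-duplex, single-ported communication), and sending a message of $m$ machine words takes time $\alpha+m\beta$; $\alpha$ and $\beta$ are treated as variables in asymptotic bounds. Objects are single machine words, totally ordered without ties. Bulk-parallel priority queue: the queue content is a set of at most $n$ objects distributed arbitrarily over the PEs; each object stays on the PE that inserted it (elements are never moved), so insertions go to the local queue of the inserting PE without any communication. Each PE keeps its local objects in a search tree supporting insertion, deletion, selection by rank, ranking, splitting and concatenation in logarithmic time; the tree is augmented with two arrays storing the paths to its smallest and largest object, so that the operations needed for deleteMin$^*$ take time $O(\log k)$ rather than $O(\log n)$. Operation deleteMin$^*$ with fixed batch size $k$ removes (and reports, each PE its local share) the $k$ globally smallest objects of the queue. With flexible batch size in $\{\underline{k},\dots,\overline{k}\}$ it removes the $k$ globally smallest objects for some $k$ with $\underline{k}\le k\le\overline{k}$ chosen by the algorithm. Expectation is over the random choices of the algorithm.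
   Formalization: The bounds are proved assuming α ≥ 1 (one local instruction is the time unit) and β ≤ α, without which they fail; (i) excludes k = p = 1, where log(kp) = 0; in (ii) the k in log(kp) is the upper limit of the batch size. *)

(* Defs.v *)
From HB Require Import structures.
From mathcomp Require Import all_boot all_order all_algebra.
From mathcomp Require Import classical_sets reals constructive_ereal ereal exp.
Set Implicit Arguments.
Unset Strict Implicit.
Unset Printing Implicit Defensive.
Import Order.TTheory GRing.Theory Num.Theory.
Local Open Scope ring_scope.

(* The p processing elements (PEs) are word RAMs with w-bit words that all run
   the same program text.  A machine word is either a number below 2 ^ w or an
   object; objects can be copied, sent and compared, but not computed with.

   Program texts contain no objects and do not depend on p, w or the input, so
   charging one time unit per command (plus the costs of tree operations and
   messages) counts RAM time up to a constant factor.  The local search tree is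
   an abstract data type with the operations Size, Select, Rank and Remove. *)

Inductive binop := OpAdd | OpSub | OpMul | OpDiv | OpMod | OpLt | OpEq.

Inductive expr :=
| Const of nat
| At of expr
| Bin of binop & expr & expr.

(* In the commands below, [a] is the address of the result.
   Rand a e      uniformly random number in {0, ..., e - 1}
   Size a        number of local objects
   Select a i    local object of rank i, counted from 0 (WNum 0 if none)
   Rank a e      number of local objects smaller than the object e
   Remove i      remove the i smallest local objects and report them
   Send d a l    send the l words at addresses a, a + 1, ... to PE d
   Recv s a      wait for the next message of PE s, store it from address a on *)
Inductive cmd :=
| Skip
| Seq of cmd & cmd
| If of expr & cmd & cmd
| While of expr & cmd
| Assign (a e : expr)
| Rand (a e : expr)
| Size (a : expr)
| Select (a i : expr)
| Rank (a e : expr)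
| Remove (i : expr)
| Send (d a l : expr)
| Recv (s a : expr).

Inductive word (T : Type) := WNum of nat | WObj of T.
Arguments WNum {T}.

Section Machine.
Variables (R : realFieldType) (disp : Order.disp_t) (T : orderType disp).
Variables (w : nat) (alpha beta : R) (p : nat).

Definition num (x : word T) : nat := if x is WNum a then a else 0%N.

Definition eval_bin (o : binop) (x y : word T) : word T :=
  match x, y with
  | WNum a, WNum b => WNum
      match o with
      | OpAdd => (a + b) %% 2 ^ w
      | OpSub => a - b
      | OpMul => (a * b) %% 2 ^ w
      | OpDiv => a %/ b
      | OpMod => a %% b
      | OpLt => (a < b)%N
      | OpEq => a == b
      end%N
  | WObj a, WObj b => WNum
      match o with
      | OpLt => (a < b)%O : nat
      | OpEq => (a == b) : nat
      | _ => 0%N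
      end
  | _, _ => WNum 0
  end.

Fixpoint eval (m : nat -> word T) (e : expr) : word T :=
  match e with
  | Const a => WNum (a %% 2 ^ w)%N
  | At e => m (num (eval m e))
  | Bin o e1 e2 => eval_bin o (eval m e1) (eval m e2)
  end.

(* [code] is the stack of commands still to be executed, [queue] the content of
   the local search tree in increasing order, [out] the objects reported so far,
   [clock] the local time, and [port] the time from which the outgoing port is
   free again. *)
Record pe := Pe {
  code : seq cmd;
  memory : nat -> word T;
  queue : seq T;
  out : seq T;
  clock : R;
  port : R }.

(* [start] is the time at which the sender began to transmit. *)
Record message := Message { start : R; payload : seq (word T) }.

Record config := Config {
  pes : 'I_p -> pe;
  chan : 'I_p -> 'I_p -> seq message (* FIFO channel from source to target *) }.

(* Cost of a tree operation at rank i: the stored path to the smallest object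
   makes it logarithmic in i rather than in the size of the tree. *)
Definition tree_cost (i : nat) : R := (1 + trunc_log 2 i.+1)%:R.

(* [r] is the outcome of the random choice if the command is [Rand]. *)
Definition local_step (s : pe) (r : nat) : pe :=
  let: Pe c m q o t u := s in
  let val e := eval m e in
  let nat_of e := num (val e) in
  let store a x : nat -> word T := [eta m with nat_of a |-> x] in
  match c with
  | Skip :: k => Pe k m q o (t + 1) u
  | Seq c1 c2 :: k => Pe [:: c1, c2 & k] m q o (t + 1) u
  | If e c1 c2 :: k =>
      Pe ((if nat_of e != 0%N then c1 else c2) :: k) m q o (t + 1) u
  | While e c1 :: k =>
      Pe (if nat_of e != 0%N then [:: c1, While e c1 & k] else k) m q o (t + 1) u
  | Assign a e :: k => Pe k (store a (val e)) q o (t + 1) u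
  | Rand a e :: k => Pe k (store a (WNum r)) q o (t + 1) u
  | Size a :: k => Pe k (store a (WNum (size q))) q o (t + 1) u
  | Select a i :: k =>
      let x := if drop (nat_of i) q is y :: _ then WObj y else WNum 0 in
      Pe k (store a x) q o (t + tree_cost (nat_of i)) u
  | Rank a e :: k =>
      let j := if val e is WObj x then count (fun y => (y < x)%O) q else 0%N in
      Pe k (store a (WNum j)) q o (t + tree_cost j) u
  | Remove i :: k =>
      let j := nat_of i in
      Pe k m (drop j q) (o ++ take j q) (t + tree_cost j) u
  | _ => s
  end.

(* Communication is full-duplex and single-ported.  A message of l words
   occupies the outgoing port of the sender for alpha + l * beta from the moment
   [t] the port is free; meanwhile the sender may compute and receive.  The
   receiver is busy for alpha + l * beta from the moment when it is ready and
   the sender has started; so it receives one message at a time. *)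
Definition step (c : config) (i : 'I_p) (r : nat) : config :=
  let: Pe cd m q o t0 u := pes c i in
  let nat_of e := num (eval m e) in
  match cd with
  | Send d a l :: k =>
      let t := Num.max t0 u in
      let x := [seq m (nat_of a + h)%N | h <- iota 0 (nat_of l)] in
      let s := Pe k m q o (t + 1) (t + alpha + (size x)%:R * beta) in
      Config [eta pes c with i |-> s]
        (fun src dst =>
           if (src == i) && (dst == nat_of d :> nat)
           then rcons (chan c src dst) (Message t x) else chan c src dst)
  | Recv b a :: k =>
      if insub (nat_of b) is Some j then
        if chan c j i is Message t x :: ms then
          let m' h := if (nat_of a <= h < nat_of a + size x)%N
                      then nth (WNum 0) x (h - nat_of a) else m h in
          let s := Pe k m' q o (Num.max t0 t + alpha + (size x)%:R * beta) u in
          Config [eta pes c with i |-> s]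
            (fun src dst =>
               if (src == j) && (dst == i) then ms else chan c src dst)
        else c
      else c
  | _ => Config [eta pes c with i |-> local_step (pes c i) r] (chan c)
  end.

Definition draws (s : pe) : nat :=
  if code s is Rand _ e :: _ then maxn 1 (num (eval (memory s) e)) else 1%N.

(* Expectation of [f] over the configurations reached from [c] by the schedule
   [sched] (which PE acts next), all random choices being independent. *)
Fixpoint expect (sched : seq 'I_p) (f : config -> R) (c : config) : R :=
  if sched is i :: sched' then
    (\sum_(r < draws (pes c i)) expect sched' f (step c i r))
      / (draws (pes c i))%:R
  else f c.

(* Receives name their source, channels are FIFO and all clocks are local, hence
   results and times do not depend on the interleaving of the PEs; we use
   round-robin scheduling. *)
Definition rounds (m : nat) : seq 'I_p := flatten (nseq m (enum 'I_p)).

Definition elapsed (c : config) : R :=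
  \big[Num.max/0]_(i < p) Num.max (clock (pes c i)) (port (pes c i)).

Definition halted (c : config) : bool :=
  [forall i, nilp (code (pes c i))] && [forall i, forall j, nilp (chan c i j)].

(* PE number i finds p, i and the arguments of the operation in its memory. *)
Definition initial (prog : cmd) (args : seq nat) (Q : 'I_p -> seq T) : config :=
  Config (fun i => Pe [:: prog] (fun a => WNum (nth 0%N [:: p, val i & args] a))
                      (Q i) [::] 0 0)
         (fun _ _ => [::]).

Definition content (Q : 'I_p -> seq T) : seq T :=
  flatten [seq Q i | i <- enum 'I_p].

Definition well_formed (Q : 'I_p -> seq T) : bool :=
  [forall i, sorted (fun x y => x < y)%O (Q i)] && uniq (content Q).

Definition smallest (Q : 'I_p -> seq T) (k : nat) : seq T :=
  take k (sort (fun x y => x <= y)%O (content Q)).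

(* For some k in {klo, ..., khi}, the k smallest objects of Q have been removed,
   and each PE has reported those that it holds. *)
Definition delivered (Q : 'I_p -> seq T) (klo khi : nat) (c : config) : bool :=
  [exists k : 'I_khi.+1, (klo <= k)%N &&
    [forall i,
       (out (pes c i) == [seq x <- Q i | x \in smallest Q k]) &&
       (queue (pes c i) == [seq x <- Q i | x \notin smallest Q k])]].

End Machine.

Section ExpectedTime.
Variables (R : realType) (disp : Order.disp_t) (T : orderType disp).
Variables (w : nat) (alpha beta : R) (p : nat).

(* [elapsed] never decreases along a run and halted configurations do not
   change; so both suprema are limits in the number m of rounds, namely
   the expected time of the whole run (by monotone convergence) and the
   probability that it eventually halts in a configuration satisfying P. *)
Definition expected_time (c : config R T p) : \bar R :=
  ereal_sup (range (fun m : nat =>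
    (expect w alpha beta (rounds p m) (@elapsed R disp T p) c)%:E)).

Definition halting_probability (P : config R T p -> bool) (c : config R T p)
    : \bar R :=
  ereal_sup (range (fun m : nat =>
    (expect w alpha beta (rounds p m)
       (fun c' => (halted c' && P c')%:R) c)%:E)).

Definition deleteMin_within (prog : cmd) (args : seq nat) (Q : 'I_p -> seq T)
    (klo khi : nat) (B : R) : Prop :=
  halting_probability (delivered Q klo khi) (initial R prog args Q) = 1%E /\
  (expected_time (initial R prog args Q) <= B%:E)%E.

End ExpectedTime.

(* The usual word-RAM convention: words have c log N bits, where N bounds all
   problem parameters.  Asking a program to work for every such w prevents it from
   packing more than a constant number of parameters or indices into a word. *)
Definition fits (c N w : nat) : Prop := (N ^ c <= 2 ^ w)%N.

(* Main.v *)
(* All three parts use the same program.  As long as the number L of objects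
   selected so far is below klo, every PE draws for each of d independent trials
   a number u uniform below 2 (khi - L) and proposes its local object of rank
   l + u, where l is its share of L.  The minimum of the proposals is a random
   threshold; a pipelined tree reduction finds the thresholds of all trials at
   once, a second one their global ranks, and the largest rank that is at most
   khi is adopted.  An object x of global rank m in [L, khi) is the threshold if
   the PE holding x draws the exact offset of x, which happens with probability
   1 / (2 (khi - L)), and no other PE draws a number below its offset of x; since
   the offsets add up to m - L, the union bound gives probability at least 1/2
   for the latter.  So a trial hits [a, khi] with probability at least
   (khi + 1 - a) / (4 (khi - L)).  For flexible batches (a = klo) a round thus
   succeeds with constant probability; for fixed ones (a = k - (k - L) / 2) it
   halves k - L with constant probability.

   Steps of different PEs commute, and additional steps only increase the
   elapsed time; so it suffices to analyse one convenient order of execution. *)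
From mathcomp Require Import all_boot all_order all_algebra.
From mathcomp Require Import boolp classical_sets reals constructive_ereal ereal exp.
From mathcomp Require Import zify ring lra.
Require Import Defs.
Set Implicit Arguments.
Unset Strict Implicit.
Unset Printing Implicit Defensive.
Import Order.TTheory GRing.Theory Num.Theory.
Local Open Scope ring_scope.

(** * Schedules *)

(** Expected time is a supremum over truncated round-robin runs, while the analysis executes whole
    phases, PE after PE. Both goals (expected elapsed time, probability of not having halted) are
    therefore instances of one predicate [X F c b] that survives executing an enabled step first, so
    the program is executed symbolically only once. The budget [F] makes truncated runs accessible
    to induction: one pass through the main loop costs every PE one unit. The number of rounds is
    controlled by a potential of the number [L] of selected objects that falls by at least 1 per
    round in expectation. This bounds the expected number of rounds by the initial potential, and
    the probability of needing more than [n] rounds by that potential over [n + 1]. The vector of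
    [d] words is cut into as many packets as the tree has levels. A pass then takes about log p
    periods of alpha + (d / log p) beta, which is alpha log p + beta d. One case escapes the count
    of hit ranks: if the whole queue has at most [khi] objects, high ranks do not exist, and success
    is the event that no PE finds an object to propose. *)

Section Semantics.
Variables (R : realFieldType) (disp : Order.disp_t) (T : orderType disp).
Variables (w : nat) (alpha beta : R) (p : nat).
Local Notation config := (config R T p).
Local Notation pe := (pe R T).
Local Notation step := (@step R disp T w alpha beta p).
Local Notation expect := (@expect R disp T w alpha beta p).
Local Notation draws := (@draws R disp T w).
Local Notation local_step := (@local_step R disp T w).
Local Notation ev := (@eval disp T w).
Implicit Types (c : config) (i j : 'I_p).

Definition source (s : pe) : option 'I_p :=
  if code s is Recv b _ :: _ then insub (num (ev (memory s) b)) else None.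

(** A PE is disabled if it has no code left or waits at a [Recv] whose channel is empty or whose
    source is no PE. In these cases [step] changes nothing. *)
Definition enabled c i : bool :=
  match code (pes c i) with
  | [::] => false
  | Recv _ _ :: _ => if source (pes c i) is Some j then ~~ nilp (chan c j i) else false
  | _ => true
  end.

Definition upd (A : eqType) B (f : A -> B) x y := fun z => if z == x then y else f z.

Lemma fwithE (A : eqType) B (f : A -> B) x y : ([eta f with x |-> y] : A -> B) = upd f x y.
Proof. by apply/funext => z. Qed.

Lemma upd_id (A : eqType) B (f : A -> B) x : upd f x (f x) = f.
Proof. by apply/funext => z; rewrite /upd; case: eqP => [->|]. Qed.

Definition sent_to (s : pe) : option nat :=
  if code s is Send d _ _ :: _ then Some (num (ev (memory s) d)) else None.

Definition sent_message (s : pe) : message R T :=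
  if code s is Send d a l :: _ then
    Message (Num.max (clock s) (port s))
      [seq memory s (num (ev (memory s) a) + h)%N
      | h <- iota 0 (num (ev (memory s) l))]
  else Message 0 [::].

Definition received (s : pe) c i : message R T :=
  if source s is Some j then head (Message 0 [::]) (chan c j i) else Message 0 [::].

Definition act (s : pe) (x : message R T) (r : nat) : pe :=
  let: Pe cd m q o t0 u := s in
  match cd with
  | Send d a l :: k =>
      let t := Num.max t0 u in
      Pe k m q o (t + 1) (t + alpha + (size (payload (sent_message s)))%:R * beta)
  | Recv b a :: k =>
      let na := num (ev m a) in
      let y := payload x in
      Pe k (fun h => if (na <= h < na + size y)%N
                      then nth (WNum 0) y (h - na) else m h)
        q o (Num.max t0 (start x) + alpha + (size y)%:R * beta) u
  | _ => local_step s r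
  end.

(** Normal form of a step: one PE changes by [act], at most one channel loses its head, at most one
    gains a last message. Commutation can then be checked effect by effect instead of for all pairs
    of commands. *)
Lemma stepE c i r : enabled c i ->
  step c i r = Config (upd (pes c) i (act (pes c i) (received (pes c i) c i) r))
    (fun a b => if (source (pes c i) == Some a) && (b == i) then behead (chan c a b)
       else if (a == i) && (sent_to (pes c i) == Some (val b))
       then rcons (chan c a b) (sent_message (pes c i)) else chan c a b).
Proof.
rewrite /enabled /step /received /sent_to /sent_message /source /act -fwithE.
case: (pes c i) => [[|[]]] //=; rewrite ?andbF //=.
all: try by move=> *; congr Config; apply/funext => a; apply/funext => b; rewrite ?andbF.
- move=> d a l k m q o t u _; congr Config; apply/funext => x; apply/funext => y.
  by rewrite eqE /= [X in _ && X]eq_sym.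
- move=> s a k m q o t u; case: insubP => //= j _ _.
  case E: (chan c j i) => [|x ms] //= _; case: x E => tx x E; congr Config.
  apply/funext => x'; apply/funext => y; rewrite andbF.
  have -> : (Some j == Some x') = (x' == j) by rewrite eq_sym.
  by case: andP => // -[/eqP-> /eqP->]; rewrite E.
Qed.

Lemma step_disabled c i r : ~~ enabled c i -> step c i r = c.
Proof.
have E s : pes c i = s -> Config [eta pes c with i |-> s] (chan c) = c.
  by move=> <-; rewrite fwithE upd_id; case: (c).
rewrite /enabled /step /source.
case Es: (pes c i) => [[|[|??|???|??|??|??|?|??|??|?|???|b a] k] m q o t u] //=.
  by move=> _; rewrite E.
by case: insubP => [j _ _|_] //=; case: (chan c j i).
Qed.

Lemma draws_disabled c i : ~~ enabled c i -> draws (pes c i) = 1%N.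
Proof. by rewrite /enabled /draws; case: (pes c i) => [[|[]]]. Qed.

Lemma draws_gt0 s : (0 < draws s)%N.
Proof. by rewrite /draws; case: s => [[|[]]] //= *; rewrite leq_max. Qed.

Lemma pes_step_neq c i j r : i != j -> pes (step c i r) j = pes c j.
Proof.
have [e nij|ne _] := boolP (enabled c i); last by rewrite step_disabled.
by rewrite stepE //= /upd eq_sym (negbTE nij).
Qed.

Lemma received_enabled c i a : enabled c i -> source (pes c i) = Some a ->
  chan c a i = received (pes c i) c i :: behead (chan c a i).
Proof.
move=> ei es; rewrite /received es.
suff: ~~ nilp (chan c a i) by case: (chan c a i).
by move: ei; rewrite /enabled es; move: es; rewrite /source; case: (code _) => [|[]].
Qed.

(** Only [j] itself removes messages from channels leading to [j]. So the head of such a channel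
    survives the steps of others, and with it the enabledness of [j] and the message it will
    receive. *)
Lemma chan_step_neq c i j r a : i != j -> enabled c i -> ~~ nilp (chan c a j) ->
  exists l, chan (step c i r) a j = chan c a j ++ l.
Proof.
move=> nij e ne; rewrite stepE //= [j == i]eq_sym (negbTE nij) andbF.
case: ifP => _; last by exists [::]; rewrite cats0.
by exists [:: sent_message (pes c i)]; rewrite cats1.
Qed.

Lemma enabled_step c i j r : i != j -> enabled c j -> enabled (step c i r) j.
Proof.
move=> nij ej; have [ei|ni] := boolP (enabled c i); last by rewrite step_disabled.
move: ej; rewrite /enabled pes_step_neq //.
case: (pes c j) => [[|[]]] //= s a k m q o t u; rewrite /source /=.
case: insubP => //= b _ _ ne.
by have [l ->] := chan_step_neq r nij ei ne; case: (chan c b j) ne.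
Qed.

Lemma received_step c i j r : i != j -> enabled c i -> enabled c j ->
  received (pes c j) (step c i r) j = received (pes c j) c j.
Proof.
move=> nij ei ej; rewrite /received.
case E: (source (pes c j)) => [a|] //.
have ne : ~~ nilp (chan c a j) by rewrite (received_enabled ej E).
by have [l ->] := chan_step_neq r nij ei ne; case: (chan c a j) ne.
Qed.

(** The only possible interference is that one PE sends into the channel from which the other
    receives. That channel is nonempty because the receiver is enabled, and on a nonempty list
    [behead] and [rcons] commute. *)
Lemma stepC c i j r r' : i != j -> enabled c i -> enabled c j ->
  step (step c i r) j r' = step (step c j r') i r.
Proof.
move=> nij ei ej; have nji : j != i by rewrite eq_sym.
rewrite (stepE r' (enabled_step r nij ej)) (stepE r (enabled_step r' nji ei)).
rewrite !pes_step_neq // !received_step // !stepE //=; congr Config.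
  apply/funext => a; rewrite /upd; case: eqP => [->|] //.
  by rewrite (negbTE nji).
apply/funext => a; apply/funext => b.
have [bi|bi] := eqVneq b i; have [bj|bj] := eqVneq b j.
- by case/eqP: nij; rewrite -bi -bj.
- rewrite !andbT !andbF bi; case: (source (pes c i) =P Some a) => si.
    by rewrite (received_enabled ei si) /=; case: ((a == j) && _).
  by case: (a =P i) => [->|] //=; rewrite (negbTE nij).
- rewrite !andbT !andbF bj; case: (source (pes c j) =P Some a) => si.
    by rewrite (received_enabled ej si) /=; case: ((a == i) && _).
  by case: (a =P i) => [->|] //=; rewrite (negbTE nij).
- rewrite !andbF.
  case: (a =P i) => [->|//]; by rewrite (negbTE nij).
Qed.

Definition average (n : nat) (f : nat -> R) : R := (\sum_(r < n) f r) / n%:R.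

Lemma expect_cons s i f c :
  expect (i :: s) f c =
  average (draws (pes c i)) (fun r => expect s f (step c i r)).
Proof. by []. Qed.

Lemma ler_average n f g : (forall r, (r < n)%N -> f r <= g r) ->
  average n f <= average n g.
Proof.
by move=> le; rewrite ler_wpM2r ?invr_ge0 ?ler0n // ler_sum // => r _; apply: le.
Qed.

Lemma eq_average n f g : (forall r, (r < n)%N -> f r = g r) ->
  average n f = average n g.
Proof. by move=> e; congr (_ / _); apply: eq_bigr => r _; apply: e. Qed.

Lemma average_const n x : (0 < n)%N -> average n (fun=> x) = x.
Proof.
by move=> n0; rewrite /average sumr_const card_ord -[x *+ n]mulr_natr mulfK // pnatr_eq0 -lt0n.
Qed.

Lemma average1 f : average 1 f = f 0%N.
Proof. by rewrite /average big_ord_recl big_ord0 addr0 divr1. Qed.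

Lemma averageC n m (f : nat -> nat -> R) :
  average n (fun a => average m (f a)) = average m (fun b => average n (f^~ b)).
Proof.
rewrite /average -!mulr_suml exchange_big /= -!mulrA [X in _ * X]mulrC.
by under [in RHS]eq_bigr do rewrite /=.
Qed.

Lemma expect_disabled s i f c : ~~ enabled c i -> expect (i :: s) f c = expect s f c.
Proof. by move=> ni; rewrite expect_cons draws_disabled // average1 step_disabled. Qed.

Lemma expect_swap s i j f c : i != j -> enabled c i -> enabled c j ->
  expect (i :: j :: s) f c = expect (j :: i :: s) f c.
Proof.
move=> nij ei ej.
transitivity (average (draws (pes c i)) (fun a => average (draws (pes c j))
   (fun b => expect s f (step (step c i a) j b)))).
  by rewrite expect_cons; apply: eq_average => r _; rewrite expect_cons pes_step_neq.
rewrite averageC !expect_cons; apply: eq_average => r _.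
rewrite expect_cons pes_step_neq 1?eq_sym //; apply: eq_average => r' _.
by rewrite stepC.
Qed.

Definition increasing (f : config -> R) := forall c i r, f c <= f (step c i r).

Section Increasing.
Variable f : config -> R.
Hypothesis f_increasing : increasing f.

(** The new step is pushed past the schedule by commutation until it meets another step of [i] or
    the end, where monotonicity of [f] applies. A disabled [k] at the head may become enabled
    through the step of [i]; it is first dropped and then reinserted by the induction hypothesis. *)
Lemma expect_insert s i c : expect s f c <= expect (i :: s) f c.
Proof.
elim: s i c => [|k s IH] i c.
  rewrite expect_cons -[X in X <= _](average_const _ (draws_gt0 (pes c i))).
  by apply: ler_average => r _; exact: f_increasing.
have [<-|nik] := eqVneq i k.
  by rewrite !(expect_cons _ i); apply: ler_average => r _; apply: IH.
have [ei|ni] := boolP (enabled c i); last by rewrite (@expect_disabled _ i).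
have [ek|nk] := boolP (enabled c k); last first.
  rewrite expect_disabled //; apply: le_trans (IH i c) _.
  by rewrite !(expect_cons _ i); apply: ler_average => r _; apply: IH.
rewrite expect_swap // !(expect_cons _ k).
by apply: ler_average => r _; apply: IH.
Qed.

Lemma expect_cat s1 s2 c : expect s2 f c <= expect (s1 ++ s2) f c.
Proof.
elim: s1 c => [|i s1 IH] c //=.
by apply: le_trans (IH c) _; apply: expect_insert.
Qed.

(** Only an inequality: an early step of [i] may wake PEs of [s1] that would otherwise have been
    blocked, so more work is done. *)
Lemma expect_move s1 s2 i c : i \notin s1 -> enabled c i ->
  expect (s1 ++ i :: s2) f c <= expect (i :: s1 ++ s2) f c.
Proof.
elim: s1 c => [|j s1 IH] c // ; rewrite inE negb_or => /andP[nij ni] ei; rewrite !cat_cons.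
have [ej|nj] := boolP (enabled c j); last first.
  rewrite (@expect_disabled _ j) //; apply: le_trans (IH _ ni ei) _; rewrite !(expect_cons _ i).
  by apply: ler_average => r _; apply: expect_insert.
rewrite expect_swap // !(expect_cons _ j).
apply: ler_average => r _; apply: IH => //.
by rewrite enabled_step 1?eq_sym.
Qed.
End Increasing.

Definition incr (F : 'I_p -> nat) i : 'I_p -> nat := fun j => (F j + (j == i))%N.

(* An expected-cost bound [X F c b] is compatible with executing any enabled PE
   first; [F] counts how often each PE may still be scheduled. *)
Record compatible (X : ('I_p -> nat) -> config -> R -> Prop) : Prop := Compatible {
  compatible_step : forall F c i (b : nat -> R), enabled c i ->
    (forall r, (r < draws (pes c i))%N -> X F (step c i r) (b r)) ->
    X (incr F i) c (average (draws (pes c i)) b);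
  compatible_le : forall F G c b b', (forall i, F i <= G i)%N -> b <= b' ->
    X G c b -> X F c b' }.

(** All schedules within the budget are allowed, not only round-robin ones, because moving a step to
    the front destroys the round-robin form. *)
Definition expected_le (f : config -> R) (F : 'I_p -> nat) c b : Prop :=
  forall s, (forall i, (count_mem i s <= F i)%N) -> expect s f c <= b.

(** If [i] occurs in the schedule, its first occurrence is moved to the front and paid for by the
    extra unit of [incr F i]. Otherwise a step of [i] is inserted in front, which only increases the
    expectation. *)
Lemma expected_le_compatible f : increasing f -> compatible (expected_le f).
Proof.
move=> fi; split=> [F c i b ei hb s hs|F G c b b' FG bb' h s hs]; last first.
  by apply: le_trans (h _ _) bb' => i; apply: leq_trans (FG i).
have [ins|nis] := boolP (i \in s); last first.
  apply: le_trans (expect_insert fi _ i _) _; rewrite expect_cons.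
  apply: ler_average => r rd; apply: hb => // j; move: (hs j); rewrite /incr.
  by case: eqP => [->|_]; rewrite ?addn0 // (count_memPn nis).
have [s1 [s2 es] nis1] : exists2 s1, exists s2, s = s1 ++ i :: s2 & i \notin s1.
  exists (take (index i s) s); last by rewrite in_take_leq ?index_size // ltnn.
  exists (drop (index i s).+1 s).
  by rewrite -[in LHS](cat_take_drop (index i s) s) (drop_nth i) ?index_mem // nth_index.
rewrite es; apply: le_trans (expect_move fi _ nis1 ei) _; rewrite expect_cons.
apply: ler_average => r rd; apply: hb => // j; move: (hs j).
by rewrite es !count_cat /= /incr [j == i]eq_sym; lia.
Qed.

(** Here [b] bounds the probability of failure, so that, as for [expected_le], a smaller [b] is a
    stronger statement and averages over random outcomes combine in the same way. *)
Definition eventually (f : config -> R) (F : 'I_p -> nat) c b : Prop :=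
  exists K, 1 - b <= expect (rounds p K) f c.

Lemma expect_rounds_le f m n c : increasing f -> (m <= n)%N ->
  expect (rounds p m) f c <= expect (rounds p n) f c.
Proof.
move=> fi mn; rewrite -(subnK mn) /rounds nseqD flatten_cat.
exact: expect_cat.
Qed.

Lemma eventually_compatible f : increasing f -> compatible (eventually f).
Proof.
move=> fi; split=> [F c i b ei hb|F G c b b' _ bb' [K hK]]; last first.
  by exists K; apply: le_trans hK; rewrite lerB.
(* There are finitely many outcomes, and more rounds only help, so the maximum of the individual [K]
   serves all of them. One further round then surely contains a step of [i]. *)
have [K hK] : exists K, forall r, (r < draws (pes c i))%N ->
    1 - b r <= expect (rounds p K) f (step c i r).
  elim: (draws (pes c i)) hb => [|n IH] hb; first by exists 0%N.
  have [K1 h1] := IH (fun r rn => hb r (ltnW rn)).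
  have [K2 h2] := hb n (ltnSn n).
  exists (maxn K1 K2) => r; rewrite ltnS leq_eqVlt => /predU1P[->|rn].
    by apply: le_trans h2 _; apply: expect_rounds_le; rewrite ?leq_maxr.
  by apply: le_trans (h1 r rn) _; apply: expect_rounds_le; rewrite ?leq_maxl.
exists K.+1; rewrite -[1](average_const 1 (draws_gt0 (pes c i))) /average -mulrBl -sumrB.
rewrite -[X in X <= _]/(average _ (fun r => 1 - b r)).
have -> : rounds p K.+1 = enum 'I_p ++ rounds p K by [].
have := mem_enum 'I_p i; case/splitPr => s1 s2.
rewrite -catA; apply: le_trans (expect_cat fi s1 _ _); rewrite cat_cons expect_cons.
apply: ler_average => r rd; apply: le_trans (hK r rd) _; exact: expect_cat.
Qed.

(** Execution in an order of our choice without random branching: every step taken has a single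
    outcome. *)
Inductive reach : config -> config -> Prop :=
| reach_refl c : reach c c
| reach_step c i c' : enabled c i -> draws (pes c i) = 1%N ->
    reach (step c i 0) c' -> reach c c'.

Lemma reach_trans c1 c2 c3 : reach c1 c2 -> reach c2 c3 -> reach c1 c3.
Proof. by elim=> // c i c' ei di _ IH /IH; apply: reach_step. Qed.

Lemma compatible_reach X F c c' b : compatible X -> reach c c' ->
  X F c' b -> X F c b.
Proof.
move=> [Xs Xl]; elim=> // {}c i {}c' ei di _ IH /IH h.
(* The unit of budget gained by this step is given away. Budget is kept only in [unroll_all]. *)
apply: (Xl _ (incr F i)) (lexx b) _ => [j|]; first exact: leq_addr.
have := Xs F c i (fun=> b) ei; rewrite di average1; apply=> r.
by case: r.
Qed.

Lemma compatible_draw X F c i b : compatible X -> enabled c i ->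
  (forall r, (r < draws (pes c i))%N -> X F (step c i r) (b r)) ->
  X F c (average (draws (pes c i)) b).
Proof.
move=> [Xs Xl] ei h; apply: (Xl _ (incr F i)) (lexx _) _ => [j|].
  exact: leq_addr.
exact: Xs.
Qed.

Lemma expect_const s x c : expect s (fun=> x) c = x.
Proof.
elim: s c => // i s IH c; rewrite expect_cons -[RHS](average_const x (draws_gt0 (pes c i))).
by apply: eq_average => r _; apply: IH.
Qed.

Lemma ler_expect s f g c : (forall c, f c <= g c) -> expect s f c <= expect s g c.
Proof.
move=> fg; elim: s c => [|i s IH] c; first exact: fg.
by rewrite !expect_cons; apply: ler_average => r _; apply: IH.
Qed.

Lemma clock_local_step s r : clock s <= clock (local_step s r).
Proof.
case: s => [[|[|c1 c2|e c1 c2|e c1|a e|a e|a|a e|a e|e|d a l|b a] k] m q o t u] //=;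
  by rewrite lerDl ?ler0n // /tree_cost.
Qed.

Hypotheses (alpha_ge0 : 0 <= alpha) (beta_ge0 : 0 <= beta).

Lemma clock_act s x r : clock s <= clock (act s x r).
Proof.
case: s => [[|[|c1 c2|e c1 c2|e c1|a e|a e|a|a e|a e|e|d a l|b a] k] m q o t u];
  try exact: clock_local_step.
  by rewrite /= ler_wpDr // le_max lexx.
rewrite /= -addrA ler_wpDr ?le_max ?lexx //.
by rewrite addr_ge0 // mulr_ge0.
Qed.

Lemma port_act s x r : port s <= port (act s x r).
Proof.
case: s => [[|[|c1 c2|e c1 c2|e c1|a e|a e|a|a e|a e|e|d a l|b a] k] m q o t u];
  try by rewrite /= ?lexx.
rewrite /= -addrA ler_wpDr ?le_max ?lexx ?orbT //.
by rewrite addr_ge0 // mulr_ge0.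
Qed.

Lemma elapsed_increasing : increasing (@elapsed R disp T p).
Proof.
move=> c i r; have [ei|ni] := boolP (enabled c i); last by rewrite step_disabled.
apply: le_bigmax2 => j _; rewrite stepE //= /upd.
case: eqP => [->|_] //; rewrite ge_max !le_max clock_act port_act ?orbT //.
Qed.

Lemma halted_disabled c i : halted c -> enabled c i = false.
Proof. by case/andP=> /forallP/(_ i)/nilP e _; rewrite /enabled e. Qed.

Lemma halted_increasing (P : config -> bool) :
  increasing (fun c => (halted c && P c)%:R).
Proof.
move=> c i r; case: (boolP (halted c)) => [h|_]; last exact: ler0n.
by rewrite step_disabled ?halted_disabled // h.
Qed.

Lemma elapsed_le c x : 0 <= x -> (forall i, clock (pes c i) <= x) ->
  (forall i, port (pes c i) <= x) -> elapsed c <= x.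
Proof.
move=> x0 hc hp; apply/bigmax_leP; split=> // i _.
by rewrite ge_max hc hp.
Qed.

Lemma expected_le_halted f F c : halted c -> expected_le f F c (f c).
Proof.
move=> h s _; elim: s => [|i s IH] //.
by rewrite expect_disabled ?halted_disabled.
Qed.

End Semantics.

(** * Hoare logic for a single PE *)

Section Hoare.
Variables (R : realFieldType) (disp : Order.disp_t) (T : orderType disp).
Variables (w : nat) (alpha beta : R) (p : nat).
Local Notation config := (config R T p).
Local Notation pe := (pe R T).
Local Notation message := (message R T).
Local Notation step := (@step R disp T w alpha beta p).
Local Notation ev := (@eval disp T w).
Local Notation reach := (@reach R disp T w alpha beta p).
Local Notation enabled := (@enabled R disp T w p).

(** One PE together with the channels leading to and from it: everything that its own steps can read
    or change. [put] writes such a state back into a configuration. *)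
Record st := St {
  mem : nat -> word T; que : seq T; rep : seq T; clk : R; prt : R;
  inb : 'I_p -> seq message; outb : 'I_p -> seq message }.

Definition pe_of k (s : st) : pe := Pe k (mem s) (que s) (rep s) (clk s) (prt s).

Definition put (c : config) i k s : config :=
  Config (upd (pes c) i (pe_of k s))
    (fun a b => if a == i then (if b == i then chan c a b else outb s b)
                else if b == i then inb s a else chan c a b).

Definition look (c : config) i : st :=
  let s := pes c i in
  St (memory s) (queue s) (out s) (clock s) (port s)
     (fun a => chan c a i) (fun b => chan c i b).

Lemma put_look c i k : code (pes c i) = k -> put c i k (look c i) = c.
Proof.
case: c => ps ch /= E; congr Config.
  apply/funext => j; rewrite /upd; case: eqP => [->|//].
  by rewrite /pe_of /= -E; case: (ps i).
apply/funext => a; apply/funext => b.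
by case: eqP => [->|_]; case: eqP => [->|].
Qed.

Definition setpe (x : pe) (s : st) : st :=
  St (memory x) (queue x) (out x) (clock x) (port x) (inb s) (outb s).

Definition is_local (x : cmd) : bool :=
  match x with Send _ _ _ | Recv _ _ | Rand _ _ => false | _ => true end.

Lemma step_local c i x k s r : ~~ (if x is (Send _ _ _ | Recv _ _) then true else false) ->
  step (put c i (x :: k) s) i r =
  let y := local_step w (pe_of (x :: k) s) r in put c i (code y) (setpe y s).
Proof.
move=> lx; rewrite stepE; last first.
  by rewrite /enabled /= /upd eqxx; case: x lx.
rewrite /= /put /=; congr Config.
  apply/funext => j; rewrite /upd eqxx; case: eqP => // _.
  by rewrite /pe_of /setpe /=; case: x lx.
apply/funext => a; apply/funext => b.
rewrite /source /sent_to /upd eqxx /=.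
by case: x lx => //= *; rewrite ?andbF.
Qed.

Lemma reach_local c i x k s : is_local x ->
  let y := local_step w (pe_of (x :: k) s) 0 in
  reach (put c i (x :: k) s) (put c i (code y) (setpe y s)).
Proof.
move=> lx; apply: (@reach_step _ _ _ _ _ _ _ _ i).
- by rewrite /enabled /= /upd eqxx; case: x lx.
- by rewrite /draws /= /upd eqxx; case: x lx.
- by rewrite step_local; [exact: reach_refl | case: x lx].
Qed.

(** A total-correctness weakest precondition, uniform in the remaining code and in the other PEs. As
    it rests on [reach], random draws stay outside this logic; they are treated in [draw_spec]. *)
Definition W (i : 'I_p) (x : cmd) (Q : st -> Prop) (s : st) : Prop :=
  forall c k, exists2 s', Q s' & reach (put c i (x :: k) s) (put c i k s').

Definition tick (t : R) (s : st) : st :=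
  St (mem s) (que s) (rep s) (clk s + t) (prt s) (inb s) (outb s).
Definition setm (m : nat -> word T) (s : st) : st :=
  St m (que s) (rep s) (clk s) (prt s) (inb s) (outb s).
Definition store a v (s : st) : st := setm (upd (mem s) a v) (tick 1 s).

Implicit Types (i : 'I_p) (s : st) (Q : st -> Prop).

Lemma tick_tick t t' s : tick t' (tick t s) = tick (t + t') s.
Proof. by rewrite /tick /= addrA. Qed.

Lemma setm_tick m m' t t' s :
  setm m' (tick t' (setm m (tick t s))) = setm m' (tick (t + t') s).
Proof. by rewrite /setm /tick /= addrA. Qed.

Lemma tick_setm m t t' s : tick t' (setm m (tick t s)) = setm m (tick (t + t') s).
Proof. by rewrite /setm /tick /= addrA. Qed.

Lemma store_setm a v m t s :
  store a v (setm m (tick t s)) = setm (upd m a v) (tick (t + 1) s).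
Proof. by rewrite /store tick_setm. Qed.

Lemma W_mono i x Q Q' s : (forall s, Q s -> Q' s) -> W i x Q s -> W i x Q' s.
Proof. by move=> QQ h c k; have [s' qs r] := h c k; exists s'; first exact: QQ. Qed.

Lemma W_skip i Q s : Q (tick 1 s) -> W i Skip Q s.
Proof. by move=> q c k; exists (tick 1 s) => //; apply: (@reach_local c i Skip k s). Qed.

Lemma W_seq i x y Q s : W i x (W i y Q) (tick 1 s) -> W i (Seq x y) Q s.
Proof.
move=> h c k; have [s1 h1 r1] := h c (y :: k); have [s2 h2 r2] := h1 c k.
exists s2 => //; apply: reach_trans (reach_trans r1 r2).
exact: (@reach_local c i (Seq x y) k s).
Qed.

Lemma W_if i e x y Q s :
  (if num (ev (mem s) e) != 0%N then W i x Q (tick 1 s) else W i y Q (tick 1 s)) ->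
  W i (If e x y) Q s.
Proof.
move=> h c k; have := @reach_local c i (If e x y) k s isT => /=.
by case: ifP h => _ h r; have [s1 h1 r1] := h c k; exists s1 => //; apply: reach_trans r1.
Qed.

Lemma W_while i e x Q s :
  (if num (ev (mem s) e) != 0%N then W i x (W i (While e x) Q) (tick 1 s)
   else Q (tick 1 s)) ->
  W i (While e x) Q s.
Proof.
move=> h c k; have := @reach_local c i (While e x) k s isT => /=.
case: ifP h => _ h r; last by exists (tick 1 s).
have [s1 h1 r1] := h c (While e x :: k); have [s2 h2 r2] := h1 c k.
by exists s2 => //; apply: reach_trans (reach_trans r1 r2).
Qed.

Lemma W_assign i a e x v Q s : ev (mem s) a = WNum x -> ev (mem s) e = v ->
  Q (store x v s) -> W i (Assign a e) Q s.
Proof.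
move=> ea ee q c k; exists (store x v s) => //.
have := @reach_local c i (Assign a e) k s isT.
by rewrite /= ea ee fwithE.
Qed.

Lemma W_size i a x Q s : ev (mem s) a = WNum x ->
  Q (store x (WNum (size (que s))) s) -> W i (Size a) Q s.
Proof.
move=> ea q c k; eexists; first exact: q.
have := @reach_local c i (Size a) k s isT.
by rewrite /= ea fwithE.
Qed.

Definition nth_word (q : seq T) h : word T :=
  if drop h q is y :: _ then WObj y else WNum 0.

Lemma W_select i a e x h Q s : ev (mem s) a = WNum x -> ev (mem s) e = WNum h ->
  Q (setm (upd (mem s) x (nth_word (que s) h)) (tick (tree_cost R h) s)) ->
  W i (Select a e) Q s.
Proof.
move=> ea ee q c k; eexists; first exact: q.
have := @reach_local c i (Select a e) k s isT.
by rewrite /= ea ee fwithE.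
Qed.

Lemma W_rank i a e x y Q s : ev (mem s) a = WNum x -> ev (mem s) e = WObj y ->
  let j := count (fun z => (z < y)%O) (que s) in
  Q (setm (upd (mem s) x (WNum j)) (tick (tree_cost R j) s)) ->
  W i (Rank a e) Q s.
Proof.
move=> ea ee j q c k; rewrite {}/j in q *; eexists; first exact: q.
have := @reach_local c i (Rank a e) k s isT.
by rewrite /= ea ee fwithE.
Qed.

Lemma W_remove i e h Q s : ev (mem s) e = WNum h ->
  Q (St (mem s) (drop h (que s)) (rep s ++ take h (que s))
        (clk s + tree_cost R h) (prt s) (inb s) (outb s)) ->
  W i (Remove e) Q s.
Proof.
move=> ee q c k; eexists; first exact: q.
have := @reach_local c i (Remove e) k s isT.
by rewrite /= ee.
Qed.

Lemma W_send i (j : 'I_p) d a l b n Q s : j != i ->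
  ev (mem s) d = WNum (val j) -> ev (mem s) a = WNum b -> ev (mem s) l = WNum n ->
  let t := Num.max (clk s) (prt s) in
  Q (St (mem s) (que s) (rep s) (t + 1) (t + alpha + n%:R * beta) (inb s)
        (upd (outb s) j (rcons (outb s j)
           (Message t [seq mem s (b + h)%N | h <- iota 0 n])))) ->
  W i (Send d a l) Q s.
Proof.
move=> nji ed ea el t q c k; eexists; first exact: q.
apply: (@reach_step _ _ _ _ _ _ _ _ i).
- by rewrite /enabled /= /upd eqxx.
- by rewrite /draws /= /upd eqxx.
rewrite stepE /=; last by rewrite /enabled /= /upd eqxx.
rewrite (_ : Config _ _ = put c i k (St (mem s) (que s) (rep s) (t + 1)
  (t + alpha + n%:R * beta) (inb s)
        (upd (outb s) j (rcons (outb s j)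
           (Message t [seq mem s (b + h)%N | h <- iota 0 n]))))).
  exact: reach_refl.
rewrite /put; congr Config.
  apply/funext => x; rewrite /= /upd /= eqxx; case: eqP => // _.
  by rewrite /pe_of /sent_message /= ea el /= size_map size_iota.
apply/funext => x; apply/funext => y.
rewrite /source /sent_to /sent_message /upd eqxx /= ed ea el /=.
rewrite (_ : (Some (val j) == Some (val y)) = (y == j)); last by rewrite eq_sym.
case: (x == i) => //=; case: (y =P j) => [->|_]; first by rewrite (negbTE nji).
by [].
Qed.

Lemma W_recv i (j : 'I_p) d a b t x ms Q s : j != i ->
  ev (mem s) d = WNum (val j) -> ev (mem s) a = WNum b ->
  inb s j = Message t x :: ms ->
  Q (St (fun h => if (b <= h < b + size x)%N then nth (WNum 0) x (h - b) else mem s h)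
        (que s) (rep s) (Num.max (clk s) t + alpha + (size x)%:R * beta) (prt s)
        (upd (inb s) j ms) (outb s)) ->
  W i (Recv d a) Q s.
Proof.
move=> nji ed ea eib q c k; eexists; first exact: q.
have nij : i != j by rewrite eq_sym.
have src : insub (val j) = Some j by exact: valK.
have en : enabled (put c i (Recv d a :: k) s) i.
  by rewrite /enabled /= /source /upd eqxx /= ed src (negbTE nji) eib.
apply: (@reach_step _ _ _ _ _ _ _ _ i _ en).
- by rewrite /draws /= /upd eqxx.
rewrite stepE //=.
match goal with |- reach _ ?y => rewrite (_ : Config _ _ = y) end.
  exact: reach_refl.
rewrite /put; congr Config.
  apply/funext => y; rewrite /= /upd /= eqxx; case: eqP => // _.
  rewrite /received /source /pe_of /= ed src /= (negbTE nji) eib /= ea.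
  by rewrite eqxx.
apply/funext => y; apply/funext => z.
rewrite /source /sent_to /upd eqxx /= ed src andbF.
have -> : (Some j == Some y) = (y == j) by rewrite eq_sym.
case: (y =P j) => [->|_] //=; rewrite (negbTE nji).
by case: (z == i); rewrite ?eib.
Qed.

Hypothesis Hw : (128 <= 2 ^ w)%N.

Lemma ev_const m n : (n < 128)%N -> ev m (Const n) = WNum n.
Proof. by move=> h /=; rewrite modn_small // (leq_trans h). Qed.

Lemma ev_at m e x : ev m e = WNum x -> ev m (At e) = m x.
Proof. by move=> /= ->. Qed.

Lemma ev_var m n : (n < 128)%N -> ev m (At (Const n)) = m n.
Proof. by move=> h; apply: ev_at; apply: ev_const. Qed.

Section Bin.
Variables (m : nat -> word T) (e1 e2 : expr) (x y : nat).
Hypotheses (h1 : ev m e1 = WNum x) (h2 : ev m e2 = WNum y).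

Lemma ev_add : (x + y < 2 ^ w)%N -> ev m (Bin OpAdd e1 e2) = WNum (x + y).
Proof. by move=> h; rewrite /= h1 h2 /= modn_small. Qed.
Lemma ev_sub : ev m (Bin OpSub e1 e2) = WNum (x - y).
Proof. by rewrite /= h1 h2. Qed.
Lemma ev_div : ev m (Bin OpDiv e1 e2) = WNum (x %/ y).
Proof. by rewrite /= h1 h2. Qed.
Lemma ev_lt : ev m (Bin OpLt e1 e2) = WNum (x < y)%N.
Proof. by rewrite /= h1 h2. Qed.
End Bin.

Definition For (j : nat) (n : expr) (body : cmd) : cmd :=
  Seq (Assign (Const j) (Const 0))
    (While (Bin OpLt (At (Const j)) n)
       (Seq body (Assign (Const j) (Bin OpAdd (At (Const j)) (Const 1))))).

Lemma W_for i j n body N (I : nat -> st -> Prop) Q s :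
  (j < 128)%N -> (N < 2 ^ w)%N ->
  (forall x s, I x s -> mem s j = WNum x /\ ev (mem s) n = WNum N) ->
  I 0%N (store j (WNum 0) (tick 1 s)) ->
  (forall x s, (x < N)%N -> I x s ->
     W i body (fun s' => mem s' j = WNum x /\ I x.+1 (store j (WNum x.+1) s'))
       (tick 2 s)) ->
  (forall s, I N s -> Q (tick 1 s)) ->
  W i (For j n body) Q s.
Proof.
move=> hj hN hI h0 hb hQ; apply: W_seq.
apply: W_assign; [exact: ev_const | exact: ev_const |].
set s0 := store _ _ _.
have loop k x s1 : (k = N - x)%N -> (x <= N)%N -> I x s1 ->
    W i (While (Bin OpLt (At (Const j)) n)
       (Seq body (Assign (Const j) (Bin OpAdd (At (Const j)) (Const 1))))) Q s1.
  elim: k x s1 => [|k IH] x s1 hk hx hs1; have [m1 m2] := hI _ _ hs1.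
    apply: W_while; rewrite (ev_lt (x := x) _ m2) ?ev_var //=.
    have -> : x = N by lia.
    rewrite ltnn /=; apply: hQ; congr (I _ _): hs1; lia.
  apply: W_while; rewrite (ev_lt (x := x) _ m2) ?ev_var //=.
  have xN : (x < N)%N by lia.
  rewrite xN /=; apply: W_seq.
  have -> : tick 1 (tick 1 s1) = tick 2 s1.
    by rewrite /tick /= -addrA; congr St; congr (_ + _); lra.
  apply: W_mono (hb _ _ xN hs1) => s2 [mj hI2].
  apply: W_assign; first exact: ev_const.
    apply: (ev_add (x := x) (y := 1)); rewrite ?ev_var ?ev_const //; lia.
  by rewrite addn1; apply: (IH x.+1) => //; lia.
exact: (loop (N - 0)%N 0%N).
Qed.

(** For bodies that touch only memory and clock. Of the cost [cb] of an iteration, 3 units are the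
    loop test, the [Seq] and the increment; the 3 in the total is the initial [Seq], the
    initialisation and the last test. *)
Lemma W_for_setm i j n body N (cb : R) (I : nat -> (nat -> word T) -> Prop) Q s :
  (j < 128)%N -> (N < 2 ^ w)%N -> (forall x m, I x m -> m j = WNum x /\ ev m n = WNum N) ->
  I 0%N (upd (mem s) j (WNum 0)) ->
  (forall x s', (x < N)%N -> I x (mem s') -> que s' = que s ->
     W i body (fun s2 => exists (m : nat -> word T) (t : R), [/\ s2 = setm m (tick t s'),
       t <= cb - 3, m j = WNum x & I x.+1 (upd m j (WNum x.+1))]) s') ->
  (forall (m : nat -> word T) (t : R), t <= 3 + N%:R * cb -> I N m -> Q (setm m (tick t s))) ->
  W i (For j n body) Q s.
Proof.
move=> hj hN hI h0 hb hQ; apply: (@W_for i j n body N (fun x s' =>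
  exists m t, [/\ s' = setm m (tick t s), t <= 2 + x%:R * cb & I x m])) => //.
- by move=> x s' [m [t [-> _ /hI]]].
- exists (upd (mem s) j (WNum 0)), 2; split=> //; last by lra.
  by rewrite /store /tick /setm /= -addrA; congr (St _ _ _ (_ + _) _ _ _); lra.
- move=> x s' xN [m [t [-> ht hi]]].
  apply: W_mono (hb x (tick 2 (setm m (tick t s))) xN hi erefl) => s2 [m' [t' [-> ht' mj hi']]].
  split=> //; exists (upd m' j (WNum x.+1)), (t + 2 + t' + 1); split=> //.
    by rewrite tick_setm setm_tick store_setm.
  by rewrite -[x.+1%:R]natr1 mulrDl; lra.
move=> s' [m [t [-> ht hi]]]; rewrite (_ : tick 1 _ = setm m (tick (t + 1) s)).
  by apply: hQ => //; lra.
by rewrite /tick /setm /= addrA.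
Qed.

End Hoare.

(** * Pipelined reduction along a binary tree *)

(* Without the inequalities of the abstract ring, [lia] stays fast. *)
Ltac nlia := repeat match goal with
  | H : context [@Order.le _ _ _ _] |- _ => clear H
  | H : context [@Order.lt _ _ _ _] |- _ => clear H end; lia.
Notation V n := (At (Const n)).
Notation "e1 :+ e2" := (Bin OpAdd e1 e2) (at level 50).
Notation "e1 :- e2" := (Bin OpSub e1 e2) (at level 50).
Notation "e1 :< e2" := (Bin OpLt e1 e2) (at level 70).

(* Memory map: 0-4 the arguments p, i, klo, khi, d; 5 the number of packets;
   6 the packet length; 7 and 8 the global and the local number of objects
   selected so far; 9 the address of the array of ranks; 10 the address of the
   receive buffer; from 16 on scratch variables; at 64 the array of candidates. *)
Definition left_child : expr := (V 1 :+ V 1) :+ Const 1.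
Definition right_child : expr := (V 1 :+ V 1) :+ Const 2.
Definition parent : expr := Bin OpDiv (V 1 :- Const 1) (Const 2).

Definition combine_loop (comb : expr -> expr -> cmd) : cmd :=
  For 18 (V 6) (comb (V 17 :+ V 18) (V 10 :+ V 18)).

Definition receive_from comb (e : expr) : cmd :=
  If (e :< V 0) (Seq (Recv e (V 10)) (combine_loop comb)) Skip.

(** PEs form a binary heap with root 0. Address 17 points to the current packet, which is sent on
    before the next one is awaited, so that different levels work on different packets
    simultaneously. *)
Definition up comb (base : expr) : cmd :=
  Seq (Assign (Const 17) base)
    (For 20 (V 5)
      (Seq (receive_from comb left_child)
      (Seq (receive_from comb right_child)
      (Seq (If (V 1) (Send parent (V 17) (V 6)) Skip)
           (Assign (Const 17) (V 17 :+ V 6)))))).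

Definition send_down (e : expr) : cmd := If (e :< V 0) (Send e (V 17) (V 6)) Skip.

Definition down (base : expr) : cmd :=
  Seq (Assign (Const 17) base)
    (For 20 (V 5)
      (Seq (If (V 1) (Recv parent (V 17)) Skip)
      (Seq (send_down left_child)
      (Seq (send_down right_child)
           (Assign (Const 17) (V 17 :+ V 6)))))).

Section Collective.
Variables (R : realFieldType) (disp : Order.disp_t) (T : orderType disp).
Variables (w : nat) (alpha beta : R) (p : nat).
Hypothesis Hw : (128 <= 2 ^ w)%N.
Local Notation message := (message R T).
Local Notation ev := (@eval disp T w).
Local Notation W := (@W R disp T w alpha beta p).
Local Notation st := (@st R disp T p).
Implicit Types (i : 'I_p) (s : st).

Definition implements (comb : expr -> expr -> cmd) (op : word T -> word T -> word T) :=
  forall i s a b x y (Q : st -> Prop),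
    ev (mem s) a = WNum x -> ev (mem s) b = WNum y ->
    (forall t, t <= 4 -> Q (setm (upd (mem s) x (op (mem s x) (mem s y))) (tick t s))) ->
    W i (comb a b) Q s.

(* [h] packets of [S] words; [bz] is the address of the receive buffer. *)
Variables (h S bz : nat) (aa : R).
Hypothesis aa_ge0 : 0 <= aa.
(** The bound on the transmission time is required only if there is someone to talk to. For a single
    PE [aa] may be 0, which matters in part (iii), where the alpha term is multiplied by ln p =
    0. *)
Hypothesis aa_alpha : (1 < p)%N -> alpha + S%:R * beta <= aa.
Hypotheses (hw_z : (bz + S < 2 ^ w)%N) (hw_p : (p + p + 4 < 2 ^ w)%N)
  (hw_h : (h < 2 ^ w)%N).

Variables (comb : expr -> expr -> cmd) (op : word T -> word T -> word T).
Hypothesis comb_op : implements comb op.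

Definition env i (m : nat -> word T) : Prop :=
  [/\ m 0%N = WNum p, m 1%N = WNum (val i), m 5%N = WNum h, m 6%N = WNum S
    & m 10%N = WNum bz].

Lemma combine_loop_spec i s pos (Q : st -> Prop) :
  env i (mem s) -> mem s 17%N = WNum pos -> (64 <= pos)%N -> (pos + S <= bz)%N ->
  (forall (m : nat -> word T) (t : R), t <= 3 + 7 * S%:R ->
    (forall a : nat, a != 18%N -> m a = if (pos <= a < pos + S)%N
       then op (mem s a) (mem s (bz + (a - pos))) else mem s a) ->
    Q (setm m (tick t s))) ->
  W i (combine_loop comb) Q s.
Proof.
move=> [m0 m1 m5 m6 m10] m17 pos64 posz hQ.
have hS : (S < 2 ^ w)%N by nlia.
apply: (@W_for_setm _ _ _ _ _ _ _ Hw _ _ _ _ S 7 (fun x m => m 18%N = WNum x /\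
   forall a, a != 18%N -> m a = if (pos <= a < pos + x)%N
     then op (mem s a) (mem s (bz + (a - pos))) else mem s a)) => //.
- by move=> x m [mx me]; split=> //; rewrite ev_var // me // ifF //; nlia.
- split=> // a na; rewrite /upd (negbTE na) addn0.
  by rewrite (_ : (_ <= _ < _)%N = false) //; nlia.
- move=> x s' xS [mx me] _.
  have mn n : (n < 64)%N -> n != 18%N -> mem s' n = mem s n.
    by move=> n64 n18; rewrite me // (_ : (_ <= _ < _)%N = false) //; nlia.
  apply: comb_op.
  + by apply: (ev_add (x := pos) (y := x)); rewrite ?ev_var //= ?mn //; nlia.
  + by apply: (ev_add (x := bz) (y := x)); rewrite ?ev_var //= ?mn //; nlia.
  move=> t ht; do 2 eexists; split; [reflexivity | lra | |].
    by rewrite /upd; case: eqP => //; nlia.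
  split=> // a na; rewrite {1}/upd (negbTE na) /upd; case: eqP => [->|nax].
    rewrite (_ : (_ <= _ < _)%N = true); last by nlia.
    rewrite me; last by nlia.
    rewrite (_ : (_ <= _ < _)%N = false); last by nlia.
    rewrite me; last by nlia.
    rewrite (_ : (_ <= _ < _)%N = false); last by nlia.
    by congr (op _ (mem s _)); nlia.
  rewrite me //; congr (if _ then _ else _); apply/idP/idP; nlia.
- by move=> m t ht [_ me]; apply: hQ => //; lra.
Qed.

Lemma receive_from_spec i s e n pos (Q : st -> Prop) (l : seq message) y :
  env i (mem s) -> mem s 17%N = WNum pos -> (64 <= pos)%N -> (pos + S <= bz)%N ->
  ev (mem s) e = WNum n -> n != i ->
  (forall j : 'I_p, val j = n -> inb s j = y :: l) -> size (payload y) = S ->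
  (forall (m : nat -> word T) (t : R) (ib : 'I_p -> seq message), t <= (if (n < p)%N then Num.max (clk s) (start y) else clk s)
                       + aa + 7 + 7 * S%:R ->
    (forall j : 'I_p, ib j = if val j == n then l else inb s j) ->
    (forall a : nat, a != 18%N -> (a < bz)%N -> m a = if (n < p)%N && (pos <= a < pos + S)%N
       then op (mem s a) (nth (WNum 0) (payload y) (a - pos)) else mem s a) ->
    Q (St m (que s) (rep s) t (prt s) ib (outb s))) ->
  W i (receive_from comb e) Q s.
Proof.
move=> he m17 pos64 posz ee ni hi hy hQ; have [m0 m1 m5 m6 m10] := he.
apply: W_if; rewrite (ev_lt ee (y := p)) ?ev_var //=.
case: (ltnP n p) hQ => [np|pn] /= hQ; last first.
  apply: W_skip; have := hQ (mem s) (clk s + 1 + 1) (inb s); apply.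
  - have S0 := ler0n R S; have a0 := aa_ge0; lra.
  - by move=> j; case: eqP => // jn; have := ltn_ord j; rewrite -jn in pn; nlia.
  - by [].
apply: W_seq; set j := Ordinal np.
have nji : j != i by rewrite -val_eqE.
apply: (@W_recv _ _ _ _ _ _ _ i j _ _ bz (start y) (payload y) l) => //.
- by rewrite /= -/(ev (mem s) (V 10)) ev_var.
- by rewrite /= (hi j) //; case: (y).
move=> /=; set s1 := St _ _ _ _ _ _ _.
apply: (@combine_loop_spec i s1 pos) => //.
- by split=> /=; rewrite ifF //; nlia.
- by rewrite /= ifF //; nlia.
move=> m t ht hm; rewrite /setm /tick /=.
apply: hQ => [||a na az].
- have pgt1 : (1 < p)%N.
    by have := ltn_ord i; move: nji; rewrite -val_eqE /=; nlia.
  have := aa_alpha pgt1; rewrite hy.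
  have : Num.max (clk s + 1 + 1) (start y) <= Num.max (clk s) (start y) + 2.
    by rewrite ge_max; apply/andP; split; rewrite ?addrA -?[_ + 2]addrA;
       [have : clk s <= Num.max (clk s) (start y) by rewrite le_max lexx
       |have : start y <= Num.max (clk s) (start y) by rewrite le_max lexx orbT]; lra.
  by move: ht; rewrite /=; lra.
- by move=> k; rewrite /upd -val_eqE.
- rewrite hm //= hy; case: ifP => // hr.
    rewrite [in X in op X _]ifF; last by nlia.
    by rewrite ifT; [congr (op _ (nth _ _ _)); nlia | nlia].
  by rewrite ifF //; nlia.
Qed.

(** The period of the pipeline, for both passes: two transmissions (two receives going up, a receive
    and the first of two sends going down) plus the local work on the packet. The last send overlaps
    with the next period. *)
Definition delta : R := 2 * aa + 30 * (S%:R + 1).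

Lemma delta_ge0 : 0 <= delta.
Proof. by have a0 := aa_ge0; have S0 := ler0n R S; rewrite /delta; lra. Qed.

(** The default for [nth] has the length of a packet, so that facts about packet lengths also hold
    for children that do not exist. *)
Definition msg0 : message := Message 0 (nseq S (WNum 0)).

(* [n] packets with the vector [g], the [q]-th one being sent before [B + q * delta]. *)
Definition stream n (B : R) (g : nat -> word T) (l : seq message) : Prop :=
  size l = n /\ forall q, (q < n)%N ->
    payload (nth msg0 l q) = mkseq (fun x => g (q * S + x)%N) S /\
    start (nth msg0 l q) <= B + q%:R * delta.

Lemma stream_rcons n B g l t x : stream n B g l ->
  x = mkseq (fun x => g (n * S + x)%N) S -> t <= B + n%:R * delta ->
  stream n.+1 B g (rcons l (Message t x)).
Proof.
move=> [sl hl] -> ht; split; first by rewrite size_rcons sl.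
move=> q; rewrite ltnS leq_eqVlt nth_rcons sl => /predU1P[->|qn].
  by rewrite ltnn eqxx.
by rewrite qn; apply: hl.
Qed.

Definition is_child (i j : nat) : bool := (j == i + i + 1)%N || (j == i + i + 2)%N.
Definition is_parent (i j : nat) : bool := (i != 0%N) && (j == (i - 1) %/ 2)%N.

Definition gather_one n (f g : nat -> word T) : nat -> word T :=
  fun x => if (n < p)%N then op (f x) (g x) else f x.
Definition gather (i : nat) (f : nat -> word T) (g : nat -> nat -> word T) :=
  gather_one (i + i + 2) (gather_one (i + i + 1) f (g (i + i + 1)%N)) (g (i + i + 2)%N).

(** What a pass over the array at [b] must preserve. The scratch variables from 16 to 63 and the
    receive buffer from [bz] on are free to change. *)
Definition unaffected b a := (a < 16)%N || [&& 64 <= a, a < bz & ~~ (b <= a < b + h * S)]%N.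

Lemma env_unaffected i b m m' : env i m ->
  (forall a, unaffected b a -> m' a = m a) -> env i m'.
Proof. by move=> [m0 m1 m5 m6 m10] e; split; rewrite e. Qed.

(** The schedule of the pipeline: a PE at height [ht] sends packet [q] no later than
    [tm + (ht + 1 + q) * delta], one period after its children. Each level thus adds one period in
    total, not one per packet. *)
Lemma up_spec i s b base (g : nat -> nat -> word T) tm (ht : nat) (Q : st -> Prop) :
  env i (mem s) -> ev (mem s) base = WNum b -> (64 <= b)%N -> (b + h * S <= bz)%N ->
  (forall j : 'I_p, if is_child i j then stream h (tm + ht%:R * delta) (g j) (inb s j)
                    else inb s j = [::]) ->
  clk s + 4 <= tm -> prt s <= tm -> (forall j, outb s j = [::]) ->
  (forall s', que s' = que s -> rep s' = rep s ->
     (forall a, unaffected b a -> mem s' a = mem s a) ->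
     (forall x, (x < h * S)%N ->
        mem s' (b + x)%N = gather i (fun x => mem s (b + x)%N) g x) ->
     (forall j, inb s' j = [::]) ->
     (forall j : 'I_p, if is_parent i j then stream h (tm + ht.+1%:R * delta)
         (gather i (fun x => mem s (b + x)%N) g) (outb s' j) else outb s' j = [::]) ->
     clk s' <= tm + (ht + h).+1%:R * delta -> prt s' <= tm + (ht + h).+1%:R * delta ->
     Q s') ->
  W i (up comb base) Q s.
Proof.
move=> he eb b64 bbz hin hclk hprt hout hQ; have [m0 m1 m5 m6 m10] := he.
have d0 := delta_ge0; have a0 := aa_ge0; have S0 := ler0n R S.
set f := fun x => mem s (b + x)%N; set r := gather i f g.
pose L n := if insub n is Some j then inb s (j : 'I_p) else [::].
have LE (j : 'I_p) : L j = inb s j by rewrite /L valK.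
apply: W_seq; apply: W_assign; [exact: ev_const | exact: eb |].
(* The port may lag behind the clock by [aa], since the last packet may still be in transmission;
   this lag is absorbed while the next packets of the children are received. *)
pose I q (s' : st) := [/\ que s' = que s /\ rep s' = rep s,
  [/\ mem s' 20%N = WNum q, mem s' 17%N = WNum (b + q * S),
     forall a, unaffected b a -> mem s' a = mem s a &
     forall x, (x < h * S)%N -> mem s' (b + x)%N = if (x < q * S)%N then r x else f x],
  forall j : 'I_p, inb s' j = drop q (L j),
  forall j : 'I_p, if is_parent i j then stream q (tm + ht.+1%:R * delta) r (outb s' j)
             else outb s' j = [::] &
  clk s' <= tm + (ht + q)%:R * delta /\ prt s' <= tm + (ht + q)%:R * delta + aa].
apply: (@W_for _ _ _ _ _ _ _ Hw _ _ _ _ h I) => //.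
- move=> q s' [_ [hj _ hf _] _ _ _]; split=> //.
  by rewrite ev_var // hf.
- split=> //=.
  + rewrite /upd /=; split=> // [|a ha|x xh]; first by rewrite addn0.
      by case: eqP ha => [->|_]; rewrite ?/unaffected //; case: eqP => [->|_].
    do 2 (case: eqP => [|_]; first by nlia); exact: erefl.
  + by move=> j; rewrite drop0 LE.
  + by move=> j; rewrite hout; case: ifP.
  + have hh : 0 <= ht%:R * delta by rewrite mulr_ge0.
    by rewrite addn0; split; lra.
- move=> q s' qh [[hq hr] [h20 h17 hf hx] hi ho [hc hp]].
  have he' := env_unaffected he hf; have [m0' m1' m5' m6' m10'] := he'.
  have qS : (q * S + S <= h * S)%N by rewrite addnC -mulSn leq_mul2r qh orbT.
  have hy n (y := nth msg0 (L n) q) : (n = i + i + 1)%N \/ (n = i + i + 2)%N ->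
      [/\ n != i, forall j : 'I_p, val j = n -> inb s' j = y :: drop q.+1 (L n),
         size (payload y) = S &
         (n < p)%N -> payload y = mkseq (fun x => g n (q * S + x)%N) S /\
                      start y <= tm + (ht + q)%:R * delta].
    move=> hn; have nn : n != i by have := ltn_ord i; nlia.
    have hs (j : 'I_p) : val j = n -> stream h (tm + ht%:R * delta) (g n) (L n).
      move=> jn; have := hin j; rewrite -LE /is_child jn ifT //.
      by case: hn => ->; rewrite eqxx ?orbT.
    have hp' : (n < p)%N -> payload y = mkseq (fun x => g n (q * S + x)%N) S /\
                      start y <= tm + (ht + q)%:R * delta.
      move=> np; have [_ /(_ q qh) [p1 p2]] := hs (Ordinal np) erefl.
      by split=> //; rewrite natrD mulrDl addrA.
    split=> //.
    + move=> j jn; rewrite hi jn (drop_nth msg0) //.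
      by have [-> _] := hs j jn.
    + case: (ltnP n p) => [/hp'[-> _]|np]; first by rewrite size_mkseq.
      rewrite /y /L; case: insubP => [j jp|_] /=; first by nlia.
      by rewrite nth_nil /= size_nseq.
  have [n1 i1 s1 p1] := hy (i + i + 1)%N (or_introl erefl).
  have [n2 i2 s2 p2] := hy (i + i + 2)%N (or_intror erefl).
  set y1 := nth _ _ _ in i1 s1 p1; set y2 := nth _ _ _ in i2 s2 p2.
  set tq := tm + (ht + q)%:R * delta in hc hp p1 p2.
  apply: W_seq; apply: (@receive_from_spec _ _ _ (i + i + 1) (b + q * S) _
      (drop q.+1 (L (i + i + 1)%N)) y1);
    [exact: he' | exact: h17 | nlia | nlia | | exact: n1 | exact: i1 | exact: s1 |].
  + apply: (ev_add (x := (i + i)%N) (y := 1%N)); rewrite ?ev_const //.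
      by apply: ev_add; rewrite ?ev_var //; have := ltn_ord i; nlia.
    by have := ltn_ord i; nlia.
  move=> m3 t3 ib3 ht3 hib3 hm3.
  have {}ht3 : t3 <= tq + aa + 10 + 7 * S%:R.
    apply: le_trans ht3 _; rewrite (_ : tq + aa + 10 + 7 * S%:R = (tq + 3) + aa + 7 + 7 * S%:R); last by lra.
    rewrite !lerD2r; case: ifP => [/p1[_ hs1]|_]; rewrite ?ge_max; try (apply/andP; split); rewrite /=; lra.
  have hm3' a : (a != 18%N) -> (a < bz)%N -> ~~ (b <= a < b + h * S)%N -> m3 a = mem s' a.
    by move=> a18 az ab; rewrite hm3 // ifF //; nlia.
  apply: W_seq; apply: (@receive_from_spec _ _ _ (i + i + 2) (b + q * S) _
      (drop q.+1 (L (i + i + 2)%N)) y2);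
    [ | | nlia | nlia | | exact: n2 | | exact: s2 |].
  + by split; rewrite /= hm3' //; nlia.
  + by rewrite /= hm3' //; nlia.
  + apply: (ev_add (x := (i + i)%N) (y := 2%N)); rewrite ?ev_const //.
      by apply: ev_add; rewrite ?ev_var //= ?hm3' //; have := ltn_ord i; nlia.
    by have := ltn_ord i; nlia.
  + by move=> j jn; rewrite /= hib3 jn ifF; [exact: i2 | nlia].
  move=> m4 t4 ib4 ht4 hib4 hm4.
  have {}ht4 : t4 <= tq + 2 * aa + 18 + 14 * S%:R.
    apply: le_trans ht4 _; rewrite (_ : tq + 2 * aa + 18 + 14 * S%:R = (tq + aa + 11 + 7 * S%:R) + aa + 7 + 7 * S%:R); last by lra.
    rewrite !lerD2r; case: ifP => [/p2[_ hs2]|_]; rewrite ?ge_max; try (apply/andP; split); rewrite /=; lra.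
  have hm4' a : (a != 18%N) -> (a < bz)%N -> ~~ (b <= a < b + h * S)%N -> m4 a = mem s' a.
    by move=> a18 az ab; rewrite hm4 //= ifF ?hm3' //; nlia.
  have hib j : ib4 j = drop q.+1 (L j).
    rewrite hib4 /= hib3; case: eqP => [->//|/eqP/negbTE j2]; case: eqP => [->//|/eqP/negbTE j1].
    by have := hin j; rewrite /is_child j1 j2 /= hi LE => ->.
  have hx4 x : (x < h * S)%N -> m4 (b + x)%N = if (x < q.+1 * S)%N then r x else f x.
    move=> xh; rewrite mulSn hm4 /= ?hm3; try nlia; rewrite hx //.
    case: (leqP (q * S) x) => qx.
      case: (ltnP x (S + q * S)) => xq; last first.
        by rewrite !ifF //; nlia.
      have -> : (b + q * S <= b + x < b + q * S + S)%N by nlia.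
      have -> : (b + x - (b + q * S) = x - q * S)%N by nlia.
      have xS : (x - q * S < S)%N by nlia.
      rewrite !andbT /r /gather /gather_one.
      have E : (q * S + (x - q * S) = x)%N by nlia.
      case: (ltnP (i + i + 2) p) => [/p2[-> _]|_]; case: (ltnP (i + i + 1) p) => [/p1[-> _]|_];
        by rewrite ?nth_mkseq // ?E.
    have -> : (b + q * S <= b + x)%N = false by nlia.
    rewrite !andbF; have -> // : (x < S + q * S)%N by nlia.
  have td : (ht + q.+1)%:R * delta = (ht + q)%:R * delta + delta.
    by rewrite addnS -natr1 mulrDl mul1r.
  have fin (t u : R) (ob : 'I_p -> seq message) : t <= tq + delta - 2 -> u <= tq + delta + aa ->
      (forall j : 'I_p, if is_parent i j then stream q.+1 (tm + ht.+1%:R * delta) r (ob j)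
                 else ob j = [::]) ->
      W i (Assign (Const 17) (V 17 :+ V 6))
        (fun s'' => mem s'' 20%N = WNum q /\ I q.+1 (store 20 (WNum q.+1) s''))
        (St m4 (que s') (rep s') t u ib4 ob).
    move=> ht_ hu_ hob; apply: W_assign; first exact: ev_const.
      by apply: (ev_add (x := (b + q * S)%N) (y := S)); rewrite ?ev_var //= ?hm4' //; nlia.
    split; first by rewrite /= /upd /= hm4' ?h20 //; nlia.
    split=> //=; last by rewrite td addrA -/tq; split; lra.
    rewrite /upd /=; split=> // [|a ha|x xh].
    - by congr WNum; nlia.
    - have ha' : (a != 20%N) /\ (a != 17%N) /\ a != 18%N by move: ha; rewrite /unaffected; nlia.
      case: ha' => /negbTE -> [/negbTE -> a18]; rewrite hm4' // ?hf //.
        by move: ha; rewrite /unaffected; nlia.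
      by move: ha; rewrite /unaffected; nlia.
    - by do 2 (case: eqP => [|_]; first by nlia); rewrite hx4.
  have mi : m4 1%N = WNum (val i) by rewrite hm4' //; nlia.
  apply: W_seq; apply: W_if; rewrite ev_var //= mi /=.
  case: eqVneq => [i0|i0] /=.
    apply: W_skip; rewrite /tick /=; apply: fin; [by rewrite /delta; lra | by lra |].
    by move=> j; have := ho j; rewrite /is_parent i0.
  have pj : ((i - 1) %/ 2 < p)%N by have := ltn_ord i; nlia.
  have pgt1 : (1 < p)%N by have := ltn_ord i; nlia.
  have aal := aa_alpha pgt1.
  pose j := Ordinal pj.
  apply: (@W_send _ _ _ _ _ _ _ i j _ _ _ (b + q * S) S).
  + by rewrite -val_eqE /=; nlia.
  + apply: ev_div; last exact: ev_const.
    by apply: ev_sub; rewrite ?ev_var ?ev_const.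
  + by rewrite ev_var //= hm4' //; nlia.
  + by rewrite ev_var //= hm4' //; nlia.
  rewrite /=; set st0 := Num.max _ _.
  have hst0 : st0 <= tq + delta - 4.
    by rewrite ge_max; apply/andP; split; rewrite /delta; lra.
  apply: fin; [by lra | by lra |].
  move=> k; rewrite /upd -val_eqE /=; have := ho k; rewrite /is_parent i0 /=.
  case: eqP => [kj|//]; have -> : k = j by apply: val_inj.
  move=> hk; apply: stream_rcons hk _ _.
    apply/eq_in_map => x; rewrite mem_iota add0n => /andP[_ xS].
    by rewrite -addnA hx4 ?ifT //; nlia.
  rewrite -addrA -mulrDl -natrD addSn; have := td; rewrite addnS => ->.
  by rewrite addrA -/tq; lra.
- move=> s' [[hq hr] [h20 h17 hf hx] hi ho [hc hp]].
  have d1 : 1 <= delta by rewrite /delta; lra.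
  have d2 : aa <= delta by rewrite /delta; lra.
  apply: hQ => //=.
  + by move=> x xh; rewrite hx // xh.
  + move=> j; rewrite hi; case E : (is_child i j); have := hin j; rewrite E LE.
      by case=> <- _; rewrite drop_size.
    by move=> ->.
  + by rewrite -natr1 mulrDl mul1r; lra.
  + by rewrite -natr1 mulrDl mul1r; lra.
Qed.
Lemma send_down_spec i s e n pos (Q : st -> Prop) :
  env i (mem s) -> mem s 17%N = WNum pos -> ev (mem s) e = WNum n -> n != i ->
  let M := Num.max (clk s) (prt s) in
  (forall (t u start : R) (ob : 'I_p -> seq message),
     start <= M + 1 -> t <= M + 2 -> u <= M + 1 + aa ->
     (forall j : 'I_p, ob j = if val j == n
        then rcons (outb s j) (Message start [seq mem s (pos + x)%N | x <- iota 0 S])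
        else outb s j) ->
     Q (St (mem s) (que s) (rep s) t u (inb s) ob)) ->
  W i (send_down e) Q s.
Proof.
move=> [m0 m1 m5 m6 m10] m17 ee ni M hQ; have a0 := aa_ge0.
have M1 : clk s <= M by rewrite le_max lexx.
have M2 : prt s <= M by rewrite le_max lexx orbT.
apply: W_if; rewrite (ev_lt ee (y := p)) ?ev_var //=.
case: (ltnP n p) => [np|pn]; last first.
  apply: W_skip; apply: (hQ (clk s + 1 + 1) (prt s) M); [lra | lra | lra |].
  by move=> j; case: eqP => // jn; have := ltn_ord j; rewrite ltnNge -jn in pn *; rewrite pn.
have pgt1 : (1 < p)%N by have := ltn_ord i; move: ni; nlia.
have aal := aa_alpha pgt1.
pose j := Ordinal np.
apply: (@W_send _ _ _ _ _ _ _ i j _ _ _ pos S) => //; try by rewrite ev_var.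
rewrite /=; set st0 := Num.max _ _.
have hst0 : st0 <= M + 1 by rewrite ge_max; apply/andP; split; lra.
apply: (hQ _ _ st0) => //; [lra | lra |].
move=> k; rewrite /upd -val_eqE /=; case: eqP => [kj|] //.
by have -> : k = j by apply: val_inj.
Qed.

(** The mirror image of [up_spec], with the level [lv] counted from the root in place of the height.
    The root has nothing to wait for, but must already hold [g]. *)
Lemma down_spec i s b base (g : nat -> word T) (tm : R) (lv : nat) (Q : st -> Prop) :
  env i (mem s) -> ev (mem s) base = WNum b -> (64 <= b)%N ->
  (b + h * S <= bz)%N ->
  (forall j : 'I_p, if is_parent i j then stream h (tm + lv%:R * delta) g (inb s j)
                    else inb s j = [::]) ->
  (val i = 0%N -> forall x, (x < h * S)%N -> mem s (b + x)%N = g x) ->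
  clk s + 4 <= tm -> prt s <= tm -> (forall j, outb s j = [::]) ->
  (forall s', que s' = que s -> rep s' = rep s ->
     (forall a, unaffected b a -> mem s' a = mem s a) ->
     (forall x, (x < h * S)%N -> mem s' (b + x)%N = g x) ->
     (forall j, inb s' j = [::]) ->
     (forall j : 'I_p, if is_child i j then stream h (tm + lv.+1%:R * delta) g (outb s' j)
                       else outb s' j = [::]) ->
     clk s' <= tm + (lv + h).+1%:R * delta -> prt s' <= tm + (lv + h).+1%:R * delta ->
     Q s') ->
  W i (down base) Q s.
Proof.
move=> he eb b64 bbz hin h0 hclk hprt hout hQ; have [m0 m1 m5 m6 m10] := he.
have a0 := aa_ge0; have d0 := delta_ge0; have S0 := ler0n R S.
have de : delta = 2 * aa + 30 * (S%:R + 1) by [].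
apply: W_seq; apply: W_assign; [exact: ev_const | exact: eb |].
pose I q (s' : st) := [/\ que s' = que s /\ rep s' = rep s,
  [/\ mem s' 20%N = WNum q, mem s' 17%N = WNum (b + q * S),
     forall a, unaffected b a -> mem s' a = mem s a &
     forall x, (x < h * S)%N ->
       mem s' (b + x)%N = if (x < q * S)%N then g x else mem s (b + x)%N],
  forall j : 'I_p, inb s' j = drop q (inb s j),
  forall j : 'I_p, if is_child i j then stream q (tm + lv.+1%:R * delta) g (outb s' j)
             else outb s' j = [::] &
  clk s' <= tm + (lv + q)%:R * delta /\ prt s' <= tm + (lv + q)%:R * delta + aa].
apply: (@W_for _ _ _ _ _ _ _ Hw _ _ _ _ h I) => //.
- move=> q s' [_ [hj _ hf _] _ _ _]; split=> //.
  by rewrite ev_var // hf.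
- split=> //=.
  + rewrite /upd /=; split=> // [|a ha|x xh]; first by rewrite addn0.
      by case: eqP ha => [->|_]; rewrite ?/unaffected //; case: eqP => [->|_].
    by do 2 (case: eqP => [|_]; first by nlia).
  + by move=> j; rewrite drop0.
  + by move=> j; rewrite hout; case: ifP.
  + have hh : 0 <= lv%:R * delta by rewrite mulr_ge0.
    by rewrite addn0; split; lra.
- move=> q s' qh [[hq hr] [h20 h17 hf hx] hi ho [hc hp]].
  have he' := env_unaffected he hf; have [m0' m1' m5' m6' m10'] := he'.
  have qS : (q * S + S <= h * S)%N by rewrite addnC -mulSn leq_mul2r qh orbT.
  set tq := tm + (lv + q)%:R * delta in hc hp.
  have td : (lv + q.+1)%:R * delta = (lv + q)%:R * delta + delta.
    by rewrite addnS -natr1 mulrDl mul1r.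
  have rest (m : nat -> word T) (t : R) (ib : 'I_p -> seq message) :
      (forall a, ~~ (b <= a < b + h * S)%N -> m a = mem s' a) ->
      (forall x, (x < h * S)%N -> m (b + x)%N = if (x < q.+1 * S)%N then g x else mem s (b + x)%N) ->
      (forall j, ib j = drop q.+1 (inb s j)) -> t <= tq + aa + 6 ->
      W i (Seq (send_down left_child)
          (Seq (send_down right_child) (Assign (Const 17) (V 17 :+ V 6))))
        (fun s'' => mem s'' 20%N = WNum q /\ I q.+1 (store 20 (WNum q.+1) s''))
        (St m (que s') (rep s') t (prt s') ib (outb s')).
    move=> hm hmx hib ht.
    have pay : [seq m (b + q * S + x)%N | x <- iota 0 S] = mkseq (fun x => g (q * S + x)%N) S.
      apply/eq_in_map => x; rewrite mem_iota add0n => /andP[_ xS].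
      by rewrite -addnA hmx ?ifT //; nlia.
    have em : env i m by split; rewrite hm //; nlia.
    have e17 : m 17%N = WNum (b + q * S) by rewrite hm //; nlia.
    have [em0 em1 em5 em6 em10] := em.
    have elr (k : nat) : (k < 3)%N ->
        ev m ((V 1 :+ V 1) :+ Const k) = WNum (i + i + k).
      move=> k3; apply: (ev_add (x := (i + i)%N) (y := k)); last by have := ltn_ord i; nlia.
        by apply: ev_add; rewrite ?ev_var //; have := ltn_ord i; nlia.
      by apply: ev_const => //; nlia.
    apply: W_seq; apply: (@send_down_spec i _ _ (i + i + 1) (b + q * S));
      [exact: em | exact: e17 | exact: elr | by nlia |] => /=.
    set M := Num.max _ _; have hM : M <= tq + aa + 7.
      by rewrite ge_max; apply/andP; split; lra.
    move=> t1 u1 st1 ob1 hst1 ht1 hu1 hob1.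
    apply: W_seq; apply: (@send_down_spec i _ _ (i + i + 2) (b + q * S));
      [exact: em | exact: e17 | exact: elr | by nlia |] => /=.
    set M' := Num.max _ _; have hM' : M' <= tq + 2 * aa + 10.
      by rewrite ge_max; apply/andP; split; lra.
    move=> t2 u2 st2 ob2 hst2 ht2 hu2 hob2.
    apply: W_assign; first exact: ev_const.
      by apply: (ev_add (x := (b + q * S)%N) (y := S)); rewrite ?ev_var //=; nlia.
    split; first by rewrite /= /upd /= hm ?h20 //; nlia.
    split=> //=.
    - rewrite /upd /=; split=> // [|a ha|x xh].
      + by congr WNum; nlia.
      + have [a20 [a17 ab]] : (a != 20%N) /\ (a != 17%N) /\ ~~ (b <= a < b + h * S)%N.
          by move: ha; rewrite /unaffected; nlia.
        by rewrite (negbTE a20) (negbTE a17) hm ?hf.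
      + by do 2 (case: eqP => [|_]; first by nlia); rewrite hmx.
    - move=> j; have := ho j; rewrite hob2 hob1 /is_child.
      have sle (st0 : R) : st0 <= tq + 2 * aa + 11 -> st0 <= tm + lv.+1%:R * delta + q%:R * delta.
        move=> hs; rewrite -addrA -mulrDl -natrD addSn; have := td; rewrite addnS => ->.
        by rewrite addrA -/tq; lra.
      case: (val j =P (i + i + 1)%N) => [e1|_] /=.
        have -> : (val j == i + i + 2)%N = false by rewrite e1; nlia.
        by move=> hk; apply: stream_rcons hk _ _; [exact: pay | apply: sle; lra].
      case: (val j =P (i + i + 2)%N) => [e2|_] //=.
      by move=> hk; apply: stream_rcons hk _ _; [exact: pay | apply: sle; lra].
    - by rewrite td addrA -/tq; split; lra.
  apply: W_seq; apply: W_if; rewrite ev_var //= m1' /=.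
  case: eqVneq => [i0|i0] /=.
    apply: W_skip; rewrite /tick /=; apply: rest => //; last by lra.
      move=> x xh; rewrite hx // mulSn; case: ltnP => qx; case: ltnP => qx' //.
        by nlia.
      by rewrite h0.
    move=> j; have := hin j; rewrite /is_parent i0 /= => hj.
    by rewrite hi hj.
  have pj : ((i - 1) %/ 2 < p)%N by have := ltn_ord i; nlia.
  have pgt1 : (1 < p)%N by have := ltn_ord i; nlia.
  have aal := aa_alpha pgt1.
  pose j := Ordinal pj.
  have := hin j; rewrite /is_parent i0 eqxx /= => -[sj /(_ q qh) [pay hst]].
  apply: (@W_recv _ _ _ _ _ _ _ i j _ _ (b + q * S) (start (nth msg0 (inb s j) q))
     (payload (nth msg0 (inb s j) q)) (drop q.+1 (inb s j))).
  + by rewrite -val_eqE /=; nlia.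
  + apply: ev_div; last exact: ev_const.
    by apply: ev_sub; rewrite ?ev_var ?ev_const.
  + by rewrite ev_var.
  + by rewrite /= hi (drop_nth msg0) ?sj //; case: (nth _ _ _).
  rewrite /= pay size_mkseq; apply: rest.
  + by move=> a ha; rewrite ifF //; nlia.
  + move=> x xh; case: ifP => hxx.
      rewrite nth_mkseq; last by nlia.
      by rewrite ifT; [congr g; nlia | nlia].
    rewrite hx //; case: ifP => hq1; first by rewrite ifT //; nlia.
    by rewrite ifF //; nlia.
  + move=> k; rewrite /upd -val_eqE; case: eqVneq => [kj|kj].
      by have -> : k = j by apply: val_inj.
    by rewrite hi; have := hin k; rewrite /is_parent i0 /= (negbTE kj) => ->.
  + have : Num.max (clk s' + 2 + 1 + 1) (start (nth msg0 (inb s j) q)) <= tq + 4.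
      have e : tm + lv%:R * delta + q%:R * delta = tq by rewrite /tq natrD mulrDl addrA.
      by rewrite e in hst; rewrite ge_max; apply/andP; split; lra.
    by move: (Num.max _ _) => M hM; lra.
- move=> s' [[hq hr] [h20 h17 hf hx] hi ho [hc hp]].
  have d1 : 1 <= delta by lra.
  have d2 : aa <= delta by lra.
  apply: hQ => //=.
  + by move=> x xh; rewrite hx // xh.
  + move=> j; rewrite hi; case E : (is_parent i j); have := hin j; rewrite E.
      by case=> <- _; rewrite drop_size.
    by move=> ->.
  + by rewrite -natr1 mulrDl mul1r; lra.
  + by rewrite -natr1 mulrDl mul1r; lra.
Qed.
End Collective.

(** * Phases executed by all PEs *)

Section Parallel.
Variables (R : realFieldType) (disp : Order.disp_t) (T : orderType disp).
Variables (w : nat) (alpha beta : R) (p : nat).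
Local Notation config := (config R T p).
Local Notation W := (@W R disp T w alpha beta p).
Local Notation reach := (@reach R disp T w alpha beta p).
Local Notation st := (@st R disp T p).
Implicit Types (i j : 'I_p) (s : st) (sg : 'I_p -> st).

(** All PEs are at the same place of the program and no message is in transit. The machine has no
    barrier and the clocks may differ; such configurations arise only because the order of execution
    may be chosen freely. *)
Definition glob k sg : config := Config (fun i => pe_of k (sg i)) (fun _ _ => [::]).

Definition PW (x : cmd) (Q : ('I_p -> st) -> Prop) sg : Prop :=
  forall k, exists2 sg', Q sg' & reach (glob (x :: k) sg) (glob k sg').

Lemma sweep (P : nat -> config -> Prop) c n :
  (forall m c, (m < n)%N -> P m c -> exists2 c', P m.+1 c' & reach c c') ->
  P 0%N c -> exists2 c', P n c' & reach c c'.
Proof.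
elim: n => [|n IH] hP h0; first by exists c => //; apply: reach_refl.
have [m d mn|c1 p1 r1] := IH _ h0; first by apply: hP; apply: ltnW.
have [c2 p2 r2] := hP n c1 (ltnSn n) p1.
by exists c2 => //; apply: reach_trans r1 r2.
Qed.

Lemma PW_mono x Q Q' sg : (forall sg, Q sg -> Q' sg) -> PW x Q sg -> PW x Q' sg.
Proof. by move=> QQ h k; have [s' qs r] := h k; exists s'; first exact: QQ. Qed.

Definition mute s : st := St (mem s) (que s) (rep s) (clk s) (prt s)
  (fun _ => [::]) (fun _ => [::]).

Definition steps_to i (k1 k2 : seq cmd) (Q : st -> Prop) s : Prop :=
  forall c, exists2 s', Q s' & reach (put c i k1 s) (put c i k2 s').

Lemma reach_put c i k1 k2 Q s : code (pes c i) = k1 -> look c i = s ->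
  steps_to i k1 k2 Q s -> exists2 s', Q s' & reach c (put c i k2 s').
Proof.
move=> hc hl h; have [s' qs r] := h c; exists s' => //.
by rewrite -hl put_look in r.
Qed.

Lemma reach_local_all k1 k2 (Q : 'I_p -> st -> Prop) sg :
  (forall i, steps_to i k1 k2 (fun s => s = mute s /\ Q i s) (mute (sg i))) ->
  exists2 sg', forall i, Q i (sg' i) & reach (glob k1 sg) (glob k2 sg').
Proof.
move=> h.
pose P n c := exists2 sg' : 'I_p -> st, forall i, (i < n)%N -> Q i (sg' i) &
  c = Config (fun i => if (i < n)%N then pe_of k2 (sg' i) else pe_of k1 (sg i))
             (fun _ _ => [::]).
have [||c [sg' hq ->] r] := @sweep P (glob k1 sg) p; last first.
- exists sg' => [i|]; first exact: hq (ltn_ord i).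
  by move: r; congr (reach _ (Config _ _)); apply/funext => i; rewrite ltn_ord.
- by exists sg.
- move=> m c mp [sg' hq ec]; pose i := Ordinal mp.
  have lc : look c i = mute (sg i) by rewrite ec /look /= ltnn.
  have cc : code (pes c i) = k1 by rewrite ec /= ltnn.
  have [s' [ms qs] r] := reach_put cc lc (h i).
  exists (put c i k2 s') => //; exists (upd sg' i s').
    move=> j; rewrite ltnS leq_eqVlt /upd => /predU1P[ji|jm].
      by have -> : j = i by [apply: val_inj]; rewrite eqxx.
    by rewrite -val_eqE /= (ltn_eqF jm); apply: hq.
  rewrite ec /put; congr Config; apply/funext => j /=; rewrite /upd.
    case: eqVneq => [->|ji] /=; first by rewrite ltnSn.
    by rewrite ltnS [(j <= m)%N]leq_eqVlt -[(j == m :> nat)]/(val j == val i) val_eqE (negbTE ji).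
  by apply/funext => a; rewrite ms /=; do !case: eqP => //.
Qed.

Lemma PW_local x Q sg :
  (forall i, W i x (fun s => s = mute s /\ Q i s) (mute (sg i))) ->
  PW x (fun sg' => forall i, Q i (sg' i)) sg.
Proof. by move=> h k; apply: reach_local_all => i c; apply: h. Qed.

Lemma reach_seq x y k sg :
  reach (glob (Seq x y :: k) sg) (glob (x :: y :: k) (fun i => tick 1 (sg i))).
Proof.
have [sg' e r] : exists2 sg', forall i, sg' i = mute (tick 1 (sg i)) &
    reach (glob (Seq x y :: k) sg) (glob (x :: y :: k) sg').
  apply: (@reach_local_all _ _ (fun i s => s = mute (tick 1 (sg i)))) => i c.
  exists (tick 1 (mute (sg i))) => //.
  exact: (@reach_local _ _ _ w alpha beta _ c i (Seq x y) k (mute (sg i))).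
by move: r; congr (reach _ (Config _ _)); apply/funext => i; rewrite e.
Qed.

Lemma PW_seq x y Q sg : PW x (PW y Q) (fun i => tick 1 (sg i)) -> PW (Seq x y) Q sg.
Proof.
move=> h k; have [sg1 h1 r1] := h (y :: k); have [sg2 h2 r2] := h1 k.
by exists sg2 => //; apply: reach_trans (reach_seq x y k sg) (reach_trans r1 r2).
Qed.

End Parallel.

Lemma is_child_parent i j : is_child i j = is_parent j i.
Proof. by rewrite /is_child /is_parent; lia. Qed.

(** In heap numbering the level of node [i] is the binary logarithm of [i + 1]. *)
Lemma trunc_log_child i j : is_child i j ->
  trunc_log 2 j.+1 = (trunc_log 2 i.+1).+1.
Proof.
move=> h; have /andP[n0 n1] := @trunc_log_bounds 2 i.+1 isT isT.
by apply: trunc_log_eq => //; move: h n0 n1; rewrite /is_child !expnS; lia.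
Qed.

(** * The value computed by a tree reduction *)

Section Reduction.
Variables (disp : Order.disp_t) (T : orderType disp) (p : nat).
Variables (op : word T -> word T -> word T) (f : nat -> nat -> word T).

(** The recursion goes to larger node numbers, so [n] serves as fuel; [p - i] units suffice at node
    [i], hence [p] everywhere. *)
Fixpoint reduction n i : nat -> word T :=
  if n is n'.+1 then gather p op i (f i) (reduction n') else f i.

Lemma reduction_stable n m i : (i < p)%N -> (p - i <= n)%N -> (p - i <= m)%N ->
  reduction n i = reduction m i.
Proof.
elim: n m i => [|n IH] [|m] i ip; try lia.
move=> hn hm; apply/funext => x; rewrite /= /gather /gather_one.
case: (ltnP (i + i + 1) p) => h1; case: (ltnP (i + i + 2) p) => h2; try lia;
  by rewrite ?(IH m) //; lia.
Qed.

Lemma reductionE i : (i < p)%N -> reduction p i = gather p op i (f i) (reduction p).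
Proof. by move=> ip; rewrite (reduction_stable (m := p.+1)) //; lia. Qed.

Fixpoint subtree n i : seq nat :=
  if n is n'.+1 then
    if (i < p)%N then i :: subtree n' (i + i + 1)%N ++ subtree n' (i + i + 2)%N else [::]
  else [::].

(** Level [t] below node [i] consists of the [2 ^ t] consecutive numbers from [(i + 1) * 2 ^ t - 1]
    on, cut off at [p]. *)
Lemma count_subtree a n i : count a (subtree n i) =
  (\sum_(t < n) count [pred j | a j & j < p] (iota ((i.+1) * 2 ^ t - 1) (2 ^ t)))%N.
Proof.
elim: n i => [|n IH] i; first by rewrite big_ord0.
have iota_gt k m : (p <= k)%N -> count [pred j | a j & (j < p)%N] (iota k m) = 0%N.
  move=> pk; apply/eqP; rewrite -leqn0 leqNgt -has_count; apply/hasPn => j.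
  by rewrite mem_iota /= => /andP[kj _]; rewrite [(j < p)%N]ltnNge (leq_trans pk) ?andbF.
have split t : count [pred j | a j & (j < p)%N] (iota (i.+1 * 2 ^ t.+1 - 1) (2 ^ t.+1)) =
  (count [pred j | a j & (j < p)%N] (iota ((i + i + 1).+1 * 2 ^ t - 1) (2 ^ t)) +
  count [pred j | a j & (j < p)%N] (iota ((i + i + 2).+1 * 2 ^ t - 1) (2 ^ t)))%N.
  have t0 : (0 < 2 ^ t)%N by rewrite expn_gt0.
  rewrite -count_cat; congr count; rewrite expnS mul2n -addnn iotaD; congr (iota _ _ ++ iota _ _); nia.
rewrite big_ord_recl /= expn0 muln1 subn1 /=.
under eq_bigr do rewrite /bump add1n split.
rewrite big_split /= -!IH; case: ltnP => ip /=; first by rewrite count_cat andbT addn0.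
have sub0 k : (p <= k)%N -> subtree n k = [::].
  by move=> pk; case: (n) => //= n'; rewrite ltnNge pk.
by rewrite andbF !sub0 //; lia.
Qed.

(** For the root the levels are adjacent intervals: the first [n] of them tile the numbers below
    [2 ^ n - 1], and [p <= 2 ^ p - 1]. *)
Lemma perm_subtree : perm_eq (subtree p 0) (iota 0 p).
Proof.
apply/permP => a; rewrite count_subtree.
have H n : (\sum_(t < n) count [pred j | a j & (j < p)%N] (iota (1 * 2 ^ t - 1) (2 ^ t)))%N =
    count [pred j | a j & (j < p)%N] (iota 0 (2 ^ n - 1)).
  elim: n => [|n IH]; first by rewrite big_ord0.
  have t0 : (0 < 2 ^ n)%N by rewrite expn_gt0.
  rewrite big_ord_recr /= IH mul1n -count_cat.
  have -> : (2 ^ n.+1 - 1 = (2 ^ n - 1) + 2 ^ n)%N by rewrite expnS; lia.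
  by rewrite iotaD add0n.
rewrite H.
have le : (p <= 2 ^ p - 1)%N by have := ltn_expl p (isT : (1 < 2)%N); lia.
rewrite -(subnKC le) iotaD count_cat addnC.
have -> : count [pred j | a j & (j < p)%N] (iota (0 + p) (2 ^ p - 1 - p)) = 0%N.
  apply/eqP; rewrite -leqn0 leqNgt -has_count; apply/hasPn => j.
  by rewrite mem_iota /= => /andP[kj _]; rewrite [(j < p)%N]ltnNge kj ?andbF.
by apply: eq_in_count => j; rewrite mem_iota /= add0n => ->; rewrite andbT.
Qed.

(* The value computed at the root is a product of all leaves, in some order. *)
Lemma reduction_ind (P : seq nat -> word T -> Prop) x : (0 < p)%N ->
  (forall i, (i < p)%N -> P [:: i] (f i x)) ->
  (forall A B u v, P A u -> P B v -> P (A ++ B) (op u v)) ->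
  exists2 A, perm_eq A (iota 0 p) & P A (reduction p 0 x).
Proof.
move=> p0 h1 h2; exists (subtree p 0); first exact: perm_subtree.
suff H n i : (i < p)%N -> (p - i <= n)%N -> P (subtree n i) (reduction n i x).
  by apply: H; rewrite ?subn0.
elim: n i => [|n IH] i ip hn; first by lia.
rewrite /= ip /gather /gather_one -cat1s.
have nil k : (p <= k)%N -> subtree n k = [::].
  by move=> pk; case: (n) => //= n'; rewrite ltnNge pk.
case: (ltnP (i + i + 1) p) => l1; case: (ltnP (i + i + 2) p) => l2; try lia.
- by rewrite catA; apply: (h2); [apply: h2; [exact: h1|]|]; apply: IH => //; lia.
- by rewrite (nil _ l2) cats0; apply: h2; [exact: h1|apply: IH => //; lia].
- by rewrite !nil // cats0; apply: h1.
Qed.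
End Reduction.

Definition all_reduce comb base : cmd := Seq (up comb base) (down base).

(** * Upward and downward pass combined *)

Section AllReduce.
Variables (R : realFieldType) (disp : Order.disp_t) (T : orderType disp).
Variables (w : nat) (alpha beta : R) (p : nat).
Hypothesis Hw : (128 <= 2 ^ w)%N.
Local Notation config := (config R T p).
Local Notation message := (message R T).
Local Notation ev := (@eval disp T w).
Local Notation W := (@W R disp T w alpha beta p).
Local Notation PW := (@PW R disp T w alpha beta p).
Local Notation reach := (@reach R disp T w alpha beta p).
Local Notation st := (@st R disp T p).
Implicit Types (i j : 'I_p) (s : st) (sg : 'I_p -> st).
Variables (h S bz : nat) (aa : R).
Hypothesis aa_ge0 : 0 <= aa.
Hypothesis aa_alpha : (1 < p)%N -> alpha + S%:R * beta <= aa.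
Hypotheses (hw_z : (bz + S < 2 ^ w)%N) (hw_p : (p + p + 4 < 2 ^ w)%N)
  (hw_h : (h < 2 ^ w)%N) (h_log : h = (trunc_log 2 p).+1).
Local Notation delta := (delta S aa).
Local Notation stream := (@stream R disp T S aa).
Variables (comb : expr -> expr -> cmd) (op : word T -> word T -> word T).
Hypothesis comb_op : implements w alpha beta p comb op.

Lemma stream_le n (B B' : R) g l : B <= B' -> stream n B g l -> stream n B' g l.
Proof.
move=> le [sl hl]; split=> // q qn; have [h1 h2] := hl q qn; split=> //.
by apply: le_trans h2 _; rewrite lerD2r.
Qed.

(** Distance to the deepest possible level. For a leaf on the last but one level this exceeds the
    true height, which is harmless, since heights serve only as deadlines. *)
Definition height i : nat := (trunc_log 2 p - trunc_log 2 i.+1)%N.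

Lemma trunc_log_ord i : (trunc_log 2 i.+1 <= trunc_log 2 p)%N.
Proof. by rewrite leq_trunc_log // ltn_ord. Qed.

(* All PEs execute [x], one after the other in the order given by [rk]; PE [i]
   receives one stream from each [j] with [e j i] and sends one to each [j] with
   [e i j]. *)
Lemma pass_all x (e : rel nat) (rk : 'I_p -> 'I_p) (lv : 'I_p -> nat)
    (g : 'I_p -> nat -> word T) (tm : R) (K : 'I_p -> st -> Prop) sg k :
  involutive rk -> (forall i j, e i j -> (rk i < rk j)%N) ->
  (forall i (ib ob : 'I_p -> seq message),
     (forall j, if e j i then stream h (tm + (lv j).+1%:R * delta) (g j) (ib j) else ib j = [::]) ->
     (forall j, ob j = [::]) ->
     W i x (fun s => [/\ K i s, forall j, inb s j = [::] & forall j, if e i j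
         then stream h (tm + (lv i).+1%:R * delta) (g i) (outb s j) else outb s j = [::]])
       (St (mem (sg i)) (que (sg i)) (rep (sg i)) (clk (sg i)) (prt (sg i)) ib ob)) ->
  exists2 sg', forall i, K i (sg' i) & reach (glob (x :: k) sg) (glob k sg').
Proof.
(* After [m] PEs have run, exactly the edges from a finished PE to an unfinished one carry a
   stream. *)
move=> rkK re hx; pose P m (c : config) := exists2 sg', forall i, (rk i < m)%N -> K i (sg' i)
  & exists2 ch : 'I_p -> 'I_p -> seq message,
    c = Config (fun i => if (rk i < m)%N then pe_of k (sg' i) else pe_of (x :: k) (sg i)) ch
  & forall i j, if [&& e i j, rk i < m & m <= rk j]%N
      then stream h (tm + (lv i).+1%:R * delta) (g i) (ch i j) else ch i j = [::].
have [||c [sg' hq [ch -> hch]] r] := @sweep _ _ _ w alpha beta _ P (glob (x :: k) sg) p; last first.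
- exists sg' => [i|]; first by apply: hq; rewrite ltn_ord.
  rewrite (_ : glob k sg' = Config
    (fun i => if (rk i < p)%N then pe_of k (sg' i) else pe_of (x :: k) (sg i)) ch) //.
  congr Config; first by apply/funext => i; rewrite ltn_ord.
  apply/funext => i; apply/funext => j; have := hch i j.
  by case: ifP => // /and3P[_ _]; rewrite leqNgt ltn_ord.
- exists sg => [//|]; exists (fun _ _ => [::]) => [//|i j].
  by case: ifP => // /and3P[_].
move=> m c mp [sg' hq [ch ec hch]]; pose i := rk (Ordinal mp).
have ri : rk i = m :> nat by rewrite /i rkK.
have rE j : (rk j == m :> nat) = (j == i) by rewrite -ri val_eqE (can_eq rkK).
have rl j : (rk j < m.+1)%N = (j == i) || (rk j < m)%N by rewrite ltnS leq_eqVlt rE.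
have cc : code (pes c i) = x :: k by rewrite ec /= ri ltnn.
have lc : look c i = St (mem (sg i)) (que (sg i)) (rep (sg i)) (clk (sg i)) (prt (sg i))
    (ch^~ i) (ch i) by rewrite ec /look /= ri ltnn.
have h1 j : if e j i then stream h (tm + (lv j).+1%:R * delta) (g j) (ch j i) else ch j i = [::].
  have := hch j i; rewrite ri leqnn andbT; case eji: (e j i) => //=.
  by have := re j i eji; rewrite ri => ->.
have h2 j : ch i j = [::] by have := hch i j; rewrite ri ltnn andbF.
have [s' [hs' is' os'] r] := reach_put cc lc (fun c' => hx i _ _ h1 h2 c' k).
exists (put c i k s') => //; exists (upd sg' i s').
  by move=> j; rewrite rl /upd; case: eqVneq => [->|_] // /hq.
exists (chan (put c i k s')).
  by rewrite ec /put /=; congr Config; apply/funext => j; rewrite /upd rl; case: (j == i).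
move=> a a'; have := hch a a'; rewrite ec /= rl; case: (eqVneq a i) => [->|nai].
  case: (eqVneq a' i) => [->|nbi].
    by have -> : e i i = false by apply/negP => /re; rewrite ltnn.
  move=> _; have := os' a'; case: (boolP (e i a')) => //= /re.
  by rewrite ri => ->.
case: (eqVneq a' i) => [->|nbi] /=; first by rewrite ri ltnn !andbF is'.
by have -> : (m < rk a')%N = (m <= rk a')%N by rewrite ltn_neqAle eq_sym rE (negbTE nbi).
Qed.

Section Passes.
Variables (b : nat) (base : expr) (tm : R) (sg : 'I_p -> st).
Hypotheses (b64 : (64 <= b)%N) (bbz : (b + h * S <= bz)%N).
Hypothesis h_env : forall i, env h S bz i (mem (sg i)).
Hypothesis h_base : forall i, ev (mem (sg i)) base = WNum b.
Hypothesis h_clk : forall i, clk (sg i) + 4 <= tm.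
Hypothesis h_prt : forall i, prt (sg i) <= tm.

Definition kept i s : Prop := [/\ que s = que (sg i), rep s = rep (sg i),
  forall a, unaffected h S bz b a -> mem s a = mem (sg i) a,
  clk s <= tm + (h + h)%:R * delta & prt s <= tm + (h + h)%:R * delta].

Lemma kept_intro i s (m : nat) : que s = que (sg i) -> rep s = rep (sg i) ->
  (forall a, unaffected h S bz b a -> mem s a = mem (sg i) a) -> (m < h)%N ->
  clk s <= tm + (m + h).+1%:R * delta -> prt s <= tm + (m + h).+1%:R * delta -> kept i s.
Proof.
move=> h1 h2 h3 mh h4 h5.
have le : tm + (m + h).+1%:R * delta <= tm + (h + h)%:R * delta.
  by rewrite lerD2l ler_wpM2r ?delta_ge0 // ler_nat; nlia.
by split=> //; [apply: le_trans h4 le | apply: le_trans h5 le].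
Qed.

Definition entry n : nat -> word T :=
  if insub n is Some i then fun x => mem (sg (i : 'I_p)) (b + x)%N else fun _ => WNum 0.
Local Notation G := (reduction p op entry p).

Lemma up_all k : exists2 sg', forall i, kept i (sg' i) /\
    forall x, (x < h * S)%N -> mem (sg' i) (b + x)%N = G i x
  & reach (glob (up comb base :: k) sg) (glob k sg').
Proof.
(* Children have larger numbers than their parents, so running the PEs by decreasing number lets
   every packet be present when it is awaited. *)
apply: (pass_all (e := is_parent) (rk := @rev_ord p) (lv := height) (g := fun i => G i) (tm := tm)
  (K := fun i s => kept i s /\ forall x, (x < h * S)%N -> mem s (b + x)%N = G i x)).
- exact: rev_ordK.
- by move=> i j; have := ltn_ord i; rewrite /is_parent /=; nlia.
move=> i ib ob hib hob.
apply: (@up_spec _ _ _ _ _ _ _ Hw h S bz aa aa_ge0 aa_alpha hw_z hw_p hw_h _ _ comb_op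
  i _ b base G tm (height i)) => //= [j|].
  have := hib j; rewrite is_child_parent; case ji: (is_parent j i) => //.
  apply: stream_le; rewrite lerD2l ler_wpM2r ?delta_ge0 // ler_nat.
  rewrite -is_child_parent in ji.
  by have := trunc_log_child ji; have := trunc_log_ord j; rewrite /height; nlia.
have -> : (fun x => mem (sg i) (b + x)%N) = entry i by rewrite /entry valK.
rewrite -reductionE // => s' e1 e2 e3 e4 e5 e6 e7 e8; split=> //; split=> //.
by apply: (kept_intro (m := height i)) => //; rewrite h_log /height; nlia.
Qed.

Lemma down_all k (g : nat -> word T) :
  (forall i, val i = 0%N -> forall x, (x < h * S)%N -> mem (sg i) (b + x)%N = g x) ->
  exists2 sg', forall i, kept i (sg' i) /\
    forall x, (x < h * S)%N -> mem (sg' i) (b + x)%N = g x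
  & reach (glob (down base :: k) sg) (glob k sg').
Proof.
move=> root; pose level i := trunc_log 2 (nat_of_ord i).+1.
apply: (pass_all (e := is_child) (rk := id) (lv := level) (g := fun=> g) (tm := tm)
  (K := fun i s => kept i s /\ forall x, (x < h * S)%N -> mem s (b + x)%N = g x)) => //.
  by move=> i j; rewrite /is_child; nlia.
move=> i ib ob hib hob.
apply: (@down_spec _ _ _ _ _ _ _ Hw h S bz aa aa_ge0 aa_alpha hw_z hw_p hw_h
  i _ b base g tm (level i)) => //= [j||].
- have := hib j; rewrite is_child_parent; case ji: (is_parent i j) => //.
  by rewrite -is_child_parent in ji; rewrite /level (trunc_log_child ji).
- exact: root.
move=> s' e1 e2 e3 e4 e5 e6 e7 e8; split=> //; split=> //.
by apply: (kept_intro (m := level i)) => //; have := trunc_log_ord i; rewrite h_log /level; nlia.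
Qed.
End Passes.

Lemma all_reduce_spec b base (t0 : R) sg (f : nat -> nat -> word T)
    (Q : ('I_p -> st) -> Prop) :
  (64 <= b)%N -> (b + h * S <= bz)%N ->
  (forall i, env h S bz i (mem (sg i))) ->
  (forall i m, (forall a, (a < 16)%N -> m a = mem (sg i) a) -> ev m base = WNum b) ->
  (forall i, clk (sg i) <= t0) -> (forall i, prt (sg i) <= t0) ->
  (forall i x, (x < h * S)%N -> mem (sg i) (b + x)%N = f i x) ->
  (forall sg', (forall i, [/\ que (sg' i) = que (sg i), rep (sg' i) = rep (sg i),
       forall a, unaffected h S bz b a -> mem (sg' i) a = mem (sg i) a,
       clk (sg' i) <= t0 + 5 * h%:R * delta & prt (sg' i) <= t0 + 5 * h%:R * delta]) ->
     (forall i x, (x < h * S)%N -> mem (sg' i) (b + x)%N = reduction p op f p 0 x) ->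
     Q sg') ->
  PW (all_reduce comb base) Q sg.
Proof.
move=> b64 bbz he hb hc hp hf hQ.
have hd : 30 <= delta.
  have de : delta = 2 * aa + 30 * (S%:R + 1) by [].
  by have a0 := aa_ge0; have S0 := ler0n R S; rewrite de; move: a0 S0; lra.
have hh : 1 <= h%:R :> R by rewrite ler1n h_log.
have hhd : 30 <= h%:R * delta.
  by apply: le_trans hd _; rewrite ler_peMl // delta_ge0.
apply: PW_seq => k; set sg0 := fun i => tick 1 (sg i).
have [i|i|i|i|sg1 h1 r1] := @up_all b base (t0 + 5) sg0 b64 bbz _ _ _ _ k.
- exact: he.
- exact: hb.
- by rewrite /=; have := hc i; lra.
- by rewrite /=; have := hp i; lra.
exists sg1; last exact: r1.
have small a : (a < 16)%N -> unaffected h S bz b a by rewrite /unaffected => ->.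
move=> k'; set t1 := t0 + 5 + (h + h)%:R * delta in h1.
have [i|i|i|i|i i0|sg2 h2 r2] := @down_all b base (t1 + 4) sg1 b64 bbz _ _ _ _ k'
    (reduction p op (entry b sg0) p 0).
- by have [[_ _ um _ _] _] := h1 i; apply: env_unaffected (he i) um.
- by have [[_ _ um _ _] _] := h1 i; apply: (hb i) => a /small; apply: um.
- by have [[_ _ _ h3 _] _] := h1 i; rewrite lerD2r.
- by have [[_ _ _ _ h3] _] := h1 i; apply: le_trans h3 _; rewrite lerDl.
- by have [_ h3] := h1 i; rewrite i0 in h3.
exists sg2; last exact: r2.
have hE x : (0 < p)%N -> (x < h * S)%N -> reduction p op (entry b sg0) p 0 x = reduction p op f p 0 x.
  move=> p0 xh; suff H n k0 : (k0 < p)%N ->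
      reduction p op (entry b sg0) n k0 x = reduction p op f n k0 x.
    exact: H.
  elim: n k0 => [|n IH] k0 kp.
    by have := hf (Ordinal kp) _ xh; rewrite /= /entry insubT.
  rewrite /= /gather /gather_one.
  have -> : entry b sg0 k0 x = f k0 x.
    by have := hf (Ordinal kp) _ xh; rewrite /= /entry insubT.
  by case: ltnP => l1; case: ltnP => l2 //; rewrite ?IH //; nlia.
(* Each pass takes [2 * h] periods; the fifth [h * delta], being at least 30, swallows the additive
   constants. *)
have bound (x : R) : x <= t1 + 4 + (h + h)%:R * delta -> x <= t0 + 5 * h%:R * delta.
  move=> hx; apply: le_trans hx _; rewrite /t1 natrD mulrDl.
  by rewrite -[5 * _ * _]mulrA; move: (h%:R * delta) hhd => y hy; lra.
apply: hQ => [i|i x xh]; last by have [_ h3] := h2 i; rewrite h3 // hE //; exact: leq_trans (ltn_ord i).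
have [[q1 q2 q3 q4 q5] _] := h1 i; have [[u1 u2 u3 u4 u5] _] := h2 i.
split; [by rewrite u1 q1 | by rewrite u2 q2 | by move=> a ha; rewrite u3 // q3 | |];
  exact: bound.
Qed.
End AllReduce.

(** * The program *)

Lemma reduction_ext (disp : Order.disp_t) (T : orderType disp) p op
    (f g : nat -> nat -> word T) n i x y : (i < p)%N ->
  (forall k, (k < p)%N -> f k x = g k y) ->
  reduction p op f n i x = reduction p op g n i y.
Proof.
move=> + fg; elim: n i => [|n IH] i ip; first exact: fg.
rewrite /= /gather /gather_one fg //.
by case: ltnP => l1; case: ltnP => l2 //; rewrite ?IH.
Qed.

Definition add_to (a b : expr) : cmd := Assign a (At a :+ At b).
(** No test for the kind of a word is needed: comparing a number with an object yields 0. So a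
    missing left operand is always replaced, and a missing right one never replaces an object. *)
Definition min_to (a b : expr) : cmd :=
  If (Bin OpEq (At a) (Const 0) :+ (At b :< At a)) (Assign a (At b)) Skip.

(* The loop counter 16 runs over the [d] trials; "no object" is the number 0. *)
Definition trial : expr := Const 64 :+ V 16.
Definition trial_rank : expr := V 9 :+ V 16.
(** A missing threshold acts as plus infinity, and then all local objects count. *)
Definition count_below (a e : expr) : cmd :=
  If (Bin OpEq e (Const 0)) (Size a) (Rank a e).

Definition draw : cmd := For 16 (V 4) (Rand trial ((V 3 :- V 7) :+ (V 3 :- V 7))).
Definition select : cmd := For 16 (V 4) (Select trial (V 8 :+ At trial)).
Definition count_loop : cmd := For 16 (V 4) (count_below trial_rank (At trial)).
Definition update : cmd :=
  For 16 (V 4) (If (V 3 :< At trial_rank) Skip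
    (If (At trial_rank :< V 7) Skip
      (Seq (Assign (Const 7) (At trial_rank)) (count_below (Const 8) (At trial))))).
Definition after_draw : cmd :=
  Seq select (Seq (all_reduce min_to (Const 64))
    (Seq count_loop (Seq (all_reduce add_to (V 9)) update))).
Definition round : cmd := Seq draw after_draw.
Definition loop : cmd := While (V 7 :< V 2) round.

(** The halving loop makes the number of packets equal to the number of tree levels. Both arrays get
    [d + p] cells because [d] is padded to a multiple of the packet length, see [hS_le]. *)
Definition setup : cmd :=
  Seq (Assign (Const 5) (Const 1))
  (Seq (Assign (Const 21) (V 0))
  (Seq (While (Const 1 :< V 21)
         (Seq (Assign (Const 21) (Bin OpDiv (V 21) (Const 2)))
              (Assign (Const 5) (V 5 :+ Const 1))))
  (Seq (Assign (Const 6) (Bin OpDiv (V 4) (V 5) :+ Const 1))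
  (Seq (Assign (Const 9) (Const 64 :+ (V 4 :+ V 0)))
       (Assign (Const 10) (V 9 :+ (V 4 :+ V 0))))))).

Definition delete_min : cmd := Seq setup (Seq loop (Remove (V 8))).

Section Local.
Variables (R : realFieldType) (disp : Order.disp_t) (T : orderType disp).
Variables (w : nat) (alpha beta : R) (p : nat).
Hypothesis Hw : (128 <= 2 ^ w)%N.
Local Notation ev := (@eval disp T w).
Local Notation W := (@W R disp T w alpha beta p).
Local Notation st := (@st R disp T p).
Implicit Types (i : 'I_p) (s : st) (Q : st -> Prop).

Definition add_op (u v : word T) : word T := eval_bin w OpAdd u v.
Definition min_op (u v : word T) : word T :=
  if num (eval_bin w OpAdd (eval_bin w OpEq u (WNum 0)) (eval_bin w OpLt v u)) != 0%N
  then v else u.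

Lemma add_implements : implements w alpha beta p add_to add_op.
Proof.
move=> i s a b x y Q ea eb hQ; apply: (W_assign alpha beta i (x := x) (v := add_op (mem s x) (mem s y))) => //.
  by rewrite /= ea eb.
by apply: (hQ 1); lra.
Qed.

Lemma min_implements : implements w alpha beta p min_to min_op.
Proof.
move=> i s a b x y Q ea eb hQ; apply: W_if.
rewrite (_ : num _ = num (eval_bin w OpAdd (eval_bin w OpEq (mem s x) (WNum 0))
  (eval_bin w OpLt (mem s y) (mem s x)))); last by rewrite /= ea eb mod0n.
have := hQ; rewrite /min_op; case: ifP => _ {}hQ.
  apply: (W_assign alpha beta i (x := x) (v := mem s y)) => //; first by rewrite /= eb.
  have := hQ (1 + 1); rewrite /store /tick /setm /= addrA; apply; lra.
apply: W_skip; have := hQ (1 + 1); rewrite upd_id /tick /setm /= addrA; apply; lra.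
Qed.

Definition count_of (q : seq T) (x : word T) : nat :=
  if x is WObj y then count (fun z => (z < y)%O) q else size q.

Definition is_candidate (x : word T) : bool := if x is WNum n then n == 0%N else true.

Lemma tree_cost_ge1 n : 1 <= tree_cost R n.
Proof. by rewrite /tree_cost ler1n. Qed.

Lemma le_tree_cost m n : (m <= n)%N -> tree_cost R m <= tree_cost R n.
Proof. by move=> mn; rewrite /tree_cost ler_nat ltnS leq_trunc_log. Qed.

Lemma count_below_spec i s a e x y K Q :
  ev (mem s) a = WNum x -> ev (mem s) e = y -> is_candidate y ->
  (count_of (que s) y <= K)%N ->
  (forall t : R, t <= 1 + tree_cost R K ->
    Q (setm (upd (mem s) x (WNum (count_of (que s) y))) (tick t s))) ->
  W i (count_below a e) Q s.
Proof.
move=> ea ee cy le hQ; apply: W_if; have t1 := tree_cost_ge1 K.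
rewrite (_ : num _ = (if y is WNum _ then 1 else 0)%N); last first.
  by rewrite /= ee mod0n; case: y cy {ee le hQ} => //= n ->.
case: y cy ee le hQ => [n|y] /= /eqP cy ee le hQ.
  apply: W_size; first exact: ea.
  by have := hQ (1 + 1); rewrite /store /tick /setm /= addrA; apply; lra.
apply: W_rank; [exact: ea | exact: ee |].
have := hQ (1 + tree_cost R (count (fun z => (z < y)%O) (que s))).
rewrite /tick /setm /= addrA; apply.
by rewrite lerD2l le_tree_cost.
Qed.

Variables (d klo khi h S by_ bz : nat).
Hypothesis hw_d : (by_ + d + 64 < 2 ^ w)%N.
Hypothesis hd_by : (64 + d <= by_)%N.

Lemma ev_trial (m : nat -> word T) j : m 16%N = WNum j -> (j < d)%N -> ev m trial = WNum (64 + j).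
Proof. by move=> m16 jd; apply: ev_add; rewrite ?ev_const ?ev_var //; lia. Qed.

Lemma ev_trial_rank (m : nat -> word T) j : m 9%N = WNum by_ -> m 16%N = WNum j -> (j < d)%N ->
  ev m trial_rank = WNum (by_ + j).
Proof. by move=> m9 m16 jd; apply: ev_add; rewrite ?ev_var //; lia. Qed.

Lemma select_spec i s l (u : nat -> nat) K Q :
  mem s 4%N = WNum d -> mem s 8%N = WNum l -> (l + K < 2 ^ w)%N ->
  (forall j, (j < d)%N -> mem s (64 + j)%N = WNum (u j) /\ (u j <= K)%N) ->
  (forall (m : nat -> word T) (t : R), t <= 3 + d%:R * (3 + tree_cost R (l + K)) ->
    (forall a : nat, a != 16%N -> ~~ (64 <= a < 64 + d)%N -> m a = mem s a) ->
    (forall j, (j < d)%N -> m (64 + j)%N = nth_word (que s) (l + u j)) ->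
    Q (setm m (tick t s))) ->
  W i select Q s.
Proof.
move=> m4 m8 lK hu hQ; set tc := tree_cost R (l + K).
apply: (@W_for_setm _ _ _ _ _ _ _ Hw _ _ _ _ d (3 + tc) (fun x m => [/\ m 16%N = WNum x,
   forall a, a != 16%N -> ~~ (64 <= a < 64 + x)%N -> m a = mem s a &
   forall j, (j < x)%N -> m (64 + j)%N = nth_word (que s) (l + u j)])) => //.
- lia.
- by move=> x m [mx me _]; split=> //; rewrite ev_var // me //; lia.
- by split=> // a na _; rewrite /upd (negbTE na).
- move=> x s' xd [mx me mj] sq; have [hux huK] := hu x xd.
  have mt : ev (mem s') trial = WNum (64 + x) by apply: ev_trial.
  apply: (W_select alpha beta i (x := (64 + x)%N) (h := (l + u x)%N)); first exact: mt.
    apply: ev_add; last by lia.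
      by rewrite ev_var // me //; lia.
    by rewrite (ev_at mt) me ?hux //; lia.
  do 2 eexists; split; [reflexivity | | | split=> //].
  + have : tree_cost R (l + u x) <= tc by rewrite le_tree_cost // leq_add2l.
    by lra.
  + by rewrite /upd; case: eqP => //; lia.
  + by move=> a na ha; rewrite /upd (negbTE na); case: eqP => [|_]; [lia | apply: me => //; lia].
  + move=> j; rewrite ltnS leq_eqVlt /upd => /predU1P[->|jx].
      by case: eqP => [|_]; [lia | rewrite eqxx sq].
    by do 2 (case: eqP => [|_]; first by lia); apply: mj.
- by move=> m t ht [_ me mj]; apply: hQ.
Qed.

Lemma count_loop_spec i s (x : nat -> word T) K Q :
  mem s 4%N = WNum d -> mem s 9%N = WNum by_ ->
  (forall j, (j < d)%N -> [/\ mem s (64 + j)%N = x j, is_candidate (x j) &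
     (count_of (que s) (x j) <= K)%N]) ->
  (forall (m : nat -> word T) (t : R), t <= 3 + d%:R * (4 + tree_cost R K) ->
    (forall a : nat, a != 16%N -> ~~ (by_ <= a < by_ + d)%N -> m a = mem s a) ->
    (forall j, (j < d)%N -> m (by_ + j)%N = WNum (count_of (que s) (x j))) ->
    Q (setm m (tick t s))) ->
  W i count_loop Q s.
Proof.
move=> m4 m9 hx hQ; set tc := tree_cost R K.
apply: (@W_for_setm _ _ _ _ _ _ _ Hw _ _ _ _ d (4 + tc) (fun n m => [/\ m 16%N = WNum n,
   forall a, a != 16%N -> ~~ (by_ <= a < by_ + n)%N -> m a = mem s a &
   forall j, (j < n)%N -> m (by_ + j)%N = WNum (count_of (que s) (x j))])) => //.
- lia.
- by move=> n m [mx me _]; split=> //; rewrite ev_var // me //; lia.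
- by split=> // a na _; rewrite /upd (negbTE na).
- move=> n s' nd [mx me mj] sq; have [hxn cx cK] := hx n nd.
  have mt : ev (mem s') trial = WNum (64 + n) by apply: ev_trial.
  have mr : ev (mem s') trial_rank = WNum (by_ + n) by apply: ev_trial_rank => //; rewrite me //; lia.
  apply: (count_below_spec i (x := (by_ + n)%N) (y := x n) (K := K)) => //.
  + by rewrite (ev_at mt) me //; lia.
  + by rewrite sq.
  move=> t ht; do 2 eexists; split; [reflexivity | by rewrite -/tc in ht; lra | | split=> //].
  + by rewrite /upd; case: eqP => //; lia.
  + by move=> a na ha; rewrite /upd (negbTE na); case: eqP => [|_]; [lia | apply: me => //; lia].
  + move=> j; rewrite ltnS leq_eqVlt /upd => /predU1P[->|jx].
      by case: eqP => [|_]; [lia | rewrite eqxx sq].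
    by do 2 (case: eqP => [|_]; first by lia); apply: mj.
- by move=> m t ht [_ me mj]; apply: hQ.
Qed.

(* [best r L n] is the largest among [L] and the ranks [r j <= khi] with [j < n],
   and the trial in which it is attained. *)
Fixpoint best (r : nat -> nat) (L n : nat) : nat * option nat :=
  if n is j.+1 then
    let: (L', o) := best r L j in
    if ((khi < r j) || (r j < L'))%N then (L', o) else (r j, Some j)
  else (L, None).

Lemma update_spec i s L l (r : nat -> nat) (x : nat -> word T) K Q :
  mem s 3%N = WNum khi -> mem s 4%N = WNum d -> mem s 9%N = WNum by_ ->
  mem s 7%N = WNum L -> mem s 8%N = WNum l ->
  (forall j, (j < d)%N -> [/\ mem s (64 + j)%N = x j, is_candidate (x j),
     mem s (by_ + j)%N = WNum (r j) & (count_of (que s) (x j) <= K)%N]) ->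
  (forall (m : nat -> word T) (t : R), t <= 3 + d%:R * (8 + tree_cost R K) ->
    (forall a : nat, (a < 16)%N -> a != 7%N -> a != 8%N -> m a = mem s a) ->
    m 7%N = WNum (best r L d).1 ->
    m 8%N = WNum (if (best r L d).2 is Some j then count_of (que s) (x j) else l) ->
    Q (setm m (tick t s))) ->
  W i update Q s.
Proof.
move=> m3 m4 m9 m7 m8 hx hQ; set tc := tree_cost R K.
have tc1 : 1 <= tc by apply: tree_cost_ge1.
pose I n (m : nat -> word T) := [/\ m 16%N = WNum n,
  forall a : nat, a != 7%N -> a != 8%N -> a != 16%N -> m a = mem s a,
  m 7%N = WNum (best r L n).1 &
  m 8%N = WNum (if (best r L n).2 is Some j then count_of (que s) (x j) else l)].
apply: (@W_for_setm _ _ _ _ _ _ _ Hw _ _ _ _ d (8 + tc) I) => //.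
- lia.
- by move=> n m [mx me _ _]; split=> //; rewrite ev_var // me.
- by split=> // a _ _ na; rewrite /upd (negbTE na).
- move=> n s' nd [mx me m7' m8'] sq; have [hxn cx hr cK] := hx n nd; rewrite -sq in cK.
  have mt : ev (mem s') trial = WNum (64 + n) by apply: ev_trial.
  have mr : ev (mem s') trial_rank = WNum (by_ + n) by apply: ev_trial_rank => //; rewrite me.
  have mrr : ev (mem s') (At trial_rank) = WNum (r n) by rewrite (ev_at mr) me //; lia.
  have bestE : best r L n.+1 = if ((khi < r n) || (r n < (best r L n).1))%N
      then best r L n else (r n, Some n).
    by rewrite /=; case: (best r L n).
  have keep t : best r L n.+1 = best r L n -> t <= 5 + tc -> exists m t', [/\ tick t s' =
      setm m (tick t' s'), t' <= 8 + tc - 3, m 16%N = WNum n & I n.+1 (upd m 16%N (WNum n.+1))].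
    move=> eb ht; exists (mem s'), t; split=> //; first by lra.
    by split; rewrite ?eb // => a a7 a8 a16; rewrite /upd (negbTE a16) me.
  apply: W_if.
  rewrite (ev_lt (x := khi) (y := r n)) ?ev_var //= ?me //.
  case: ltnP bestE => h1 bestE /=.
    by apply: W_skip; rewrite tick_tick; apply: keep; last by lra.
  apply: W_if; rewrite (ev_lt (x := r n) (y := (best r L n).1)) ?ev_var //=.
  case: ltnP bestE => h2 bestE /=.
    by apply: W_skip; rewrite !tick_tick; apply: keep; last by lra.
  apply: W_seq; apply: W_assign; [exact: ev_const | exact: mrr |].
  set s3 := store _ _ _.
  have mt3 : ev (mem s3) trial = WNum (64 + n) by apply: ev_trial.
  apply: (count_below_spec i (x := 8%N) (y := x n) (K := K)) => //.
  + exact: ev_const.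
  + by rewrite (ev_at mt3) /= /upd /= me //; lia.
  move=> t ht; rewrite -/tc in ht.
  exists (upd (upd (mem s') 7%N (WNum (r n))) 8%N (WNum (count_of (que s) (x n)))), (4 + t); split=> //.
  + by rewrite -sq /s3 /store /setm /tick /= -!addrA; congr (St _ _ _ (_ + _) _ _ _); ring.
  + by lra.
  + by split; rewrite ?bestE // => a a7 a8 a16; rewrite /upd (negbTE a16) (negbTE a8) (negbTE a7) me.
- by move=> m t ht [_ me e7 e8]; apply: hQ => // a a16 a7 a8; rewrite me //; lia.
Qed.
End Local.

(** * Averages over the random draws of a round *)

Section Tapes.
Variables (R : realFieldType) (D d : nat).

(* Expectation over the sequences of [n] independent uniform numbers below [D]. *)
Fixpoint avg_tape n (b : seq nat -> R) : R :=
  if n is n'.+1 then average D (fun r => avg_tape n' (fun u => b (r :: u))) else b [::].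

Fixpoint avg_all n (b : seq (seq nat) -> R) : R :=
  if n is n'.+1 then avg_tape d (fun u => avg_all n' (fun us => b (u :: us))) else b [::].

Definition is_tape (u : seq nat) : bool := (size u == d) && all (fun r => r < D)%N u.
End Tapes.

Section Unroll.
Variables (R : realFieldType) (disp : Order.disp_t) (T : orderType disp).
Variables (w : nat) (alpha beta : R) (p : nat).
Local Notation config := (config R T p).
Local Notation ev := (@eval disp T w).
Local Notation st := (@st R disp T p).
Implicit Types (i : 'I_p) (s : st).
Variables (X : ('I_p -> nat) -> config -> R -> Prop).
Hypothesis X_ok : compatible w alpha beta X.

(* Every PE makes at least one step per round. *)
Lemma unroll_all F e x k sg b :
  (forall i, num (ev (mem (sg i)) e) != 0%N) ->
  X F (glob (x :: While e x :: k) (fun i => tick 1 (sg i))) b ->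
  X (fun i => (F i).+1) (glob (While e x :: k) sg) b.
Proof.
move=> he hX; have [Xs Xl] := X_ok.
(* In [cf m] the first [m] PEs have passed the loop test. Each test is the step charged to the
   budget of its PE. *)
pose cf m : config := Config (fun i => if (i < m)%N then pe_of (x :: While e x :: k) (tick 1 (sg i))
   else pe_of (While e x :: k) (sg i)) (fun _ _ => [::]).
have loop n m : (m + n = p)%N -> X (fun i => F i + (m <= i))%N (cf m) b.
  elim: n m => [|n IH] m mn.
    rewrite addn0 in mn; subst m; apply: Xl (lexx b) _ => [i|].
      by rewrite [(p <= i)%N]leqNgt ltn_ord addn0.
    rewrite (_ : cf p = glob (x :: While e x :: k) (fun i => tick 1 (sg i))) //.
    by congr Config; apply/funext => i; rewrite ltn_ord.
  have mp : (m < p)%N by lia.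
  pose i := Ordinal mp.
  have lc : look (cf m) i = mute (sg i) by rewrite /look /= ltnn.
  have cc : code (pes (cf m) i) = While e x :: k by rewrite /= ltnn.
  have en : enabled w (cf m) i by rewrite /enabled cc.
  have dr : draws w (pes (cf m) i) = 1%N by rewrite /draws cc.
  have := Xs (fun j => F j + (m.+1 <= j))%N (cf m) i (fun _ => b) en; rewrite dr average1 => h.
  apply: Xl (lexx b) (h _) => [j|r _].
    by rewrite /incr -val_eqE /=; lia.
  have -> : step w alpha beta (cf m) i r = cf m.+1.
    rewrite -(put_look cc) lc step_local // /put /cf /= he /=; congr Config.
      apply/funext => j; rewrite /upd; case: eqVneq => [->|ji] /=; first by rewrite ltnSn.
      by rewrite ltnS [(j <= m)%N]leq_eqVlt -[(j == m :> nat)]/(val j == val i) val_eqE (negbTE ji).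
    by apply/funext => a; apply/funext => a'; do !case: eqP => //.
  by apply: IH; lia.
apply: (Xl _ (fun i => F i + (0 <= i))%N) (lexx b) _ => [i|]; first by rewrite leq0n addn1.
rewrite (_ : glob _ _ = cf 0%N) //; first by apply: (loop p).
Qed.
End Unroll.

Section Draw.
Variables (R : realFieldType) (disp : Order.disp_t) (T : orderType disp).
Variables (w : nat) (alpha beta : R) (p : nat).
Hypothesis Hw : (128 <= 2 ^ w)%N.
Local Notation config := (config R T p).
Local Notation ev := (@eval disp T w).
Local Notation st := (@st R disp T p).
Implicit Types (i : 'I_p) (s : st).
Variables (d khi L : nat).
Hypotheses (hw_d : (64 + d < 2 ^ w)%N) (hw_khi : (khi + khi < 2 ^ w)%N) (L_khi : (L < khi)%N).
Local Notation D := ((khi - L) + (khi - L))%N.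
Variables (X : ('I_p -> nat) -> config -> R -> Prop).
Hypothesis X_ok : compatible w alpha beta X.

Lemma X_local F c i x k s b : is_local x ->
  let y := local_step w (pe_of (x :: k) s) 0 in
  X F (put c i (code y) (setpe y s)) b -> X F (put c i (x :: k) s) b.
Proof.
move=> lx y h; 
  exact: (@compatible_reach _ _ _ _ _ _ _ X F _ _ b X_ok (@reach_local _ _ _ w alpha beta _ c i x k s lx) h).
Qed.

Definition drawn s (u : seq nat) s' : Prop := exists2 m, exists2 t : R,
  t <= 3 + 4 * d%:R & s' = setm m (tick t s)
  & (forall a : nat, a != 16%N -> ~~ (64 <= a < 64 + d)%N -> m a = mem s a) /\
    forall j, (j < d)%N -> m (64 + j)%N = WNum (nth 0%N u j).

Lemma draw_spec F c i k s b :
  mem s 3%N = WNum khi -> mem s 4%N = WNum d -> mem s 7%N = WNum L ->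
  (forall u s', is_tape D d u -> drawn s u s' -> X F (put c i k s') (b u)) ->
  X F (put c i (draw :: k) s) (avg_tape D d b).
Proof.
move=> m3 m4 m7 hb; apply: X_local => //=; apply: X_local => //=.
rewrite mod0n modn_small; last by apply: leq_trans Hw.
set WL := While _ _.
have loop n v m (t : R) : (size v + n = d)%N -> all (fun r => r < D)%N v ->
    t <= 2 + 4 * (size v)%:R -> m 16%N = WNum (size v) ->
    (forall a : nat, a != 16%N -> ~~ (64 <= a < 64 + size v)%N -> m a = mem s a) ->
    (forall j, (j < size v)%N -> m (64 + j)%N = WNum (nth 0%N v j)) ->
    X F (put c i (WL :: k) (setm m (tick t s))) (avg_tape D n (fun u => b (v ++ u))).
  elim: n v m t => [|n IH] v m t sv av ht m16 me mv.
    rewrite addn0 in sv.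
    apply: X_local => //.
    rewrite (_ : code _ = k); last first.
      rewrite /= modn_small; last by apply: leq_trans Hw.
      rewrite [(4 %% _)%N]modn_small; last by apply: leq_trans Hw.
      by rewrite m16 me //= ?m4 /= ?sv ?ltnn //; lia.
    rewrite /= cats0; apply: hb; first by rewrite /is_tape sv eqxx.
    exists m; last by rewrite -sv.
    by exists (t + 1); [rewrite -sv; lra | rewrite /setm /tick /setpe /= addrA].
  have vd : (size v < d)%N by lia.
  apply: X_local => //.
  rewrite (_ : code _ = [:: Seq (Rand trial ((V 3 :- V 7) :+ (V 3 :- V 7)))
      (Assign (Const 16) (V 16 :+ Const 1)), WL & k]); last first.
    rewrite /= modn_small; last by apply: leq_trans Hw.
    rewrite [(4 %% _)%N]modn_small; last by apply: leq_trans Hw.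
    by rewrite m16 me //= ?m4 /= ?vd //; lia.
  apply: X_local => //=.
  set s1 := setpe _ _.
  have s1E : s1 = setm m (tick (t + 2) s).
    by rewrite /s1 /setpe /setm /tick /= -!addrA; congr (St _ _ _ (_ + (_ + _)) _ _ _); ring.
  rewrite s1E; set c1 := put _ _ _ _.
  have eD : ev m ((V 3 :- V 7) :+ (V 3 :- V 7)) = WNum D.
    by apply: ev_add; [| | lia]; apply: ev_sub; rewrite ev_var // me //; lia.
  have dr : draws w (pes c1 i) = D.
    rewrite /draws (_ : pes c1 i = pe_of [:: Rand trial ((V 3 :- V 7) :+ (V 3 :- V 7)),
      Assign (Const 16) (V 16 :+ Const 1), WL & k] (setm m (tick (t + 2) s))); last first.
      by rewrite /c1 /= /upd eqxx.
    by change (maxn 1 (num (ev m ((V 3 :- V 7) :+ (V 3 :- V 7)))) = D); rewrite eD /=; lia.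
  rewrite -dr; apply: (@compatible_draw _ _ _ _ _ _ _ X F c1 i _ X_ok); first by rewrite /enabled /c1 /= /upd eqxx.
  rewrite dr => r rD; rewrite /c1 step_local //; cbv zeta.
  have et : ev m trial = WNum (64 + size v) 
    by apply: ev_add; rewrite ?ev_const ?ev_var //; lia.
  rewrite (_ : code _ = [:: Assign (Const 16) (V 16 :+ Const 1), WL & k]) //.
  rewrite (_ : setpe _ _ = setm (upd m (64 + size v)%N (WNum r)) (tick (t + 2 + 1) s)); last first.
    by rewrite /setpe /setm /tick [local_step]lock /= -lock /local_step /pe_of; cbn -[eval];
       rewrite et fwithE !addrA.
  apply: X_local => //.
  rewrite (_ : code _ = WL :: k) //.
  rewrite (_ : setpe _ _ = setm (upd (upd m (64 + size v)%N (WNum r)) 16%N (WNum (size v).+1))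
     (tick (t + 4) s)); last first.
    rewrite /setpe /setm /tick; cbn -[eval].
    rewrite ev_const // (ev_add (x := size v) (y := 1%N)) ?ev_const //; last by lia.
      by rewrite /= fwithE addn1 -!addrA; congr (St _ _ _ (_ + (_ + _)) _ _ _); ring.
    by rewrite ev_var // /upd; case: eqP => //; lia.
  have -> : (fun u => b (v ++ r :: u)) = (fun u => b (rcons v r ++ u)).
    by apply/funext => u; rewrite cat_rcons.
  apply: IH; rewrite ?size_rcons ?all_rcons ?rD //.
  - by lia.
  - by rewrite -[(size v).+1%:R]natr1; lra.
  - move=> a na ha; rewrite /upd (negbTE na); case: eqP => [|_]; first by lia.
    by apply: me => //; lia.
  - move=> j; rewrite ltnS leq_eqVlt /upd nth_rcons => /predU1P[->|jv].
      by rewrite ltnn eqxx; case: eqP => [|_]; [lia | rewrite eqxx].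
    by rewrite jv; do 2 (case: eqP => [|_]; first by lia); apply: mv.
rewrite (_ : setpe _ _ = setm (upd (mem s) 16%N (WNum 0)) (tick 2 s)); last first.
  by rewrite /setpe /setm /tick /= fwithE -!addrA; congr (St _ _ _ (_ + _) _ _ _); ring.
apply: (loop d [::]) => //=; first by lra.
by move=> a na _; rewrite /upd (negbTE na).
Qed.

Lemma draw_all F k sg b :
  (forall i, [/\ mem (sg i) 3%N = WNum khi, mem (sg i) 4%N = WNum d & mem (sg i) 7%N = WNum L]) ->
  (forall us sg', size us = p -> all (is_tape D d) us ->
     (forall i, drawn (mute (sg i)) (nth [::] us i) (sg' i)) -> X F (glob k sg') (b us)) ->
  X F (glob (draw :: k) sg) (avg_all D d p b).
Proof.
move=> hm hb.
pose cf m (sg' : 'I_p -> st) : config := Config (fun i => if (i < m)%N then pe_of k (sg' i)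
   else pe_of (draw :: k) (sg i)) (fun _ _ => [::]).
have loop n m us sg' : (m + n = p)%N -> size us = m -> all (is_tape D d) us ->
    (forall i, (i < m)%N -> drawn (mute (sg i)) (nth [::] us i) (sg' i)) ->
    X F (cf m sg') (avg_all D d n (fun us' => b (us ++ us'))).
  elim: n m us sg' => [|n IH] m us sg' mn su au hd.
    rewrite /= cats0; rewrite addn0 in mn; rewrite mn in su hd *.
    rewrite (_ : cf p sg' = glob k sg').
      by apply: hb => // i; apply: hd; rewrite ltn_ord.
    by congr Config; apply/funext => i; rewrite ltn_ord.
  have mp : (m < p)%N by lia.
  pose i := Ordinal mp.
  have lc : look (cf m sg') i = mute (sg i) by rewrite /look /= ltnn.
  have cc : code (pes (cf m sg') i) = draw :: k by rewrite /= ltnn.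
  rewrite -(put_look cc) lc; have [m3 m4 m7] := hm i.
  apply: draw_spec => // u s' hu hs'.
  have -> : (fun us' => b (us ++ u :: us')) = (fun us' => b (rcons us u ++ us')).
    by apply/funext => us'; rewrite cat_rcons.
  rewrite (_ : put _ _ _ _ = cf m.+1 (upd sg' i s')).
    apply: IH; rewrite ?size_rcons ?su ?all_rcons ?hu //; first by lia.
    move=> j; rewrite ltnS leq_eqVlt nth_rcons su /upd => /predU1P[ji|jm].
      by have -> : j = i by [apply: val_inj]; rewrite ltnn !eqxx.
    by rewrite jm -val_eqE /= (ltn_eqF jm); apply: hd.
  rewrite /put /cf /=; congr Config; apply/funext => j /=; rewrite /upd.
    case: eqVneq => [->|ji] /=; first by rewrite ltnSn.
    by rewrite ltnS [(j <= m)%N]leq_eqVlt -[(j == m :> nat)]/(val j == val i) val_eqE (negbTE ji).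
  have -> : s' = mute s' by have [m' [t' _ ->] _] := hs'.
  by apply/funext => a; rewrite /=; do !case: eqP => //.
rewrite (_ : glob _ _ = cf 0%N sg); last by congr Config.
exact: (loop p 0%N [::]).
Qed.

End Draw.

Section NthWord.
Variables (disp : Order.disp_t) (T : orderType disp).

Lemma nth_wordP (q : seq T) h : sorted <%O q ->
  (nth_word q h = WNum 0 /\ (size q <= h)%N) \/
  (exists y, [/\ nth_word q h = WObj y, (h < size q)%N, y \in q &
     count (fun z => (z < y)%O) q = h]).
Proof.
move=> sq; rewrite /nth_word; case: (ltnP h (size q)) => hq; last first.
  by left; rewrite drop_oversize.
right; case: q sq hq => // x0 q sq hq; rewrite (drop_nth x0 hq).
set y := nth x0 _ h; exists y; split=> //; first by apply: mem_nth.
rewrite -[in LHS](cat_take_drop h (x0 :: q)) count_cat.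
have E1 : count (fun z => (z < y)%O) (take h (x0 :: q)) = h.
  rewrite -[RHS](size_takel (ltnW hq)); apply/eqP; rewrite -all_count.
  apply/(all_nthP x0) => k; rewrite size_takel ?(ltnW hq) // => kh.
  rewrite nth_take // /y; apply: (sorted_ltn_nth lt_trans) => //; rewrite inE //.
  exact: ltn_trans hq.
have E2 : count (fun z => (z < y)%O) (drop h (x0 :: q)) = 0%N.
  apply/eqP; rewrite -leqn0 leqNgt -has_count; apply/hasPn => z /(nthP x0)[k].
  rewrite size_drop nth_drop => kh <-; rewrite -leNgt /y.
  have s2 : sorted <=%O (x0 :: q) by apply: sub_sorted sq => a b /ltW.
  apply: (sorted_leq_nth le_trans le_refl) => //; rewrite ?inE ?leq_addr //.
  by move: kh; rewrite /=; lia.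
by rewrite E1 E2 addn0.
Qed.

Lemma nth_word_candidate (q : seq T) h : is_candidate (nth_word q h).
Proof. by rewrite /nth_word; case: drop. Qed.
End NthWord.

Section Minimum.
Variables (disp : Order.disp_t) (T : orderType disp) (w p : nat).
Hypothesis Hw : (128 <= 2 ^ w)%N.

(* The number 0 stands for "no object" and acts as plus infinity. *)
Definition is_minimum (I : eqType) (A : seq I) (f : I -> word T) (v : word T) : Prop :=
  (v = WNum 0 /\ {in A, forall i, f i = WNum 0}) \/
  (exists y, [/\ v = WObj y, exists2 i, i \in A & f i = WObj y &
     {in A, forall i z, f i = WObj z -> (y <= z)%O}]).

Lemma min_opE (u v : word T) : is_candidate u -> is_candidate v ->
  min_op w u v = match u, v with
    | WObj y, WObj z => if (z < y)%O then v else u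
    | WObj _, WNum _ => u
    | WNum _, _ => v end.
Proof.
have w1 : (1 < 2 ^ w)%N by apply: leq_trans Hw.
case: u v => [n|y] [m|z] //= => [/eqP-> /eqP->|/eqP-> _|_ _|_ _]; rewrite /min_op /=.
- by rewrite modn_small.
- by rewrite modn_small.
- by rewrite mod0n.
- by case: (z < y)%O; rewrite /= ?add0n ?addn0 ?mod0n ?modn_small //=.
Qed.

Lemma min_op_minimum (I : eqType) (A B : seq I) f u v :
  is_candidate u -> is_candidate v -> is_minimum A f u -> is_minimum B f v ->
  is_minimum (A ++ B) f (min_op w u v).
Proof.
move=> cu cv hu hv; rewrite min_opE //.
case: hu => [[-> hA]|[y [-> [i iA fi] hA]]]; case: hv => [[-> hB]|[z [-> [j jB fj] hB]]].
- by left; split=> // k; rewrite mem_cat => /orP[/hA|/hB].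
- right; exists z; split=> // [|k]; first by exists j => //; rewrite mem_cat jB orbT.
  by rewrite mem_cat => /orP[/hA ->|/hB].
- right; exists y; split=> // [|k]; first by exists i => //; rewrite mem_cat iA.
  by rewrite mem_cat => /orP[/hA|/hB ->].
- right; case: ltP => [zy|yz].
    exists z; split=> // [|k]; first by exists j => //; rewrite mem_cat jB orbT.
    rewrite mem_cat => /orP[/hA h x /h|/hB //]; exact/le_trans/ltW.
  exists y; split=> // [|k]; first by exists i => //; rewrite mem_cat iA.
  by rewrite mem_cat => /orP[/hA //|/hB h x /h]; exact/le_trans.
Qed.

Lemma minimum_candidate (I : eqType) (A : seq I) f v : is_minimum A f v -> is_candidate v.
Proof. by case=> [[->]|[y [->]]]. Qed.

Lemma minimum_perm (I : eqType) (A B : seq I) f v : A =i B ->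
  is_minimum A f v -> is_minimum B f v.
Proof.
move=> AB [[-> h]|[y [-> [i iA fi] h]]]; [left|right]; first by split=> // k; rewrite -AB; apply: h.
exists y; split=> // [|k]; first by exists i; rewrite -?AB.
by rewrite -AB; apply: h.
Qed.

Lemma reduction_min (f : nat -> nat -> word T) x : (0 < p)%N ->
  (forall i, (i < p)%N -> is_candidate (f i x)) ->
  is_minimum (iota 0 p) (fun i => f i x) (reduction p (min_op w) f p 0 x).
Proof.
move=> p0 hf.
have [i ip|A B u v h1 h2|A pA h] := @reduction_ind _ T p (min_op w) f
  (fun A v => is_minimum A (fun i => f i x) v) x p0.
- have := hf i ip; case E: (f i x) => [n|y] /=; [move/eqP=> n0; left|move=> _; right].
    by rewrite n0; split=> // k; rewrite inE => /eqP ->; rewrite E n0.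
  exists y; split=> // [|k]; first by exists i => //; rewrite inE.
  by rewrite inE => /eqP -> z; rewrite E => -[->].
- by apply: min_op_minimum (h1) (h2); [apply: minimum_candidate (h1) | apply: minimum_candidate (h2)].
- by apply: minimum_perm h => k; apply: perm_mem.
Qed.

(** The machine reduces modulo [2 ^ w] at every node, so the invariant is the sum modulo [2 ^ w];
    the bound on the full sum removes the modulus at the end. *)
Lemma reduction_add (f : nat -> nat -> word T) (g : nat -> nat) x : (0 < p)%N ->
  (forall i, (i < p)%N -> f i x = WNum (g i)) -> (\sum_(0 <= i < p) g i < 2 ^ w)%N ->
  reduction p (@add_op _ T w) f p 0 x = WNum (\sum_(0 <= i < p) g i)%N.
Proof.
move=> p0 hf hs.
have gs i : (i < p)%N -> (g i <= \sum_(0 <= j < p) g j)%N.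
  by move=> ip; rewrite big_mkord (bigD1 (Ordinal ip)) //= leq_addr.
have [i ip|A B u v -> ->|A pA ->] := @reduction_ind _ T p (@add_op _ T w) f
  (fun A v => v = WNum ((\sum_(i <- A) g i) %% 2 ^ w)%N) x p0.
- by rewrite hf // big_seq1 modn_small // (leq_ltn_trans (gs i ip)).
- by rewrite /add_op /= big_cat modnDm.
- by rewrite (perm_big _ pA) /= modn_small ?/index_iota ?subn0 //; move: hs; rewrite /index_iota subn0.
Qed.

End Minimum.

(** * Rounds *)

Lemma best_spec khi r L n (L' := (best khi r L n).1) :
  [/\ (L <= L')%N, (L <= khi)%N -> (L' <= khi)%N,
     forall j, (j < n)%N -> (r j <= khi)%N -> (r j <= L')%N &
     if (best khi r L n).2 is Some j then (j < n)%N /\ r j = L' else L' = L].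
Proof.
rewrite {}/L'; elim: n => [|n] //=; case: (best khi r L n) => L' o /= [h1 h2 h3 h4].
case: (ltnP khi (r n)) => k1 /=; last case: (ltnP (r n) L') => k2 /=; split=> //.
- by move=> j; rewrite ltnS leq_eqVlt => /predU1P[->|]; [lia | apply: h3].
- by case: o h4 => // j [jn]; split=> //; lia.
- by move=> j; rewrite ltnS leq_eqVlt => /predU1P[->|]; [lia | apply: h3].
- by case: o h4 => // j [jn]; split=> //; lia.
- by lia.
- by move=> j; rewrite ltnS leq_eqVlt => /predU1P[->|jn hj] //; have := h3 j jn hj; lia.
Qed.

(** * Consistent local prefixes *)

Section Cuts.
Variables (disp : Order.disp_t) (T : orderType disp) (p : nat).
Variable q : 'I_p -> seq T.
Hypothesis q_sorted : forall i, sorted <%O (q i).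
Implicit Types (i : 'I_p) (l : 'I_p -> nat).

(** The local shares [l] describe a global prefix of the sorted queue. This is what the program
    maintains in place of the selected set. *)
Definition cut l : Prop := forall i j x y,
  x \in take (l i) (q i) -> y \in drop (l j) (q j) -> (x < y)%O.

Lemma take_count (s : seq T) y (c := count (fun z => (z < y)%O) s) : sorted <%O s ->
  {in take c s, forall x, (x < y)%O} /\ {in drop c s, forall x, (y <= x)%O}.
Proof.
rewrite {}/c; elim: s => [|a s IH] // ps.
have ss : sorted <%O s by apply: path_sorted ps.
have as' : all (fun x => a < x)%O s by apply: order_path_min ps => ? ? ?; apply: lt_trans.
rewrite [count _ _]/=; case: ltP => ay.
  have [h1 h2] := IH ss; split=> x /=; last exact: h2.
  by rewrite inE => /predU1P[->|/h1].
have -> : count (fun z => (z < y)%O) s = 0%N.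
  apply/eqP; rewrite -leqn0 leqNgt -has_count; apply/hasPn => z /(allP as') az.
  by rewrite -leNgt (le_trans ay) // ltW.
split=> // x; rewrite addn0 drop0 inE => /predU1P[-> //|/(allP as') ax].
by rewrite (le_trans ay) // ltW.
Qed.

Lemma cut_count_of v : cut (fun i => count_of (q i) v).
Proof.
move=> i j x y; case: v => [n|z] /=; first by rewrite drop_size.
have [h1 _] := take_count z (q_sorted i); have [_ h2] := take_count z (q_sorted j).
by move=> /h1 xz /h2; apply: lt_le_trans.
Qed.

(** Sorting the prefixes and the suffixes separately and concatenating gives a sorted permutation of
    the queue, so its first [L] entries are the prefixes. *)
Lemma smallest_cut l (L := (\sum_i l i)%N) : cut l -> (forall i, l i <= size (q i))%N ->
  smallest q L =i flatten [seq take (l i) (q i) | i <- enum 'I_p].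
Proof.
move=> hc hl; set A := flatten _.
pose B := flatten [seq drop (l i) (q i) | i <- enum 'I_p].
have pAB : perm_eq (content q) (A ++ B).
  rewrite /content /A /B; elim: (enum 'I_p) => //= i e IH.
  rewrite -[q i in X in perm_eq X _](cat_take_drop (l i)) -!catA perm_cat2l.
  by rewrite perm_sym perm_catCA perm_cat2l perm_sym.
have sA : size A = L.
  rewrite /A size_flatten /shape -map_comp sumnE big_map /L big_enum /=.
  by apply: eq_bigr => i _; rewrite size_takel.
have AB a b : a \in A -> b \in B -> (a <= b)%O.
  by move=> /flatten_mapP[i _ ai] /flatten_mapP[j _ bj]; apply/ltW/(hc i j).
have so (s : seq T) : sorted <=%O (sort <=%O s) by apply: sort_le_sorted.
have e : sort (fun x y => x <= y)%O (content q) = sort <=%O A ++ sort <=%O B.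
  apply: le_sorted_eq; first exact: so.
    rewrite sorted_pairwise; last by move=> ? ? ?; apply: le_trans.
    rewrite pairwise_cat -!sorted_pairwise ?so; try by move=> ? ? ?; apply: le_trans.
    rewrite !andbT; apply/allrelP => a b; rewrite !mem_sort; exact: AB.
  by rewrite perm_sort (perm_trans pAB) // perm_sym perm_cat // perm_sort.
move=> x; rewrite /smallest e take_size_cat ?size_sort // mem_sort //.
Qed.

Lemma filter_smallest l i (L := (\sum_i l i)%N) : cut l -> (forall i, l i <= size (q i))%N ->
  [seq x <- q i | x \in smallest q L] = take (l i) (q i) /\
  [seq x <- q i | x \notin smallest q L] = drop (l i) (q i).
Proof.
move=> hc hl; have hs := smallest_cut hc hl.
have tk : {in take (l i) (q i), forall x, x \in smallest q L}.
  by move=> x xi; rewrite hs; apply/flatten_mapP; exists i; rewrite ?mem_enum.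
have dr : {in drop (l i) (q i), forall x, x \notin smallest q L}.
  move=> x xi; apply/negP; rewrite hs => /flatten_mapP[j _ xj].
  by have := hc j i x x xj xi; rewrite ltxx.
rewrite -[in X in X = _ /\ _](cat_take_drop (l i) (q i)).
rewrite -[in X in _ /\ X = _](cat_take_drop (l i) (q i)) !filter_cat.
have f1 (P : pred T) (s : seq T) : {in s, forall x, P x} -> [seq x <- s | P x] = s.
  by move=> h; apply/all_filterP/allP.
have f0 (P : pred T) (s : seq T) : {in s, forall x, ~~ P x} -> [seq x <- s | P x] = [::].
  by move=> h; apply/eqP; rewrite -[_ == _]negbK -has_filter; apply/hasPn.
rewrite (f1 _ _ tk) (f0 _ _ dr) cats0; split=> //.
rewrite f0; last by move=> x /tk ->.
by rewrite f1.
Qed.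
End Cuts.

Section TapeAverages.
Variables (R : realFieldType) (D d : nat).
Hypothesis D_gt0 : (0 < D)%N.

Lemma average_affine (a c : R) f : average D (fun r => a + c * f r) = a + c * average D f.
Proof.
rewrite /average big_split /= sumr_const card_ord -mulr_sumr mulrDl mulrA; congr (_ + _).
by rewrite -[a *+ D]mulr_natr mulfK // pnatr_eq0 -lt0n.
Qed.

Lemma avg_tape_affine n (a c : R) b :
  avg_tape D n (fun u => a + c * b u) = a + c * avg_tape D n b.
Proof.
elim: n b => [|n IH] b //=; rewrite -average_affine.
by apply: eq_average => r _; rewrite IH.
Qed.

Lemma avg_all_affine n (a c : R) b :
  avg_all D d n (fun us => a + c * b us) = a + c * avg_all D d n b.
Proof.
elim: n b => [|n IH] b //=; rewrite -avg_tape_affine.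
by congr avg_tape; apply/funext => u; rewrite IH.
Qed.

Lemma ler_avg_tape n (f g : seq nat -> R) : (forall u, is_tape D n u -> f u <= g u) ->
  avg_tape D n f <= avg_tape D n g.
Proof.
elim: n f g => [|n IH] f g fg /=; first exact: fg.
apply: ler_average => r rD; apply: IH => u /andP[/eqP su au]; apply: fg.
by rewrite /is_tape /= su eqxx rD.
Qed.

Lemma ler_avg_all n (f g : seq (seq nat) -> R) :
  (forall us, size us = n -> all (is_tape D d) us -> f us <= g us) ->
  avg_all D d n f <= avg_all D d n g.
Proof.
elim: n f g => [|n IH] f g fg /=; first exact: fg.
apply: ler_avg_tape => u hu; apply: IH => us su au; apply: fg; rewrite /= ?su //.
by rewrite hu.
Qed.

Lemma avg_tape_ge0 n (f : seq nat -> R) : (forall u, 0 <= f u) -> 0 <= avg_tape D n f.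
Proof.
elim: n f => [|n IH] f f0 /=; first exact: f0.
by rewrite mulr_ge0 ?invr_ge0 // sumr_ge0 // => r _; apply: IH.
Qed.

Lemma avg_all_ge0 n (f : seq (seq nat) -> R) : (forall u, 0 <= f u) -> 0 <= avg_all D d n f.
Proof.
elim: n f => [|n IH] f f0 /=; first exact: f0.
by apply: avg_tape_ge0 => u; apply: IH.
Qed.
End TapeAverages.

Section Round.
Variables (R : realFieldType) (disp : Order.disp_t) (T : orderType disp).
Variables (w : nat) (alpha beta : R) (p : nat).
Local Notation config := (config R T p).
Local Notation ev := (@eval disp T w).
Local Notation W := (@W R disp T w alpha beta p).
Local Notation PW := (@PW R disp T w alpha beta p).
Local Notation reach := (@reach R disp T w alpha beta p).
Local Notation st := (@st R disp T p).
Implicit Types (i : 'I_p) (s : st) (sg : 'I_p -> st) (l : 'I_p -> nat) (us : seq (seq nat)).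

Variables (klo khi d : nat) (q : 'I_p -> seq T).
Hypothesis p_gt0 : (0 < p)%N.
Hypothesis q_sorted : forall i, sorted <%O (q i).
Let h := (trunc_log 2 p).+1.
Let S := (d %/ h + 1)%N.
Let by_ := (64 + (d + p))%N.
Let bz := (by_ + (d + p))%N.
Hypothesis hw : (256 + 4 * (d + p + khi) + \sum_i size (q i) < 2 ^ w)%N.
Variable aa : R.
Hypothesis aa_ge0 : 0 <= aa.
Hypothesis aa_alpha : (1 < p)%N -> alpha + S%:R * beta <= aa.
Local Notation delta := (delta S aa).

Let Hw : (128 <= 2 ^ w)%N. Proof. by move: hw; nlia. Qed.

Lemma h_le_p : (h <= p)%N.
Proof.
rewrite /h; have /andP[h1 _] := @trunc_log_bounds 2 p isT p_gt0.
exact: leq_trans (ltn_expl _ (isT : (1 < 2)%N)) h1.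
Qed.

(** Rounding up wastes at most one word per packet, and there are at most [p] packets. *)
Lemma hS_le : (h * S <= d + p)%N.
Proof.
have := h_le_p; rewrite /S mulnDr muln1 mulnC; have := leq_divM d h; nlia.
Qed.

Lemma d_le_hS : (d <= h * S)%N.
Proof. by rewrite /S mulnC addn1 ltnW // ltn_ceil. Qed.

Lemma S_le : (S <= d + 1)%N. Proof. by rewrite /S leq_add2r leq_div. Qed.

Definition drawn_number us (i j : nat) : nat := nth 0%N (nth [::] us i) j.

Definition candidate us l (n j : nat) : word T :=
  if insub n is Some i then nth_word (q i) (l (i : 'I_p) + drawn_number us i j) else WNum 0.

Definition threshold us l j : word T :=
  reduction p (@min_op _ T w) (candidate us l) p 0 j.

Definition rank_of us l j : nat := \sum_i count_of (q i) (threshold us l j).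

Definition next_rank us L l : nat := (best khi (rank_of us l) L d).1.
Definition next_local us L l i : nat :=
  if (best khi (rank_of us l) L d).2 is Some j then count_of (q i) (threshold us l j)
  else l i.

Lemma candidate_ok us l n j : is_candidate (candidate us l n j).
Proof. by rewrite /candidate; case: insubP => // i _ _; apply: nth_word_candidate. Qed.

Lemma threshold_min us l j :
  is_minimum (iota 0 p) (fun n => candidate us l n j) (threshold us l j).
Proof.
by apply: (reduction_min Hw) => // i ip; apply: candidate_ok.
Qed.

Lemma candidateE us l i j :
  candidate us l i j = nth_word (q i) (l i + drawn_number us i j).
Proof. by rewrite /candidate valK. Qed.

(** The threshold is at most the proposal of PE [i], which has local rank [l i + u]; without a
    proposal that number is at least the local size. Hence rank queries stay below [3 * khi] and
    cost O(log khi), whatever the size of the queue. *)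
Lemma count_threshold us l i j :
  (count_of (q i) (threshold us l j) <= l i + drawn_number us i j)%N.
Proof.
have ip : val i \in iota 0 p by rewrite mem_iota add0n /= ltn_ord.
set g := (l i + _)%N.
have none : nth_word (q i) g = WNum 0 -> (size (q i) <= g)%N.
  by case: (nth_wordP g (q_sorted i)) => [[_ //]|[y [-> _ _ _]]].
case: (threshold_min us l j) => [[-> h0]|[y [-> _ hy]]] /=.
  by apply: none; have := h0 _ ip; rewrite candidateE.
case: (nth_wordP g (q_sorted i)) => [[_ le]|[z [ez _ _ cz]]].
  exact: leq_trans (count_size _ _) le.
have yz : (y <= z)%O by apply: hy ip _ _; rewrite candidateE.
rewrite -cz; apply: sub_count => x /= xy; exact: lt_le_trans xy yz.
Qed.

Definition fixed i (m : nat -> word T) : Prop := env h S bz i m /\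
  [/\ m 2%N = WNum klo, m 3%N = WNum khi, m 4%N = WNum d & m 9%N = WNum by_].

Lemma fixed_eq i m m' : fixed i m ->
  (forall a, (a < 16)%N -> a != 7%N -> a != 8%N -> m' a = m a) -> fixed i m'.
Proof.
move=> [[m0 m1 m5 m6 m10] [m2 m3 m4 m9]] e.
by split; split; rewrite e.
Qed.

Definition ready L l tm i s : Prop := [/\ fixed i (mem s),
  mem s 7%N = WNum L /\ mem s 8%N = WNum (l i), que s = q i /\ rep s = [::],
  clk s <= tm & prt s <= tm].

Lemma ready_setm L l tm tm' i s m t : ready L l tm i s ->
  (forall a, (a < 16)%N -> m a = mem s a) -> tm + t <= tm' -> tm <= tm' ->
  ready L l tm' i (setm m (tick t s)).
Proof.
move=> [fx [m7 m8] qr hc hp] e ht htm; split=> //=.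
- by apply: fixed_eq fx _ => a a16 _ _; apply: e.
- by rewrite !e.
- by lra.
- by lra.
Qed.

Let tc := tree_cost R (3 * khi).

Let tc_ge1 : 1 <= tc. Proof. exact: tree_cost_ge1. Qed.

Lemma ready_all_reduce comb op b base L l tm sg Q f : implements w alpha beta p comb op ->
  (64 <= b)%N -> (b + h * S <= bz)%N ->
  (forall i m, fixed i m -> ev m base = WNum b) ->
  (forall i, ready L l tm i (sg i)) ->
  (forall i x, (x < d)%N -> mem (sg i) (b + x)%N = f (val i) x) ->
  (forall sg', (forall i, ready L l (tm + 5 * h%:R * delta) i (sg' i)) ->
     (forall i a, (64 <= a < bz)%N -> ~~ (b <= a < b + h * S)%N -> mem (sg' i) a = mem (sg i) a) ->
     (forall i x, (x < d)%N -> mem (sg' i) (b + x)%N = reduction p op f p 0 x) -> Q sg') ->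
  PW (all_reduce comb base) Q sg.
Proof.
move=> hop b64 bbz hb hr hf hQ.
have hSp := hS_le; have dhS := d_le_hS; have Sd := S_le; have hp := h_le_p.
pose g n x : word T := if insub n is Some i then mem (sg (i : 'I_p)) (b + x)%N else WNum 0.
have fix_i i : fixed i (mem (sg i)) by have [] := hr i.
apply: (@all_reduce_spec _ _ _ _ _ _ _ Hw h S bz aa aa_ge0 aa_alpha _ _ _ _ _ _ hop b base tm sg g) => //.
- by move: hw; rewrite /bz /by_; nlia.
- by move: hw; nlia.
- by move: hw; nlia.
- by move=> i; have [] := fix_i i.
- move=> i m hm; apply: (hb i); apply: fixed_eq (fix_i i) _ => a a16 _ _; exact: hm.
- by move=> i; have [] := hr i.
- by move=> i; have [] := hr i.
- by move=> i x _; rewrite /g valK.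
move=> sg' h1 h2; apply: hQ.
- move=> i; have [e1 e2 e3 e4 e5] := h1 i; have [fx [m7 m8] [eq er] hc hp'] := hr i.
  have sm a : (a < 16)%N -> mem (sg' i) a = mem (sg i) a.
    by move=> a16; apply: e3; rewrite /unaffected a16.
  split=> //; first by apply: fixed_eq fx _ => a a16 _ _; apply: sm.
    by rewrite !sm.
  by rewrite e1 e2.
- move=> i a ab na; have [_ _ e3 _ _] := h1 i; apply: e3.
  by move: ab na; rewrite /unaffected; nlia.
- move=> i x xd; rewrite h2; last by apply: leq_trans dhS.
  apply: reduction_ext => // k kp; rewrite /g insubT /=.
  exact: (hf (Ordinal kp)).
Qed.

(** Three loops over the trials ([select], [count_loop], [update]) and two all-reduce operations of
    [5 * h * delta] each. *)
Definition round_tail_time : R := 20 + 3 * d%:R * (8 + tc) + 10 * h%:R * delta.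

Lemma after_draw_spec us L l tm sg : (L < klo)%N -> (klo <= khi)%N ->
  (forall i, (l i <= L)%N) ->
  (forall i, ready L l tm i (sg i)) ->
  (forall i j, (j < d)%N -> mem (sg i) (64 + j)%N = WNum (drawn_number us i j) /\
     (drawn_number us i j < (khi - L) + (khi - L))%N) ->
  PW after_draw (fun sg' => forall i,
    ready (next_rank us L l) (next_local us L l) (tm + round_tail_time) i (sg' i)) sg.
Proof.
move=> Lklo klohi lL hr hu; have := tc_ge1 => tc1.
have d0 : 0 <= d%:R :> R by [].
have del0 : 0 <= delta by apply: delta_ge0.
have hd0 : 0 <= h%:R * delta by apply: mulr_ge0.
have Wh := Hw.
have hSp := hS_le; have dhS := d_le_hS; have hp := h_le_p.
have sm : (bz + d + 64 + 4 * khi < 2 ^ w)%N by move: hw; rewrite /bz /by_; nlia.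
have Y0 : 0 <= d%:R * (8 + tc) by rewrite mulr_ge0 //; lra.
have YE k : d%:R * (k + tc) = d%:R * (8 + tc) + (k - 8) * d%:R by ring.
set Y := d%:R * (8 + tc) in Y0 YE.
pose c (n j : nat) := candidate us l n j.
pose Q1 i s := ready L l (tm + 4 + Y) i s /\
  forall j, (j < d)%N -> mem s (64 + j)%N = c (val i) j.
apply: PW_seq; apply: (PW_mono (Q := fun sg' => forall i, Q1 i (sg' i))); last first.
  apply: PW_local => i; have [[[m0 m1 m5 m6 m10] [m2 m3 m4 m9]] [m7 m8] [eq er] hc hp'] := hr i.
  apply: (select_spec alpha beta Wh (d := d) (by_ := by_) _ _ i (l := l i) (K := (khi + khi)%N)
     (u := drawn_number us i)) => //.
  - by move: sm; rewrite /bz; nlia.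
  - by rewrite /by_; nlia.
  - by have := lL i; nlia.
  - by move=> j jd; have [-> uj] := hu i j jd; split=> //; nlia.
  move=> m t ht hm hmj; split=> //; split.
    apply: (ready_setm (tm := tm + 1)).
    + by have [fx mm qr hc' hp''] := hr i; split=> //=; lra.
    + by move=> a a16; apply: hm; nlia.
    + have tcl : tree_cost R (l i + (khi + khi)) <= tc.
        by apply: le_tree_cost; have := lL i; nlia.
      have : d%:R * (3 + tree_cost R (l i + (khi + khi))) <= Y.
        by apply: ler_wpM2l => //; lra.
      by lra.
    + by lra.
  by move=> j jd; rewrite /= hmj //= /c candidateE eq.
have ticked i t (L0 : nat) l0 s : ready L0 l0 t i s -> ready L0 l0 (t + 1) i (tick 1 s).
  by move=> [fx mm qr hc hp0]; split=> //=; lra.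
have YE' k : k <= 8 -> d%:R * (k + tc) <= Y.
  by move=> k8; rewrite YE; have : (k - 8) * d%:R <= 0 by [rewrite mulr_le0_ge0 //; lra]; lra.
pose A := 5 * h%:R * delta.
have A0 : 0 <= A by rewrite /A -mulrA mulr_ge0 //; lra.
move=> sg1 h1; apply: PW_seq.
apply: (@ready_all_reduce _ _ 64 _ L l (tm + 4 + Y + 1) _ _ (candidate us l) (min_implements alpha beta (p := p))) => //.
- by rewrite /bz /by_; nlia.
- by move=> i m _; apply: ev_const.
- by move=> i; apply: ticked; have [] := h1 i.
- by move=> i x xd; have [_ ->] := h1 i.
rewrite -/A => sg2 h2 _ h2x; apply: PW_seq.
pose Q3 i s := [/\ ready L l (tm + 9 + 2 * Y + A) i s,
  forall j, (j < d)%N -> mem s (64 + j)%N = threshold us l j &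
  forall j, (j < d)%N -> mem s (by_ + j)%N = WNum (count_of (q i) (threshold us l j))].
apply: (PW_mono (Q := fun sg' => forall i, Q3 i (sg' i))); last first.
  apply: PW_local => i; have [[[m0 m1 m5 m6 m10] [m2 m3 m4 m9]] [m7 m8] [eq er] hc hp'] := h2 i.
  apply: (count_loop_spec alpha beta Wh (d := d) (by_ := by_) _ _ i (K := (3 * khi)%N)
     (x := threshold us l)) => //.
  - by move: sm; rewrite /bz; nlia.
  - by rewrite /by_; nlia.
  - move=> j jd; split; first by rewrite /= h2x.
      exact: minimum_candidate (threshold_min us l j).
    rewrite /= eq; apply: leq_trans (count_threshold us l i j) _.
    by have [_ uj] := hu i j jd; have := lL i; nlia.
  move=> m t ht hm hmj; split=> //; split.
  - apply: (ready_setm (ticked _ _ _ _ _ (h2 i))).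
    + by move=> a a16; apply: hm; rewrite /by_; nlia.
    + by have := YE' 4; rewrite -/tc in ht; move: ht; lra.
    + by lra.
  - move=> j jd; rewrite /= hm; [exact: h2x | by nlia | by rewrite /by_; nlia].
  - by move=> j jd; rewrite /= hmj //= eq.
move=> sg3 h3; apply: PW_seq.
pose g n j := if insub n is Some i then count_of (q (i : 'I_p)) (threshold us l j) else 0%N.
have rE j : (\sum_(0 <= i < p) g i j = rank_of us l j)%N.
  by rewrite big_mkord /rank_of; apply: eq_bigr => i _; rewrite /g valK.
have rlt j : (rank_of us l j < 2 ^ w)%N.
  apply: leq_ltn_trans hw; apply: leq_trans (leq_addl _ _); apply: leq_sum => i _.
  by rewrite /count_of; case: (threshold _ _ _) => // y; apply: count_size.
apply: (@ready_all_reduce _ _ by_ _ L l (tm + 10 + 2 * Y + A) _ _ (fun n j => WNum (g n j)) (add_implements alpha beta (p := p))) => //.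
- by rewrite /bz; nlia.
- by move=> i m [_ [_ _ _ m9]]; rewrite ev_var.
- move=> i; have [hr3 _ _] := h3 i; have := ticked _ _ _ _ _ hr3.
  by rewrite (_ : tm + 9 + 2 * Y + A + 1 = tm + 10 + 2 * Y + A) //; ring.
- by move=> i x xd; have [_ _ /(_ x xd)] := h3 i; rewrite /g valK.
rewrite -/A => sg4 h4 h4f h4x.
apply: PW_local => i; have [[[m0 m1 m5 m6 m10] [m2 m3 m4 m9]] [m7 m8] [eq er] hc hp'] := h4 i.
apply: (update_spec alpha beta Wh (d := d) (khi := khi) (by_ := by_) _ _ i (L := L) (l := l i)
  (r := rank_of us l) (K := (3 * khi)%N) (x := threshold us l)) => //.
- by move: sm; rewrite /bz; nlia.
- by rewrite /by_; nlia.
- move=> j jd; split.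
  + rewrite /= h4f; [|by rewrite /bz /by_; nlia|by rewrite /by_; nlia].
    by have [_ /(_ j jd) h64 _] := h3 i.
  + exact: minimum_candidate (threshold_min us l j).
  + rewrite /= h4x //; rewrite -rE; apply: reduction_add => //; last by rewrite rE.
  + rewrite /= eq; apply: leq_trans (count_threshold us l i j) _.
    by have [_ uj] := hu i j jd; have := lL i; nlia.
move=> m t ht hm hm7 hm8; split=> //; split=> //=.
- by apply: fixed_eq (hm); have [] := h4 i.
- by rewrite hm7 hm8 /next_rank /next_local eq.
- have rt : round_tail_time = 20 + 3 * Y + A + A by rewrite /round_tail_time /A /Y; ring.
  by rewrite rt; move: ht hc; rewrite -/tc -/Y /= => *; lra.
- have rt : round_tail_time = 20 + 3 * Y + A + A by rewrite /round_tail_time /A /Y; ring.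
  by rewrite rt; move: hp'; rewrite /= => *; lra.
Qed.

Hypothesis klo_khi : (klo <= khi)%N.
Local Notation D L := ((khi - L) + (khi - L))%N.

Definition round_time : R := round_tail_time + 4 * d%:R + 6.

Section Step.
Variables (X : ('I_p -> nat) -> config -> R -> Prop).
Hypothesis X_ok : compatible w alpha beta X.

Lemma round_spec F k L l tm sg b : (L < klo)%N -> (forall i, (l i <= L)%N) ->
  (forall i, ready L l tm i (sg i)) ->
  (forall us sg', size us = p -> all (is_tape (D L) d) us ->
     (forall i, ready (next_rank us L l) (next_local us L l) (tm + round_time) i (sg' i)) ->
     X F (glob (loop :: k) sg') (b us)) ->
  X (fun i => (F i).+1) (glob (loop :: k) sg) (avg_all (D L) d p b).
Proof.
move=> Lklo lL hr hb.
apply: (unroll_all X_ok) => [i|].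
  have [[_ [m2 _ _ _]] [m7 _] _ _ _] := hr i.
  by rewrite (ev_lt (x := L) (y := klo)) ?ev_var //= Lklo.
apply: (@compatible_reach _ _ _ _ _ _ _ X F _ _ _ X_ok (reach_seq _ _ _ _ _ _ _)).
set sg1 := fun i => tick 1 (tick 1 (sg i)).
have hr1 i : ready L l (tm + 2) i (sg1 i).
  by have [fx mm qr hc hp] := hr i; split=> //=; lra.
apply: (draw_all Hw (khi := khi) (L := L) _ _ _ X_ok).
- by move: hw; nlia.
- by move: hw; nlia.
- by apply: leq_trans klo_khi.
- by move=> i; have [[_ [_ m3 m4 _]] [m7 _] _ _ _] := hr i.
move=> us sg2 sus aus hd.
have hr2 i : ready L l (tm + 2 + (3 + 4 * d%:R)) i (sg2 i).
  have [m [t ht ->] [hm _]] := hd i.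
  apply: (@ready_setm L l (tm + 2)).
  - by have [fx mm qr hc hp] := hr1 i; split.
  - by move=> a a16; rewrite hm //; nlia.
  - by lra.
  - by have d0 : 0 <= d%:R :> R by []; lra.
have [i j jd|sg3 h3 r3] := after_draw_spec Lklo klo_khi lL hr2
   (us := us) _ (loop :: k).
- have [m [t ht ->] [_ hm]] := hd i; split; first exact: hm.
  have hu : is_tape (D L) d (nth [::] us i).
    by move/allP: aus; apply; apply: mem_nth; rewrite sus.
  by case/andP: hu => /eqP sz /(all_nthP 0%N); apply; rewrite sz.
apply: (@compatible_reach _ _ _ _ _ _ _ X F _ _ _ X_ok r3); apply: hb => // i.
have := h3 i; rewrite (_ : tm + 2 + (3 + 4 * d%:R) + _ = tm + round_time - 1); last first.
  by rewrite /round_time; ring.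
by move=> [fx mm qr hc hp]; split=> //; lra.
Qed.
End Step.

Definition finished l tm i s : Prop := [/\ que s = drop (l i) (q i), rep s = take (l i) (q i),
  clk s <= tm & prt s <= tm].

Lemma finish_spec L l tm sg : (klo <= L)%N -> (forall i, (l i <= 3 * khi)%N) ->
  (forall i, ready L l tm i (sg i)) ->
  exists2 sg', forall i, finished l (tm + 1 + tree_cost R (3 * khi)) i (sg' i) &
    reach (glob [:: loop; Remove (V 8)] sg) (glob [::] sg').
Proof.
move=> Lklo lL hr; have t1 := tree_cost_ge1 R (3 * khi).
pose Q i s := ready L l (tm + 1) i s.
have [sg1 h1 r1] : exists2 sg1, forall i, Q i (sg1 i) &
    reach (glob [:: loop; Remove (V 8)] sg) (glob [:: Remove (V 8)] sg1).
  have hP : PW loop (fun sg' => forall i, Q i (sg' i)) sg.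
    apply: PW_local => i; have [[e [m2 m3 m4 m9]] [m7 m8] qr hc hp] := hr i.
    apply: W_while; rewrite (ev_lt (x := L) (y := klo)) ?ev_var //=.
    rewrite ltnNge Lklo /=; split=> //; split=> //=; lra.
  exact: hP.
have hP : PW (Remove (V 8)) (fun sg' => forall i, finished l (tm + 1 + tree_cost R (3 * khi)) i (sg' i)) sg1.
  apply: PW_local => i; have [_ [m7 m8] [eq er] hc hp] := h1 i.
  apply: (W_remove alpha beta i (h := l i)); first by rewrite ev_var.
  split=> //; rewrite /finished /= eq er; split=> //.
  - by rewrite lerD // le_tree_cost.
  - by lra.
have [sg2 h2 r2] := hP [::].
by exists sg2 => //; apply: reach_trans r1 r2.
Qed.

Lemma setup_spec tm sg :
  (forall i, [/\ [/\ mem (sg i) 0%N = WNum p, mem (sg i) 1%N = WNum (val i), mem (sg i) 2%N = WNum klo,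
     mem (sg i) 3%N = WNum khi & mem (sg i) 4%N = WNum d],
     mem (sg i) 7%N = WNum 0 /\ mem (sg i) 8%N = WNum 0,
     que (sg i) = q i /\ rep (sg i) = [::], clk (sg i) <= tm & prt (sg i) <= tm]) ->
  PW setup (fun sg' => forall i,
    ready 0 (fun=> 0%N) (tm + 12 + 4 * (trunc_log 2 p).+1%:R) i (sg' i)) sg.
Proof.
move=> hr; apply: PW_local => i.
have [[m0 m1 m2 m3 m4] [m7 m8] [eq er] hc hp] := hr i.
have ip := ltn_ord i.
have tlp : (trunc_log 2 p < p)%N.
  have /andP[h1 _] := @trunc_log_bounds 2 p isT p_gt0.
  exact: leq_trans (ltn_expl _ (isT : (1 < 2)%N)) h1.
rewrite -/h.
apply: W_seq; apply: W_assign; [exact: ev_const | exact: ev_const |].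
apply: W_seq; apply: (W_assign alpha beta i (x := 21%N) (v := WNum p));
  [exact: ev_const | by rewrite ev_var | ].
apply: W_seq; set s3 := tick 1 _.
have s3E : s3 = setm (upd (upd (mem (sg i)) 5%N (WNum 1)) 21%N (WNum p)) (tick 5 (mute (sg i))).
  rewrite /s3 (_ : tick 1 (mute (sg i)) = setm (mem (sg i)) (tick 1 (mute (sg i)))) //.
  by rewrite store_setm tick_setm store_setm tick_setm; congr (setm _ (tick _ _)); ring.
rewrite s3E; set post := (X in W _ _ X _).
have hpost (m : nat -> word T) (t : R) : t <= 6 + 4 * (trunc_log 2 p)%:R -> m 5%N = WNum h ->
    (forall a, (a < 16)%N -> a != 5%N -> m a = mem (sg i) a) -> post (setm m (tick t (mute (sg i)))).
  move=> ht m5 hm; rewrite /post.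
  have S_lt : (d %/ h + 1 < 2 ^ w)%N by have := leq_div d h; move: hw; nlia.
  apply: W_seq; apply: W_assign; first exact: ev_const.
    apply: (ev_add (x := (d %/ h)%N) (y := 1%N)); [|exact: ev_const|exact: S_lt].
    by apply: ev_div; rewrite ev_var //= hm.
  apply: W_seq; apply: W_assign; first exact: ev_const.
    apply: (ev_add (x := 64%N) (y := (d + p)%N)); [exact: ev_const| |by move: hw; nlia].
    by apply: ev_add; rewrite ?ev_var //= ?/upd /= ?hm //; move: hw; nlia.
  apply: W_assign; first exact: ev_const.
    apply: (ev_add (x := (64 + (d + p))%N) (y := (d + p)%N)); [by rewrite ev_var| |by move: hw; nlia].
    by apply: ev_add; rewrite ?ev_var //= ?/upd /= ?hm //; move: hw; nlia.
  split=> //; split=> //=.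
  - by split; split; rewrite /upd /= ?m5 // hm.
  - by rewrite /upd /= !hm.
  - by rewrite -[h%:R]natr1; lra.
  - by have : 0 <= h%:R :> R by []; lra.
have loop (n x y : nat) (m : nat -> word T) (t : R) : (0 < x)%N -> trunc_log 2 x = n -> (y + n = h)%N ->
    t + 4 * n%:R <= 5 + 4 * (trunc_log 2 p)%:R -> m 5%N = WNum y -> m 21%N = WNum x ->
    (x <= p)%N ->
    (forall a, (a < 16)%N -> a != 5%N -> m a = mem (sg i) a) ->
    W i (While (Const 1 :< V 21)
         (Seq (Assign (Const 21) (Bin OpDiv (V 21) (Const 2)))
              (Assign (Const 5) (V 5 :+ Const 1)))) post (setm m (tick t (mute (sg i)))).
  elim: n x y m t => [|n IH] x y m t x0 xn yn ht m5 m21 xp hm; apply: W_while;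
    rewrite (ev_lt (x := 1%N) (y := x)) ?ev_const ?ev_var //=.
    have -> : (1 < x)%N = false.
      by apply/negbTE; rewrite -leqNgt; case: ltnP => // x1; move: xn; rewrite trunc_log2S.
    rewrite tick_setm; apply: hpost => //; first by lra.
    by rewrite m5; congr WNum; nlia.
  case: (ltnP 1 x) => x1 /=; last first.
    by have ex : x = 1%N by [nlia]; move: xn; rewrite ex.
  apply: W_seq; apply: W_assign; first exact: ev_const.
    by apply: (ev_div (x := x) (y := 2%N)); rewrite ?ev_var ?ev_const.
  apply: W_assign; first exact: ev_const.
    by apply: (ev_add (x := y) (y := 1%N)); rewrite ?ev_var ?ev_const //; move: hw; nlia.
  set s4 := store _ _ _.
  have -> : s4 = setm (upd (upd m 21%N (WNum (x %/ 2))) 5%N (WNum (y + 1))) (tick (t + 4) (mute (sg i))).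
    by rewrite /s4 !tick_setm !store_setm /=; congr (setm _ (tick _ _)); ring.
  apply: (IH (x %/ 2)%N (y + 1)%N) => //.
  - by rewrite divn_gt0.
  - by move: xn; rewrite divn2 trunc_log2S // => -[].
  - by nlia.
  - by move: ht; rewrite -natr1; lra.
  - by apply: leq_trans (leq_div _ _) xp.
  - by move=> a a16 a5; rewrite /upd (negbTE a5); case: eqP => [|_]; [nlia | rewrite hm].
refine (loop (trunc_log 2 p) p 1%N _ 5 p_gt0 erefl _ _ _ _ _ _).
all: rewrite ?/upd /= ?add1n //.
by move=> a a16 a5; rewrite (negbTE a5); case: eqP => [|_]; [nlia|].
Qed.

Hypotheses (alpha_ge0 : 0 <= alpha) (beta_ge0 : 0 <= beta) (d_gt0 : (0 < d)%N).
Local Notation start sg := (glob [:: loop; Remove (V 8)] sg).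

Definition invariant L l : Prop := [/\ cut q l, L = (\sum_i l i)%N,
  forall i, (l i <= size (q i))%N & (L <= khi)%N].

Lemma invariant_next us L l : invariant L l ->
  invariant (next_rank us L l) (next_local us L l).
Proof.
move=> [hc hL hl Lk]; rewrite /next_rank /next_local.
have [h1 h2 h3] := best_spec khi (rank_of us l) L d.
case: (best khi _ L d).2 => [j [_ rj]|e]; last first.
  by split=> //; [rewrite e | apply: h2].
split; [exact: cut_count_of | by rewrite -rj | | exact: h2].
by move=> i; rewrite /count_of; case: (threshold _ _ _) => // y; apply: count_size.
Qed.

Lemma invariant_le L l i : invariant L l -> (l i <= L)%N.
Proof. by move=> [_ -> _ _]; rewrite (bigD1 i) //= leq_addr. Qed.

(** A drift argument: [pot] is nonnegative and falls by at least 1 per round in expectation, so it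
    bounds the expected number of remaining rounds. The fixed and the flexible variants differ only
    in the choice of [pot]. *)
Variable pot : nat -> R.
Hypothesis pot_ge0 : forall L, 0 <= pot L.
Hypothesis pot_step : forall L l, (L < klo)%N -> invariant L l ->
  avg_all (D L) d p (fun us => pot (next_rank us L l)) <= pot L - 1.

Lemma D_gt0 L : (L < klo)%N -> (0 < D L)%N.
Proof. by move=> Lk; move: klo_khi; lia. Qed.

Lemma pot_ge1 L l : (L < klo)%N -> invariant L l -> 1 <= pot L.
Proof.
move=> Lk hi; rewrite -subr_ge0; apply: le_trans (pot_step Lk hi).
by apply: avg_all_ge0 => us; apply: pot_ge0.
Qed.

(** The last loop test and the final [Remove] fit into one extra round; this is the 1 in [1 + pot L]
    below. *)
Lemma round_time_ge : 1 + tree_cost R (3 * khi) <= round_time.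
Proof.
have t1 := tc_ge1; have d1 : 1 <= d%:R :> R by rewrite ler1n.
have dd : 0 <= 10 * h%:R * delta by rewrite mulr_ge0 ?mulr_ge0 // delta_ge0.
have dt : 8 + tc <= d%:R * (8 + tc) by rewrite ler_peMl //; lra.
by rewrite /round_time /round_tail_time -/tc -[3 * _ * _]mulrA; lra.
Qed.

Lemma finish L l (tm : R) sg : (klo <= L)%N -> invariant L l -> 0 <= tm ->
  (forall i, ready L l tm i (sg i)) ->
  exists c, [/\ reach (start sg) c, halted c, delivered q klo khi c &
    elapsed c <= tm + 1 + tree_cost R (3 * khi)].
Proof.
move=> Lk hi tm0 hr; have [hc hL hl Lkhi] := hi.
have lL i : (l i <= 3 * khi)%N by have := invariant_le i hi; lia.
have [sg' h1 r1] := finish_spec Lk lL hr.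
have t1 := tree_cost_ge1 R (3 * khi).
exists (glob [::] sg'); split=> //.
- by apply/andP; split; apply/forallP => i //; apply/forallP.
- apply/existsP; exists (Ordinal (Lkhi : (L < khi.+1)%N)); rewrite Lk /=.
  apply/forallP => i; have [e1 e2 _ _] := h1 i; have [f1 f2] := filter_smallest i hc hl.
  by rewrite e1 e2 /= hL f1 f2 !eqxx.
- by apply: elapsed_le => [|i|i]; [lra| |]; have [_ _ h3 h4] := h1 i; rewrite -?addrA in h3 h4 *.
Qed.

(** Induction on the budget [m] rather than on the number of rounds, which is unbounded. With budget
    0 the schedule is empty and only the time [tm] elapsed so far counts. *)
Lemma time_bound m L l (tm : R) sg : invariant L l -> 0 <= tm ->
  (forall i, ready L l tm i (sg i)) ->
  expected_le w alpha beta (@elapsed R disp T p) (fun=> m) (start sg) (tm + round_time * (1 + pot L)).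
Proof.
have Xok := expected_le_compatible (elapsed_increasing w alpha_ge0 beta_ge0 (T := T) (p := p)).
have t1 := tree_cost_ge1 R (3 * khi).
have De0 : 0 <= round_time by have := round_time_ge; lra.
elim: m L l tm sg => [|m IH] L l tm sg hi tm0 hr.
  move=> s hs; have -> : s = [::].
    by case: s hs => // i s /(_ i); rewrite /= eqxx.
  have DV : 0 <= round_time * (1 + pot L) by rewrite mulr_ge0 // addr_ge0.
  apply: elapsed_le => [|i|i]; first by lra.
    by have [_ _ _ hc _] := hr i; rewrite /=; lra.
  by have [_ _ _ _ hc] := hr i; rewrite /=; lra.
case: (ltnP L klo) => hL; last first.
  have [c [r hh _ he]] := finish hL hi tm0 hr.
  have main := compatible_reach Xok r (@expected_le_halted _ _ _ w alpha beta _ _ (fun=> m.+1) _ hh).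
  apply: (compatible_le Xok _ _ main) => //.
  apply: le_trans he _; have := round_time_ge; have : 0 <= round_time * pot L by rewrite mulr_ge0.
  by rewrite mulrDr mulr1; lra.
pose b us := tm + round_time + round_time * (1 + pot (next_rank us L l)).
have main : expected_le w alpha beta (@elapsed R disp T p) (fun=> m.+1) (start sg)
    (avg_all (D L) d p b).
  apply: (round_spec Xok (F := fun=> m) hL _ hr).
    by move=> i; apply: invariant_le hi.
  move=> us sg' su au hr'; apply: IH hr'; first exact: invariant_next.
  by rewrite addr_ge0.
apply: (compatible_le Xok _ _ main) => //.
have -> : avg_all (D L) d p b = (tm + round_time + round_time) +
    round_time * avg_all (D L) d p (fun us => pot (next_rank us L l)).
  rewrite -avg_all_affine; last exact: D_gt0.
  by congr avg_all; apply/funext => us; rewrite /b mulrDr mulr1 addrA.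
have := pot_step hL hi; move: (avg_all _ _ _ _) => y hy.
have : round_time * y <= round_time * (pot L - 1) by rewrite ler_wpM2l.
by rewrite mulrBr mulrDr mulr1; lra.
Qed.

Local Notation success := (fun c : config => (halted c && delivered q klo khi c)%:R : R).

(** Markov's inequality for the number of rounds, proved along the run: the probability of not
    having halted after [n] rounds is at most [pot L / (n + 1)]. *)
Lemma halting_bound n F L l (tm : R) sg : invariant L l -> 0 <= tm ->
  (forall i, ready L l tm i (sg i)) ->
  eventually w alpha beta success F (start sg) (pot L / n.+1%:R).
Proof.
have si : increasing w alpha beta success by apply: halted_increasing.
have Xok := eventually_compatible si.
have t1 := tree_cost_ge1 R (3 * khi).
have De0 : 0 <= round_time by have := round_time_ge; lra.
have trivial c b : 1 <= b -> eventually w alpha beta success F c b.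
  by move=> b1; exists 0%N; rewrite /= (le_trans _ (ler0n _ _)) // subr_le0.
elim: n F L l tm sg trivial => [|n IH] F L l tm sg trivial hi tm0 hr;
  (case: (ltnP L klo) => hL; last first).
- have [c [r hh hd _]] := finish hL hi tm0 hr.
  apply: (compatible_reach Xok r); exists 0%N; rewrite /= hh hd.
  by rewrite lerBlDr lerDl divr_ge0.
- by apply: trivial; rewrite divr1; apply: pot_ge1 hi.
- have [c [r hh hd _]] := finish hL hi tm0 hr.
  apply: (compatible_reach Xok r); exists 0%N; rewrite /= hh hd.
  by rewrite lerBlDr lerDl divr_ge0.
case: (lerP n.+2%:R (pot L)) => hV.
  by apply: trivial; rewrite ler_pdivlMr ?ltr0n // mul1r.
pose b us := pot (next_rank us L l) / n.+1%:R.
have main : eventually w alpha beta success (fun i => (F i).+1) (start sg) (avg_all (D L) d p b).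
  apply: (round_spec Xok (F := F) hL _ hr).
    by move=> i; apply: invariant_le hi.
  move=> us sg' su au hr'; apply: IH hr' => //; first exact: invariant_next.
  by rewrite addr_ge0.
apply: (compatible_le Xok _ _ main) => [i|]; first exact: leqnSn.
have -> : b = (fun us => 0 + (n.+1%:R)^-1 * pot (next_rank us L l)).
  by apply/funext => us; rewrite add0r mulrC.
rewrite avg_all_affine; last exact: D_gt0.
rewrite add0r; have := pot_step hL hi; move: (avg_all _ _ _ _) => y hy.
rewrite mulrC ler_pdivrMr ?ltr0n // mulrAC ler_pdivlMr ?ltr0n //.
have n0 : 0 <= n%:R :> R by [].
(* The remaining inequality [(pot L - 1) * (n + 2) <= pot L * (n + 1)] amounts to [pot L <= n + 2],
   and otherwise the claimed bound is at least 1. *)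
apply: (le_trans (y := (pot L - 1) * n.+2%:R)); first by rewrite ler_wpM2r.
by move: hV; rewrite -!natr1; lra.
Qed.

Lemma delete_min_reach (X : ('I_p -> nat) -> config -> R -> Prop) F (t0 : R) sg b :
  compatible w alpha beta X -> 0 <= t0 ->
  (forall i, [/\ [/\ mem (sg i) 0%N = WNum p, mem (sg i) 1%N = WNum (val i), mem (sg i) 2%N = WNum klo,
     mem (sg i) 3%N = WNum khi & mem (sg i) 4%N = WNum d],
     mem (sg i) 7%N = WNum 0 /\ mem (sg i) 8%N = WNum 0,
     que (sg i) = q i /\ rep (sg i) = [::], clk (sg i) <= t0 & prt (sg i) <= t0]) ->
  (forall sg', (forall i, ready 0 (fun=> 0%N) (t0 + 14 + 4 * (trunc_log 2 p).+1%:R) i (sg' i)) ->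
     X F (start sg') b) ->
  X F (glob [:: delete_min] sg) b.
Proof.
move=> Xok t00 hr hX.
apply: (compatible_reach Xok (reach_seq _ _ _ _ _ _ _)).
have [i|sg1 h1 r1] := setup_spec (tm := t0 + 1) (sg := fun i => tick 1 (sg i)) _ [:: Seq loop (Remove (At (Const 8)))].
  have [m1 m2 m3 m4 m5] := hr i; split=> //=; lra.
apply: (compatible_reach Xok r1).
apply: (compatible_reach Xok (reach_seq _ _ _ _ _ _ _)); apply: hX => i.
by have [fx mm qr hc hp] := h1 i; split=> //=; lra.
Qed.
End Round.

(** * Success probability of a trial *)

Section Columns.
Variables (R : realFieldType) (D : nat).
Hypothesis D_gt0 : (0 < D)%N.

Lemma eq_avg_tape n (f g : seq nat -> R) : (forall u, is_tape D n u -> f u = g u) ->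
  avg_tape D n f = avg_tape D n g.
Proof. by move=> e; apply/eqP; rewrite eq_le !ler_avg_tape // => u /e ->. Qed.

Lemma eq_avg_all d n (f g : seq (seq nat) -> R) :
  (forall us, size us = n -> all (is_tape D d) us -> f us = g us) ->
  avg_all D d n f = avg_all D d n g.
Proof. by move=> e; apply/eqP; rewrite eq_le !ler_avg_all // => us s /(e us s) ->. Qed.

Lemma average_tapeC n (f : nat -> seq nat -> R) :
  average D (fun r => avg_tape D n (f r)) = avg_tape D n (fun u => average D (f^~ u)).
Proof.
elim: n f => [|n IH] f //=; rewrite averageC; apply: eq_average => r _.
by rewrite IH.
Qed.

Lemma avg_tapeC n m (f : seq nat -> seq nat -> R) :
  avg_tape D n (fun u => avg_tape D m (f u)) = avg_tape D m (fun v => avg_tape D n (f^~ v)).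
Proof.
elim: n f => [|n IH] f //=; rewrite -average_tapeC.
by apply: eq_average => r _; rewrite IH.
Qed.

Definition add_column (col : seq nat) (us : seq (seq nat)) : seq (seq nat) :=
  [seq x.1 :: x.2 | x <- zip col us].

Definition column (us : seq (seq nat)) j : seq nat := [seq nth 0%N u j | u <- us].

(** Fubini: the program draws PE by PE, but the independent units of the analysis are the trials,
    each a column with one number per PE. *)
Lemma avg_all_column d n (b : seq (seq nat) -> R) :
  avg_all D d.+1 n b = avg_tape D n (fun col => avg_all D d n (fun us => b (add_column col us))).
Proof.
elim: n b => [|n IH] b //=; apply: eq_average => r _.
rewrite avg_tapeC; congr avg_tape; apply/funext => u.
by rewrite IH.
Qed.

Lemma column_add0 col us : size col = size us -> column (add_column col us) 0 = col.
Proof.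
by elim: col us => [|c col IH] [|u us] //= [e]; rewrite /column /= -[X in _ :: X]/(column (add_column col us) 0) IH.
Qed.

Lemma column_addS col us j : size col = size us -> column (add_column col us) j.+1 = column us j.
Proof.
elim: col us => [|c col IH] [|u us] //= [e].
by rewrite /column /= -[X in _ :: X]/(column (add_column col us) j.+1) IH.
Qed.

(* The trials are independent. *)
Lemma avg_all_prod d n (g : seq nat -> R) :
  avg_all D d n (fun us => \prod_(j < d) g (column us j)) = avg_tape D n g ^+ d.
Proof.
elim: d => [|d IH].
  rewrite expr0 (_ : (fun us => _) = fun us => 1 + 0 * (fun _ => 0) us).
    by rewrite avg_all_affine // mul0r addr0.
  by apply/funext => us; rewrite big_ord0 mul0r addr0.
rewrite avg_all_column exprSr -IH.
transitivity (avg_tape D n (fun col => 0 + avg_all D d n (fun us => \prod_(j < d) g (column us j)) * g col)).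
  apply: eq_avg_tape => col /andP[/eqP sc _]; rewrite add0r mulrC.
  rewrite -[RHS]add0r -avg_all_affine //; apply: eq_avg_all => us su _.
  rewrite add0r big_ord_recl column_add0 ?sc ?su //; congr (_ * _).
  by apply: eq_bigr => j _; rewrite lift0 column_addS ?sc ?su.
by rewrite avg_tape_affine // add0r.
Qed.

Lemma avg_tape_prod n (g : 'I_n -> nat -> R) :
  avg_tape D n (fun col => \prod_(i < n) g i (nth 0%N col i)) = \prod_(i < n) average D (g i).
Proof.
elim: n g => [|n IH] g /=; first by rewrite !big_ord0.
rewrite big_ord_recl -(IH (fun i => g (lift ord0 i))).
rewrite -[RHS]add0r [_ * avg_tape _ _ _]mulrC -average_affine //.
apply: eq_average => r _; rewrite add0r mulrC -[RHS]add0r -avg_tape_affine //.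
by congr avg_tape; apply/funext => u; rewrite add0r big_ord_recl.
Qed.

(** By independence, an event containing a box has at least the product of the probabilities of its
    sides. *)
Lemma avg_tape_box n (g : 'I_n -> pred nat) (b : pred (seq nat)) :
  (forall u, is_tape D n u -> (forall i, g i (nth 0%N u i)) -> b u) ->
  \prod_(i < n) average D (fun r => (g i r)%:R) <= avg_tape D n (fun u => (b u)%:R) :> R.
Proof.
move=> hb; rewrite -(avg_tape_prod (fun i r => (g i r)%:R)); apply: ler_avg_tape => u hu.
case: (boolP [forall i, g i (nth 0%N u i)]) => [/forallP h|].
  by rewrite hb // big1 // => i _; rewrite h.
rewrite negb_forall => /existsP[i /negbTE hi].
by rewrite (bigD1 i) //= hi mul0r ler0n.
Qed.

Lemma average_ge (t : nat) : 1 - t%:R / D%:R <= (average D (fun r => (t <= r)%N%:R) : R) <= 1.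
Proof.
have D0 : 0 < D%:R :> R by rewrite ltr0n.
rewrite /average -natr_sum ler_pdivrMr // mul1r ler_nat ler_pdivlMr // mulrBl mul1r.
rewrite divfK ?gt_eqF // lerBlDr -natrD ler_nat.
have -> : (\sum_(r < D) (t <= r)%N = D - t)%N.
  elim: (D) => [|n IH]; first by rewrite big_ord0.
  by rewrite big_ord_recr /= IH; case: (leqP t n) => h; lia.
by lia.
Qed.

Lemma average_eq (t : nat) : (t < D)%N -> average D (fun r => (r == t)%:R) = D%:R^-1 :> R.
Proof.
move=> tD; rewrite /average (bigD1 (Ordinal tD)) //= eqxx big1 ?addr0 ?mul1r // => i.
by rewrite -val_eqE /= => /negbTE ->.
Qed.

(** The union bound in product form (Weierstrass). The induction carries along that the partial
    products lie between 0 and 1. *)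
Lemma prod_ge (I : finType) (P : pred I) (f : I -> R) : (forall i, P i -> 0 <= f i <= 1) ->
  1 - \sum_(i | P i) (1 - f i) <= \prod_(i | P i) f i.
Proof.
move=> hf; suff : (0 <= \prod_(i | P i) f i <= 1) /\ 
  1 - \sum_(i | P i) (1 - f i) <= \prod_(i | P i) f i by case.
elim/big_rec2: _ => [|i y x /hf /andP[f0 f1] [/andP[y0 y1] le]].
  by rewrite subr0 ler01 lexx.
split; first by apply/andP; split; [exact: mulr_ge0 | exact: mulr_ile1].
have : 0 <= (1 - f i) * (1 - x) by rewrite mulr_ge0 // subr_ge0.
by rewrite mulrBl mulrBr; lra.
Qed.

Lemma prod_above n (P : pred 'I_n) (t : 'I_n -> nat) : (\sum_i t i + \sum_i t i <= D)%N ->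
  2^-1 <= \prod_(i | P i) average D (fun r => (t i <= r)%N%:R) :> R.
Proof.
move=> ht; have D0 : 0 < D%:R :> R by rewrite ltr0n.
have h : \sum_(i | P i) (1 - average D (fun r => (t i <= r)%N%:R)) <= 2^-1 :> R.
  apply: (le_trans (y := \sum_(i < n) (t i)%:R / D%:R)).
    rewrite [leLHS]big_mkcond; apply: ler_sum => i _; have /andP[h _] := average_ge (t i).
    by case: ifP => _; [lra | exact: divr_ge0].
  rewrite -mulr_suml -natr_sum ler_pdivrMr //.
  have : (\sum_(i < n) t i + \sum_(i < n) t i)%:R <= D%:R :> R by rewrite ler_nat.
  by rewrite natrD; lra.
apply: le_trans (prod_ge _).
  by move: (\sum_(_ | _) _) h => x h; lra.
move=> i _; have /andP[_ ->] := average_ge (t i).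
by rewrite andbT /average mulr_ge0 ?invr_ge0 ?ler0n // sumr_ge0.
Qed.

Lemma avg_tape_above n (t : 'I_n -> nat) (b : pred (seq nat)) :
  (\sum_i t i + \sum_i t i <= D)%N ->
  (forall u, is_tape D n u -> (forall i, t i <= nth 0%N u i)%N -> b u) ->
  2^-1 <= avg_tape D n (fun u => (b u)%:R : R).
Proof.
move=> ht hb; apply: le_trans (prod_above xpredT ht) _.
exact: (avg_tape_box (g := fun i r => t i <= r)%N _ hb).
Qed.

(** The factor of [i0] contributes 1 / D for the exact draw, all other factors together at least 1/2
    by [prod_above]. *)
Lemma avg_tape_hit n (t : 'I_n -> nat) (i0 : 'I_n) (b : pred (seq nat)) :
  (\sum_i t i + \sum_i t i <= D)%N ->
  (forall u, is_tape D n u -> nth 0%N u i0 = t i0 -> (forall i, t i <= nth 0%N u i)%N -> b u) ->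
  (2 * D%:R)^-1 <= avg_tape D n (fun u => (b u)%:R : R).
Proof.
move=> ht hb; apply: le_trans (avg_tape_box (g := fun i r => if i == i0 then r == t i else t i <= r)%N _ _).
  rewrite (bigD1 i0) //= invfM mulrC; apply: ler_pM; rewrite ?invr_ge0 ?ler0n //.
    rewrite eqxx average_eq //.
    by have : (t i0 <= \sum_i t i)%N; [rewrite (bigD1 i0) //= leq_addr | lia].
  apply: le_trans (prod_above (predC1 i0) ht) _; rewrite le_eqVlt; apply/orP; left; apply/eqP.
  by apply: eq_bigr => i /negbTE ->.
move=> u hu h; apply: hb => //; first by have := h i0; rewrite eqxx => /eqP.
by move=> i; have := h i; case: eqP => [-> /eqP ->|].
Qed.

Lemma avg_tape_add n (f g : seq nat -> R) :
  avg_tape D n (fun u => f u + g u) = avg_tape D n f + avg_tape D n g.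
Proof.
elim: n f g => [|n IH] f g //=; rewrite /average -mulrDl -big_split /=.
by congr (_ / _); apply: eq_bigr => r _; rewrite IH.
Qed.

(* Disjoint events [r u = m], each of probability at least [c]. *)
Lemma avg_tape_interval n (r : seq nat -> nat) (c : R) a k :
  (forall m, (a <= m < a + k)%N -> c <= avg_tape D n (fun u => (r u == m)%:R)) ->
  k%:R * c <= avg_tape D n (fun u => (a <= r u < a + k)%N%:R).
Proof.
elim: k => [|k IH] h.
  by rewrite mul0r; apply: avg_tape_ge0.
have -> : (fun u => (a <= r u < a + k.+1)%N%:R) =
    (fun u => (a <= r u < a + k)%N%:R + (r u == a + k)%N%:R : R).
  apply/funext => u; rewrite -natrD; congr (_%:R).
  by case: eqP => [->|]; case: leqP => ? ; case: ltnP => ?; case: ltnP => ? //=; lia.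
rewrite avg_tape_add -natr1 mulrDl mul1r lerD //.
  by apply: IH => m hm; apply: h; lia.
by apply: h; lia.
Qed.
End Columns.

(** A rational substitute for the estimate of [(1 - s) ^+ n] by exp(- n s): failure of all [n]
    trials has probability at most 1 / (1 + n s0). *)
Lemma expr_one_sub_le (R : realFieldType) (s s0 : R) n : 0 <= s0 -> s0 <= s <= 1 ->
  (1 - s) ^+ n * (1 + n%:R * s0) <= 1.
Proof.
move=> s00 /andP[s0s s1]; elim: n => [|n IH]; first by rewrite expr0 mul0r addr0 mulr1.
apply: le_trans IH; rewrite exprSr -mulrA ler_wpM2l ?exprn_ge0 ?subr_ge0 //.
have n0 : 0 <= n%:R * s0 by rewrite mulr_ge0.
apply: (le_trans (y := (1 - s0) * (1 + n.+1%:R * s0))).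
  by rewrite ler_wpM2r ?addr_ge0 ?mulr_ge0 //; lra.
have : 0 <= s0 * (n%:R * s0 + s0) by rewrite mulr_ge0 // addr_ge0.
by rewrite -natr1 !mulrDl !mulrDr; lra.
Qed.

Section Ranks.
Variables (R : realFieldType) (disp : Order.disp_t) (T : orderType disp) (w p : nat).
Implicit Types (i : 'I_p) (l : 'I_p -> nat) (us : seq (seq nat)).
Variables (klo khi d : nat) (q : 'I_p -> seq T).
Hypothesis hw : (256 + 4 * (d + p + khi) + \sum_i size (q i) < 2 ^ w)%N.
Hypothesis p_gt0 : (0 < p)%N.
Hypothesis q_sorted : forall i, sorted <%O (q i).
Hypothesis q_uniq : uniq (content q).

(** The rank found by a trial depends only on its own column, here presented as tapes of length one,
    so the product formula for independent trials applies. *)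
Definition rank_col l (col : seq nat) : nat := rank_of w q [seq [:: r] | r <- col] l 0.

Lemma rank_of_column us l j : size us = p -> rank_of w q us l j = rank_col l (column us j).
Proof.
move=> su; rewrite /rank_col /rank_of; apply: eq_bigr => i _; congr count_of.
apply: reduction_ext => // k kp; rewrite /candidate; case: insubP => // i' _ _.
congr nth_word; congr addn; rewrite /drawn_number.
by rewrite (nth_map 0%N) ?size_map ?su ?ltn_ord //= (nth_map [::]) ?su ?ltn_ord.
Qed.

Lemma count_lt_mono (s : seq T) y z : y \in s -> (y < z)%O ->
  (count (fun x => (x < y)%O) s < count (fun x => (x < z)%O) s)%N.
Proof.
move=> ys yz; have := count_predUI (fun x => (x < y)%O) (pred1 y) s.
have -> : count (predI (fun x => (x < y)%O) (pred1 y)) s = 0%N.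
  apply/eqP; rewrite -leqn0 leqNgt -has_count; apply/hasPn => x _ /=.
  by case: eqP => [->|]; rewrite ?ltxx ?andbF.
rewrite addn0 => h; apply: (@leq_trans (count (predU (fun x => (x < y)%O) (pred1 y)) s)).
  by rewrite h -addn1 leq_add2l -has_count has_pred1.
by apply: sub_count => x /= /orP[/lt_trans -> //|/eqP ->].
Qed.

Lemma nth_word_count (s : seq T) x : sorted <%O s -> x \in s ->
  nth_word s (count (fun z => (z < x)%O) s) = WObj x.
Proof.
move=> ss xs; have ks : (index x s < size s)%N by rewrite index_mem.
have e : nth_word s (index x s) = WObj x.
  by rewrite /nth_word (drop_nth x ks) nth_index.
case: (nth_wordP (index x s) ss) => [[_ ]|[y [ey _ _ cy]]]; first by rewrite leqNgt ks.
by move: cy; move: ey; rewrite e => -[<-] ->.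
Qed.

Lemma count_content (a : pred T) : (\sum_i count a (q i))%N = count a (content q).
Proof.
by rewrite /content count_flatten sumnE -map_comp big_map big_enum.
Qed.

Lemma size_content : (\sum_i size (q i))%N = size (content q).
Proof. by rewrite /content size_flatten /shape sumnE -map_comp big_map big_enum. Qed.

Lemma exists_rank m : (m < size (content q))%N ->
  exists x, [/\ x \in content q & (\sum_i count (fun z => (z < x)%O) (q i))%N = m].
Proof.
move=> mM; have sm : (m < size (sort <=%O (content q)))%N by rewrite size_sort.
case E : (content q) => [|x0 s0]; first by rewrite E in mM.
have ss : sorted <%O (sort <=%O (content q)) by rewrite sort_lt_sorted.
case: (nth_wordP m ss) => [[_]|[y [_ _ ys cy]]]; first by rewrite leqNgt sm.
exists y; split; first by rewrite -E -(mem_sort <=%O).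
by rewrite count_content -cy; apply/permP; rewrite perm_sym perm_sort.
Qed.

(** If [x] lies behind the cut, all selected objects are smaller. If [x] is itself selected, nothing
    behind the cut is smaller, so no count exceeds its [l j], and the comparison of the sums forces
    equality everywhere. *)
Lemma cut_le_count l x i : cut q l -> (forall i, l i <= size (q i))%N -> x \in content q ->
  (\sum_i l i <= \sum_i count (fun z => (z < x)%O) (q i))%N ->
  (l i <= count (fun z => (z < x)%O) (q i))%N.
Proof.
move=> hc hl /flatten_mapP[i0 _ xi0] hs.
move: xi0; rewrite -{1}(cat_take_drop (l i0) (q i0)) mem_cat => /orP[xt|xd].
  have le j : (count (fun z => (z < x)%O) (q j) <= l j)%N.
    rewrite -[in leqLHS](cat_take_drop (l j) (q j)) count_cat.
    have -> : count (fun z => (z < x)%O) (drop (l j) (q j)) = 0%N.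
      apply/eqP; rewrite -leqn0 leqNgt -has_count; apply/hasPn => z zd.
      by rewrite -leNgt ltW // (hc i0 j).
    by rewrite addn0 (leq_trans (count_size _ _)) // size_takel.
  rewrite leqNgt; apply/negP => lt.
  have : (\sum_i count (fun z => (z < x)%O) (q i) < \sum_i l i)%N.
    rewrite (bigD1 i) //= [ltnRHS](bigD1 i) //= -addSn leq_add //.
    by apply: leq_sum => j _.
  by rewrite ltnNge hs.
rewrite -[in leqRHS](cat_take_drop (l i) (q i)) count_cat.
have /all_filterP/(congr1 size) : all (fun z => (z < x)%O) (take (l i) (q i)).
  by apply/allP => z zt; apply: hc zt xd.
by rewrite size_filter size_takel // => ->; apply: leq_addr.
Qed.

Local Notation D L := ((khi - L) + (khi - L))%N.

Section Trial.
Variables (L : nat) (l : 'I_p -> nat).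
Hypotheses (L_lt : (L < khi)%N) (hc : cut q l) (hL : L = (\sum_i l i)%N)
  (hl : forall i, (l i <= size (q i))%N).

Let candidate_col (col : seq nat) i :
  candidate q [seq [:: r] | r <- col] l i 0 = nth_word (q i) (l i + nth 0%N col i).
Proof.
rewrite candidateE /drawn_number; congr nth_word; congr addn.
case: (ltnP i (size col)) => h; first by rewrite (nth_map 0%N).
by rewrite !nth_default ?size_map.
Qed.

(** The offsets [c i - l i] of the object of rank [m] sum to [m - L], which is at most half of
    [D L]. This is why the draws range up to twice [khi - L]. *)
Lemma rank_col_hit m : (L <= m <= khi)%N -> (m < size (content q))%N ->
  (2 * (D L)%:R)^-1 <= avg_tape (D L) p (fun col => (rank_col l col == m)%:R : R).
Proof.
move=> /andP[Lm mk] mM; have [x [xc xm]] := exists_rank mM.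
pose c i := count (fun z => (z < x)%O) (q i).
have lc i : (l i <= c i)%N by apply: cut_le_count => //; rewrite xm -hL.
have [i0 _ xi0] := flatten_mapP xc.
have sumt : (\sum_i (c i - l i) = m - L)%N.
  rewrite hL -xm; apply/eqP; rewrite -(eqn_add2r (\sum_i l i)%N) subnK; last by apply: leq_sum => i _.
  by rewrite -big_split /=; apply/eqP; apply: eq_bigr => i _; rewrite subnK.
apply: (@avg_tape_hit R (D L) _ p (fun i => (c i - l i)%N) i0); first by lia.
  by rewrite sumt; lia.
move=> u _ u0 ut; rewrite /rank_col /rank_of.
set v := threshold _ _ _ _ _; suff -> : v = WObj x by rewrite -xm.
have ip i : val i \in iota 0 p by rewrite mem_iota add0n /= ltn_ord.
have e0 : candidate q [seq [:: r] | r <- u] l i0 0 = WObj x.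
  by rewrite candidate_col u0 subnKC // nth_word_count.
have := threshold_min p_gt0 hw [seq [:: r] | r <- u] l 0; rewrite -/v.
case=> [[_ /(_ _ (ip i0))]|[y [-> [n ni ny] hy]]]; first by rewrite e0.
congr WObj; apply/eqP; rewrite eq_le (hy _ (ip i0) _ e0) /=.
have np : (n < p)%N by move: ni; rewrite mem_iota.
have := candidate_col u (Ordinal np); rewrite /= ny => /esym ec.
case: (nth_wordP (l (Ordinal np) + nth 0%N u n) (q_sorted (Ordinal np))) => [[]|[z []]].
  by rewrite ec.
rewrite ec => -[<-] _ yq cy; rewrite leNgt; apply/negP => yx.
have := count_lt_mono yq yx; rewrite cy; have := ut (Ordinal np).
by rewrite /= -/(c (Ordinal np)); lia.
Qed.

(** If every PE draws at least the number of its unselected objects, nobody proposes anything, the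
    threshold is plus infinity and the whole queue is selected. These numbers sum to at most half of
    [D L]. *)
Lemma rank_col_all : (size (content q) <= khi)%N ->
  2^-1 <= avg_tape (D L) p (fun col => (rank_col l col == size (content q))%:R : R).
Proof.
move=> Mk.
have sumt : (\sum_i (size (q i) - l i) = size (content q) - L)%N.
  rewrite hL -size_content; apply/eqP; rewrite -(eqn_add2r (\sum_i l i)%N) subnK; last by apply: leq_sum => i _.
  by rewrite -big_split /=; apply/eqP; apply: eq_bigr => i _; rewrite subnK.
apply: (@avg_tape_above R (D L) _ p (fun i => (size (q i) - l i)%N)); first by lia.
  by rewrite sumt; lia.
move=> u _ ut; rewrite /rank_col /rank_of.
set v := threshold _ _ _ _ _; suff -> : v = WNum 0 by rewrite /= size_content.
have := threshold_min p_gt0 hw [seq [:: r] | r <- u] l 0; rewrite -/v.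
case=> [[]|[y [_ [n ni ny] _]]] //.
have np : (n < p)%N by move: ni; rewrite mem_iota.
have := candidate_col u (Ordinal np); rewrite /= ny => /esym.
have := ut (Ordinal np); rewrite /nth_word => /= h.
by rewrite drop_oversize //; have := hl (Ordinal np); lia.
Qed.

(** A small queue need not have objects of all ranks in the window, so there the event of
    [rank_col_all] is used. In a queue of more than [khi] objects every rank of the window exists
    and the disjoint hits add up. *)
Lemma window_prob a : (L <= a <= khi)%N -> (a <= size (content q))%N ->
  (khi + 1 - a)%:R / (4 * (khi - L)%:R) <=
  avg_tape (D L) p (fun col => (a <= rank_col l col <= khi)%N%:R : R).
Proof.
move=> /andP[La ak] aM.
have k0 : 0 < (khi - L)%:R :> R by rewrite ltr0n subn_gt0.
case: (leqP (size (content q)) khi) => Mk.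
  apply: (le_trans (y := 2^-1)).
    rewrite ler_pdivrMr ?mulr_gt0 //.
    (* Because [L <= a] and [L < khi]; so the claimed probability is at most the available 1/2. *)
    have : (khi + 1 - a)%:R <= (2 * (khi - L))%:R :> R by rewrite ler_nat; move: La ak L_lt; clear; lia.
    by rewrite natrM; lra.
  apply: le_trans (rank_col_all Mk) _; apply: ler_avg_tape.
  by move=> u _; case: eqP => [->|_]; rewrite ?ler0n // aM Mk.
have -> : (fun col => (a <= rank_col l col <= khi)%N%:R : R) =
    (fun col => (a <= rank_col l col < a + (khi + 1 - a))%N%:R).
  by rewrite (_ : a + (khi + 1 - a) = khi.+1)%N //; move: ak; clear; lia.
rewrite (_ : 4 * (khi - L)%:R = 2 * (D L)%:R); last by rewrite natrD; ring.
apply: avg_tape_interval; first by lia.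
by move=> m hm; apply: rank_col_hit; lia.
Qed.
End Trial.
Hypothesis klo_khi : (klo <= khi)%N.
Hypothesis klo_size : (klo <= size (content q))%N.
Local Notation next us L l := (next_rank w khi d q us L l).

Definition miss l a (col : seq nat) : R := 1 - (a <= rank_col l col <= khi)%N%:R.

Lemma miss_ge0 l a col : 0 <= miss l a col.
Proof. by rewrite subr_ge0 lern1 leq_b1. Qed.

Lemma next_rank_miss us L l a : size us = p -> (next us L l < a)%N ->
  \prod_(j < d) miss l a (column us j) = 1.
Proof.
move=> su na; rewrite big1 // => j _; rewrite /miss -rank_of_column //.
have [_ _ h _] := best_spec khi (rank_of w q us l) L d.
case: andP => [[h1 h2]|_]; last by rewrite subr0.
by have := h j (ltn_ord j) h2; rewrite leqNgt (leq_trans na).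
Qed.

Lemma avg_miss L l a (s0 : R) : (L < khi)%N -> invariant khi q L l -> (L <= a <= khi)%N ->
  (a <= size (content q))%N -> 0 <= s0 -> s0 * (4 * (khi - L)%:R) <= (khi + 1 - a)%:R ->
  avg_all (D L) d p (fun us => \prod_(j < d) miss l a (column us j)) * (1 + d%:R * s0) <= 1.
Proof.
move=> Lk [hc hL hl _] ha aM s00 hs; have D0 : (0 < D L)%N by rewrite addn_gt0 subn_gt0 Lk.
have := window_prob Lk hc hL hl ha aM.
set s := avg_tape _ _ _ => h1.
rewrite avg_all_prod // (_ : avg_tape _ _ _ = 1 - s); last first.
  rewrite -[- s]mulN1r -avg_tape_affine //; congr avg_tape; apply/funext => u.
  by rewrite mulN1r.
apply: expr_one_sub_le => //; apply/andP; split.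
  by apply: le_trans h1; rewrite ler_pdivlMr // mulr_gt0 // ltr0n subn_gt0.
have := @avg_tape_ge0 R (D L) p (miss l a) (miss_ge0 l a).
rewrite (_ : avg_tape _ _ _ = 1 - s) ?subr_ge0 //.
rewrite -[- s]mulN1r -avg_tape_affine //; congr avg_tape; apply/funext => u.
by rewrite mulN1r.
Qed.

(** The mean of a geometric variable. A single trial hits [[klo, khi]] with probability at least eps
    / (4 d), so all [d] trials miss with probability at most 1 / (1 + eps / 4), and the reciprocal
    of the success probability is 1 + 4 / eps. *)
Definition flexible_potential (eps : R) L : R := if (L < klo)%N then 1 + 4 / eps else 0.

Lemma flexible_potential_step (eps : R) L l : 0 < eps -> (0 < d)%N ->
  eps * (khi%:R / d%:R) <= khi%:R - klo%:R -> (L < klo)%N -> invariant khi q L l ->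
  avg_all (D L) d p (fun us => flexible_potential eps (next us L l)) <=
    flexible_potential eps L - 1.
Proof.
move=> e0 d0 he Lk hi; have Lkhi := leq_trans Lk klo_khi.
have D0 : (0 < D L)%N by rewrite addn_gt0 subn_gt0 Lkhi.
have c0 : 0 <= 1 + 4 / eps by rewrite addr_ge0 // divr_ge0 // ltW.
rewrite [in leRHS]/flexible_potential Lk.
have dR : 0 < d%:R :> R by rewrite ltr0n.
apply: (le_trans (y := avg_all (D L) d p (fun us => 0 + (1 + 4 / eps) *
    \prod_(j < d) miss l klo (column us j)))).
  apply: ler_avg_all => us su _; rewrite add0r /flexible_potential.
  case: ltnP => h; first by rewrite (next_rank_miss su h) mulr1.
  by rewrite mulr_ge0 // prodr_ge0 // => j _; apply: miss_ge0.
rewrite avg_all_affine // add0r.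
have := @avg_miss L l klo (eps / (4 * d%:R)) Lkhi hi; rewrite (ltnW Lk) klo_khi => /(_ isT klo_size).
have -> : d%:R * (eps / (4 * d%:R)) = eps / 4 by field; rewrite gt_eqF.
move: (avg_all _ _ _ _) => y hy.
have {hy} : y * (1 + eps / 4) <= 1.
  apply: hy; first by rewrite divr_ge0 ?mulr_ge0 // ltW.
  apply: (le_trans (y := eps * (khi%:R / d%:R))).
    rewrite (_ : eps / (4 * d%:R) * (4 * (khi - L)%:R) = eps * ((khi - L)%:R / d%:R)); last first.
      by field; rewrite gt_eqF.
    by apply: ler_wpM2l; [exact: ltW | rewrite ler_pM2r ?invr_gt0 // ler_nat leq_subr].
  by apply: le_trans he _; rewrite natrB ?natrD; [lra | lia].
move=> hy; have e4 : 0 <= 4 / eps by rewrite divr_ge0 // ltW.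
have -> : (1 + 4 / eps) * y = 4 / eps * (y * (1 + eps / 4)) by field; rewrite gt_eqF.
have : 4 / eps * (y * (1 + eps / 4)) <= 4 / eps * 1 by apply: ler_wpM2l.
by lra.
Qed.

(** The logarithm counts the halvings of [klo - L] still to come. A round halves it with probability
    at least 1/9: a trial succeeds with probability at least 1/8, and [avg_miss] turns this into a
    failure bound of 1 / (1 + 1/8) = 8/9. *)
Definition fixed_potential L : R :=
  if (L < klo)%N then 9 * (1 + trunc_log 2 (klo - L))%:R else 0.

Lemma fixed_potential_step L l : klo = khi -> d = 1%N -> (L < klo)%N -> invariant khi q L l ->
  avg_all (D L) d p (fun us => fixed_potential (next us L l)) <= fixed_potential L - 1.
Proof.
move=> ek d1 Lk hi; have Lkhi := leq_trans Lk klo_khi.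
have D0 : (0 < D L)%N by rewrite addn_gt0 subn_gt0 Lkhi.
(* Rounding the half down makes [a = klo] when one object is missing, so that success then finishes
   the operation. *)
pose a := (klo - (klo - L)./2)%N.
have La : (L <= a)%N by rewrite /a; move: Lk; clear; lia.
have ak : (a <= klo)%N by apply: leq_subr.
apply: (le_trans (y := avg_all (D L) d p (fun us => (fixed_potential L - 9) +
    9 * \prod_(j < d) miss l a (column us j)))).
  apply: ler_avg_all => us su _.
  have m0 : 0 <= \prod_(j < d) miss l a (column us j) by rewrite prodr_ge0 // => j _; apply: miss_ge0.
  have [Ln _ _ _] := best_spec khi (rank_of w q us l) L d.
  rewrite -/(next us L l) in Ln.
  case: (ltnP (next us L l) a) => h.
    rewrite (next_rank_miss su h) mulr1 subrK /fixed_potential Lk (leq_trans h ak).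
    by rewrite ler_wpM2l // ler_nat leq_add2l leq_trunc_log // leq_sub2l.
  apply: (le_trans (y := fixed_potential L - 9)); last by rewrite lerDl mulr_ge0.
  rewrite /fixed_potential Lk; case: ltnP => hn; last first.
    by rewrite natrD mulrDr mulr1 addrC addKr mulr_ge0.
  have t1 : ((trunc_log 2 (klo - next us L l)).+1 <= trunc_log 2 (klo - L))%N.
    have m1 : (klo - next us L l <= (klo - L)./2)%N by move: h hn Lk; rewrite /a; clear; lia.
    rewrite (@trunc_log2S (klo - L)%N); last by move: m1 hn; clear; lia.
    by rewrite ltnS leq_trunc_log.
  have : (trunc_log 2 (klo - next us L l)).+1%:R <= (trunc_log 2 (klo - L))%:R :> R by rewrite ler_nat.
  by rewrite !natrD -natr1; lra.
rewrite avg_all_affine //.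
have := @avg_miss L l a (8^-1) Lkhi hi; rewrite -ek La ak => /(_ isT (leq_trans ak klo_size)).
move: (avg_all _ _ _ _) => y hy; have {hy} : y * (1 + d%:R * 8^-1) <= 1.
  apply: hy; rewrite ?invr_ge0 //.
  rewrite (_ : 8^-1 * (4 * (klo - L)%:R) = (klo - L)%:R / 2); last by field.
  rewrite ler_pdivrMr // -natrM ler_nat; move: Lk; rewrite /a; clear; lia.
by rewrite d1 => hy; lra.
Qed.
End Ranks.

(** * Expected time *)

Lemma count_mem_rounds p m (i : 'I_p) : count_mem i (rounds p m) = m.
Proof.
rewrite /rounds; elim: m => [|m IH] //=.
by rewrite count_cat IH count_uniq_mem ?enum_uniq // mem_enum.
Qed.

Section Within.
Variables (R : realType) (disp : Order.disp_t) (T : orderType disp).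
Variables (w : nat) (alpha beta : R) (p : nat) (klo khi d : nat) (q : 'I_p -> seq T).
Hypotheses (alpha_ge0 : 0 <= alpha) (beta_ge0 : 0 <= beta).
Hypothesis d_gt0 : (0 < d)%N.
Hypothesis p_gt0 : (0 < p)%N.
Hypothesis q_sorted : forall i, sorted <%O (q i).
Hypothesis klo_khi : (klo <= khi)%N.
Hypothesis hw : (256 + 4 * (d + p + khi) + \sum_i size (q i) < 2 ^ w)%N.
Local Notation S := (d %/ (trunc_log 2 p).+1 + 1)%N.
Local Notation D L := ((khi - L) + (khi - L))%N.

Definition arguments (args : seq nat) (i : 'I_p) : nat -> word T :=
  fun a => WNum (nth 0%N [:: p, val i & args] a).

Variable pot : nat -> R.
Hypothesis pot_ge0 : forall L, 0 <= pot L.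
Hypothesis pot_step : forall L l, (L < klo)%N -> invariant khi q L l ->
  avg_all (D L) d p (fun us => pot (next_rank w khi d q us L l)) <= pot L - 1.

(** The three parts of the theorem pass different arguments; [pre] brings them into the common form
    [[:: klo; khi; d]]. *)
Variables (pre : cmd) (args : seq nat).
Hypothesis pre_spec : forall i (s : st R T p), mem s = arguments args i ->
  W w alpha beta i pre (fun s' => exists2 t, t <= 3 &
    s' = setm (arguments [:: klo; khi; d] i) (tick t s)) s.

Lemma delete_min_within B :
  (forall aa, aa = (if (1 < p)%N then alpha + S%:R * beta else 0) ->
    18 + 4 * (trunc_log 2 p).+1%:R + round_time p khi d aa * (1 + pot 0%N) <= B) ->
  deleteMin_within w alpha beta (Seq pre delete_min) args q klo khi B.
Proof.
move=> /(_ _ erefl) hB.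
pose aa := if (1 < p)%N then alpha + S%:R * beta else 0.
have aa0 : 0 <= aa by rewrite /aa; case: ifP => // _; rewrite addr_ge0 ?mulr_ge0.
have aaE : (1 < p)%N -> alpha + S%:R * beta <= aa by rewrite /aa => ->.
have inv0 : invariant khi q 0 (fun=> 0%N).
  by split=> [i j x y|||] //; rewrite ?take0 // big1.
pose sg i : st R T p := St (arguments args i) (q i) [::] 0 0 (fun=> [::]) (fun=> [::]).
have c0 : initial R (Seq pre delete_min) args q = glob [:: Seq pre delete_min] sg by [].
have tm0 : 0 <= 4 + 14 + 4 * (trunc_log 2 p).+1%:R :> R by rewrite !addr_ge0 ?mulr_ge0.
have start X F b : compatible w alpha beta X ->
    (forall sg', (forall i, ready klo khi d q 0 (fun=> 0%N)
        (4 + 14 + 4 * (trunc_log 2 p).+1%:R) i (sg' i)) ->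
      X F (glob [:: loop; Remove (At (Const 8))] sg') b) ->
    X F (initial R (Seq pre delete_min) args q) b.
  move=> Xok hX; rewrite c0; apply: (compatible_reach Xok (reach_seq _ _ _ _ _ _ _)).
  have [i c k|sg1 h1 r1] := @PW_local R _ T w alpha beta p pre
    (fun i s => exists2 t, t <= 3 & s = setm (arguments [:: klo; khi; d] i) (tick t (mute (tick 1 (sg i)))))
    (fun i => tick 1 (sg i)) _ [:: delete_min].
    have [s' [t t3 ->] rs] := pre_spec (erefl : mem (mute (tick 1 (sg i))) = arguments args i) c k.
    by exists (setm (arguments [:: klo; khi; d] i) (tick t (mute (tick 1 (sg i))))) => //; split=> //; exists t.
  apply: (compatible_reach Xok r1).
  apply: (delete_min_reach p_gt0 hw klo_khi (t0 := 4) Xok _ _ hX) => // i.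
  by have [t t3 ->] := h1 i; split=> //=; lra.
split; last first.
  apply: ge_ereal_sup => _ [m _ <-]; rewrite lee_fin; apply: le_trans hB.
  have Xok := expected_le_compatible (elapsed_increasing w alpha_ge0 beta_ge0 (T := T) (p := p)).
  suff main : expected_le w alpha beta (@elapsed R disp T p) (fun=> m)
      (initial R (Seq pre delete_min) args q)
      (4 + 14 + 4 * (trunc_log 2 p).+1%:R + round_time p khi d aa * (1 + pot 0%N)).
    apply: le_trans (main (rounds p m) _) _ => [i|]; first by rewrite count_mem_rounds.
    by rewrite /aa; lra.
  apply: start => // sg' hr.
  exact: (time_bound p_gt0 q_sorted hw aa0 aaE klo_khi alpha_ge0 beta_ge0 d_gt0 pot_ge0 pot_step inv0 tm0 hr).
apply/eqP; rewrite eq_le; apply/andP; split.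
  apply: ge_ereal_sup => _ [m _ <-]; rewrite lee_fin.
  apply: le_trans (_ : expect w alpha beta (rounds p m) (fun=> 1) _ <= 1); last by rewrite expect_const.
  by apply: ler_expect => c; rewrite lern1 leq_b1.
apply/lee_addgt0Pr => e e0.
pose success (c : config R T p) : R := (halted c && delivered q klo khi c)%:R.
have Xok : compatible w alpha beta (eventually w alpha beta success).
  by apply: eventually_compatible; apply: halted_increasing.
(* Enough rounds to push the failure bound [pot 0 / (n + 1)] below [e]; halting with probability 1
   follows as [e] is arbitrary. *)
pose n := Num.bound (pot 0%N / e).
have Vn : pot 0%N / n.+1%:R <= e.
  rewrite ler_pdivrMr ?ltr0n // mulrC -ler_pdivrMr //.
  apply: ltW; apply: lt_le_trans (archi_boundP _) _; first by rewrite divr_ge0 // ltW.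
  by rewrite ler_nat.
have [K hK] : eventually w alpha beta success (fun=> 0%N)
    (initial R (Seq pre delete_min) args q) (pot 0%N / n.+1%:R).
  apply: start => // sg' hr.
  exact: (halting_bound p_gt0 q_sorted hw aa0 aaE klo_khi alpha_ge0 beta_ge0 d_gt0 pot_ge0 pot_step n _ inv0 tm0 hr).
rewrite -leeBlDr //; apply: le_trans (ereal_sup_ubound _); last by exists K.
by rewrite lee_fin; apply: le_trans hK; rewrite lerD2l lerN2.
Qed.
End Within.

(** * From explicit costs to the asymptotic bounds *)

Section Costs.
Variable R : realType.

Lemma ln2_ge : 2^-1 <= ln 2 :> R.
Proof.
have : ln (1 + - 2^-1) <= - 2^-1 :> R by apply: le_ln1Dx; lra.
rewrite (_ : 1 + - 2^-1 = 2^-1); last by field.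
by rewrite lnV ?posrE //; lra.
Qed.

Lemma trunc_log_le_ln n : (0 < n)%N -> (trunc_log 2 n)%:R <= 2 * ln n%:R :> R.
Proof.
move=> n0; have : ln ((2 ^ trunc_log 2 n)%:R) <= ln n%:R :> R.
  by rewrite ler_ln ?posrE ?ltr0n ?expn_gt0 // ler_nat trunc_logP.
rewrite natrX lnXn // -[leLHS]mulr_natl.
have : (trunc_log 2 n)%:R * 2^-1 <= (trunc_log 2 n)%:R * ln 2 :> R.
  by rewrite ler_wpM2l ?ler0n // ln2_ge.
by move=> h1 h2; lra.
Qed.

Lemma tree_cost_le khi : (0 < khi)%N -> tree_cost R (3 * khi) <= 3 + 2 * ln khi%:R.
Proof.
move=> k0; apply: (le_trans (y := 3 + (trunc_log 2 khi)%:R)); last first.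
  by rewrite lerD2l trunc_log_le_ln.
rewrite /tree_cost -natrD ler_nat (_ : 3 + _ = 1 + (trunc_log 2 (2 * (2 * khi))))%N.
  by rewrite leq_add2l leq_trunc_log //; lia.
by rewrite !trunc_logMp ?muln_gt0 //; lia.
Qed.

(** A pass pays [h * (alpha + S * beta)] with [h * S <= d + h]; the surplus [h * beta] is charged to
    [h * alpha]. Additive constants are charged to [d >= 1]. The quantity [P] occurs 644 times in
    all, which gives 2576 = 4 * 644. *)
Lemma delete_min_cost (alpha beta v aa : R) p khi d : 1 <= alpha -> 0 <= beta ->
  (0 < p)%N -> (0 < khi)%N -> (0 < d)%N -> 0 <= v ->
  aa = (if (1 < p)%N then alpha + (d %/ (trunc_log 2 p).+1 + 1)%:R * beta else 0) ->
  beta <= alpha ->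
  18 + 4 * (trunc_log 2 p).+1%:R + round_time p khi d aa * (1 + v) <=
  (1 + v) * (d%:R * (986 + 6 * ln khi%:R) + 2576 * (alpha * ln p%:R) + 20 * (beta * d%:R)).
Proof.
move=> a1 b0 p0 k0 d0 v0 aaE ba.
set h := (trunc_log 2 p).+1; pose S := (d %/ h + 1)%N.
have hS : h%:R * S%:R <= d%:R + h%:R :> R.
  by rewrite -natrM -natrD ler_nat mulnDr muln1 mulnC leq_add2r leq_divM.
have hE : h%:R = (trunc_log 2 p)%:R + 1 :> R by rewrite natr1.
have h1 : 1 <= h%:R :> R by rewrite ler1n.
have dR : 1 <= d%:R :> R by rewrite ler1n.
(* The startup cost of a pass. For [p > 1] the [h] levels number at most twice the binary logarithm
   of [p], hence at most 4 ln p; for [p = 1] both sides of [P4] are 0. *)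
pose P := if (1 < p)%N then h%:R * alpha else 0.
have lp0 : 0 <= ln p%:R :> R by rewrite ln_ge0 // ler1n.
have P4 : P <= 4 * (alpha * ln p%:R).
  rewrite /P; case: ltnP => p1; last by rewrite !mulr_ge0 //; lra.
  have t1 : 1 <= (trunc_log 2 p)%:R :> R by rewrite ler1n trunc_log_gt0.
  have tl := trunc_log_le_ln p0.
  have : h%:R * alpha <= (4 * ln p%:R) * alpha.
    by apply: ler_wpM2r; rewrite ?[h%:R]hE; lra.
  by move=> ?; lra.
have hP : h%:R <= 1 + P.
  rewrite /P; case: ltnP => p1.
    have : h%:R * 1 <= h%:R * alpha by rewrite ler_wpM2l //; lra.
    by lra.
  by rewrite /h (_ : p = 1%N) ?trunc_log1 ?addr0 //; lia.
have haa : h%:R * aa <= 2 * P + d%:R * beta.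
  rewrite aaE /P; case: ltnP => p1; last by rewrite !mulr0 add0r mulr_ge0 //; lra.
  have : (h%:R * S%:R) * beta <= (d%:R + h%:R) * beta by rewrite ler_wpM2r.
  have : h%:R * beta <= h%:R * alpha by rewrite ler_wpM2l //; lra.
  by rewrite -/h -/S => m1 m2; lra.
have tc := tree_cost_le k0.
have tc1 := tree_cost_ge1 R (3 * khi).
have P0 : 0 <= P by rewrite /P; case: ifP => // _; rewrite mulr_ge0; lra.
have dtc : d%:R * tree_cost R (3 * khi) <= d%:R * (3 + 2 * ln khi%:R) by rewrite ler_wpM2l //; lra.
set B := (X in _ <= _ * X).
have key : 18 + 4 * h%:R + round_time p khi d aa <= B.
  rewrite /B /round_time /round_tail_time /delta -/h -/S.
  rewrite (_ : 3 * d%:R * _ = 24 * d%:R + 3 * (d%:R * tree_cost R (3 * khi))); last by ring.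
  rewrite (_ : 10 * h%:R * _ = 20 * (h%:R * aa) + 300 * (h%:R * S%:R) + 300 * h%:R); last by ring.
  rewrite (_ : d%:R * (986 + _) = 986 * d%:R + 6 * (d%:R * ln khi%:R)); last by ring.
  rewrite (_ : d%:R * (3 + _) = 3 * d%:R + 2 * (d%:R * ln khi%:R)) in dtc; last by ring.
  rewrite (_ : d%:R * beta = beta * d%:R) in haa; last by ring.
  move: dtc haa hS hP P4 dR; clear.
  move: (d%:R * _) (d%:R * _) (h%:R * _) (h%:R * _) (alpha * _) (beta * _) => x1 x2 x3 x4 x5 x6.
  move: P (h%:R) (d%:R) => y1 y2 y3 *; lra.
have r0 : 0 <= 18 + 4 * h%:R :> R by lra.
apply: (le_trans (y := (1 + v) * (18 + 4 * h%:R + round_time p khi d aa))).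
  rewrite -[leLHS]addr0 (_ : (1 + v) * _ = 18 + 4 * h%:R + round_time p khi d aa * (1 + v) +
    v * (18 + 4 * h%:R)); last by ring.
  by rewrite lerD2l mulr_ge0.
by rewrite ler_wpM2l // addr_ge0.
Qed.
End Costs.

(** The exponent 10 handles the additive constants: for [N >= 2] the factor [N ^ 9] is at least
    512. *)
Lemma fits_words (N w : nat) : (1 < N)%N -> fits 10 N w -> (260 + 5 * N < 2 ^ w)%N.
Proof.
move=> N1; apply: leq_trans; rewrite expnS.
have : (2 ^ 9 <= N ^ 9)%N by rewrite leq_exp2r.
by rewrite (_ : 2 ^ 9 = 512)%N // => h; apply: leq_trans (leq_mul (leqnn N) h); lia.
Qed.

(** The arguments start at address 2, after [p] and the PE number, hence the shift by 2. *)
Lemma assign_args (R : realFieldType) (disp : Order.disp_t) (T : orderType disp) (w p : nat)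
    (alpha beta : R) (i : 'I_p) (args args' : seq nat) n e x (s : st R T p) :
  (128 <= 2 ^ w)%N -> (n < 128)%N -> mem s = arguments T args i ->
  eval w (mem s) e = WNum x -> args' = set_nth 0%N args (n - 2) x -> (2 <= n)%N ->
  forall Q : st R T p -> Prop, Q (setm (arguments T args' i) (tick 1 s)) ->
  W w alpha beta i (Assign (Const n) e) Q s.
Proof.
move=> w128 n128 ms ex -> n2 Q hQ; apply: W_assign; [exact: ev_const | exact: ex | ].
rewrite /store ms (_ : upd _ _ _ = arguments T (set_nth 0%N args (n - 2) x) i) //.
apply/funext => -[|[|a]]; rewrite /upd /arguments /=; case: (_ =P n) => h //; try by lia.
  by rewrite nth_set_nth /= -h subn2 eqxx.
by rewrite nth_set_nth /= ifF //; apply/eqP; lia.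
Qed.

Section Bounds.
Variables (R : realType) (disp : Order.disp_t) (T : orderType disp).
Variables (w p N klo khi d : nat) (alpha beta : R) (Q : 'I_p -> seq T).
Hypotheses (p_gt0 : (0 < p)%N) (alpha_ge1 : 1 <= alpha) (beta_alpha : 0 <= beta <= alpha).
Hypothesis N_fits : fits 10 N w.
Hypothesis hN : (size (content Q) + p + khi + d <= N.+1)%N.
Hypothesis N_gt1 : (1 < N)%N.
Hypothesis Q_ok : well_formed Q.
Hypotheses (klo_gt0 : (0 < klo)%N) (klo_khi : (klo <= khi)%N).
Hypothesis klo_size : (klo <= size (content Q))%N.
Hypothesis d_gt0 : (0 < d)%N.
Variables (pre : cmd) (args : seq nat).
Hypothesis pre_spec : forall i (s : st R T p), (128 <= 2 ^ w)%N -> mem s = arguments T args i ->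
  W w alpha beta i pre (fun s' => exists2 t, t <= 3 &
    s' = setm (arguments T [:: klo; khi; d] i) (tick t s)) s.

Local Notation cost := (d%:R * (986 + 6 * ln khi%:R) + 2576 * (alpha * ln p%:R) + 20 * (beta * d%:R)).

Let hw : (256 + 4 * (d + p + khi) + \sum_i size (Q i) < 2 ^ w)%N.
Proof.
rewrite size_content; apply: leq_trans (fits_words N_gt1 N_fits).
by move: hN; clear; lia.
Qed.

Let w128 : (128 <= 2 ^ w)%N. Proof. by move: hw; clear; lia. Qed.

Let Q_sorted i : sorted <%O (Q i). Proof. by have /andP[/forallP h _] := Q_ok; apply: h. Qed.
Let Q_uniq : uniq (content Q). Proof. by have /andP[] := Q_ok. Qed.

Lemma flexible_within eps B : 0 < eps -> eps * (khi%:R / d%:R) <= khi%:R - klo%:R ->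
  (2 + 4 / eps) * cost <= B ->
  deleteMin_within w alpha beta (Seq pre delete_min) args Q klo khi B.
Proof.
move=> e0 he hB; have /andP[b0 ba] := beta_alpha; have c0 : 0 <= 4 / eps by rewrite divr_ge0 // ltW.
have a0 : 0 <= alpha by apply: le_trans alpha_ge1.
apply: (@delete_min_within R _ T w alpha beta p klo khi d Q a0 b0 d_gt0 p_gt0 Q_sorted klo_khi hw
  (flexible_potential klo eps)).
- by move=> L; rewrite /flexible_potential; case: ifP => // _; rewrite addr_ge0.
- by move=> L l Lk hi; apply: (flexible_potential_step hw p_gt0 Q_sorted Q_uniq klo_khi klo_size).
- by move=> i s; apply: pre_spec.
move=> aa aaE; rewrite /flexible_potential klo_gt0; apply: le_trans hB.
have := @delete_min_cost R alpha beta (1 + 4 / eps) aa p khi d alpha_ge1 b0 p_gt0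
  (leq_trans klo_gt0 klo_khi) d_gt0 (addr_ge0 ler01 c0) aaE ba.
by rewrite addrA.
Qed.

Lemma fixed_within B : klo = khi -> d = 1%N ->
  (1 + 9 * (1 + trunc_log 2 klo)%:R) * cost <= B ->
  deleteMin_within w alpha beta (Seq pre delete_min) args Q klo khi B.
Proof.
move=> ek d1 hB; have /andP[b0 ba] := beta_alpha.
have a0 : 0 <= alpha by apply: le_trans alpha_ge1.
apply: (@delete_min_within R _ T w alpha beta p klo khi d Q a0 b0 d_gt0 p_gt0 Q_sorted klo_khi hw
  (fixed_potential R klo)).
- by move=> L; rewrite /fixed_potential; case: ifP.
- by move=> L l Lk hi; apply: (fixed_potential_step R hw p_gt0 Q_sorted Q_uniq klo_khi klo_size).
- by move=> i s; apply: pre_spec.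
move=> aa aaE; rewrite /fixed_potential klo_gt0 subn0; apply: le_trans hB.
by apply: delete_min_cost => //; apply: leq_trans klo_khi.
Qed.
End Bounds.

Theorem theorem5 (R : realType) :
  (* fixed batch size k *)
  (exists (prog : cmd) (c : nat) (C : R),
    forall (w p n k : nat) (alpha beta : R)
           (disp : Order.disp_t) (T : orderType disp) (Q : 'I_p -> seq T),
      (0 < p)%N -> 1 <= alpha -> 0 <= beta <= alpha ->
      fits c (n + p + k) w ->
      well_formed Q -> (size (content Q) <= n)%N ->
      (0 < k)%N -> (k <= size (content Q))%N -> (1 < k * p)%N ->
      deleteMin_within w alpha beta prog [:: k] Q k k
        (C * (alpha * ln (k * p)%:R ^+ 2)))
  /\
  (* flexible batch size, khi - klo = Omega(khi) *)
  (exists (prog : cmd) (c : nat),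
    forall eps : R, 0 < eps -> exists C : R,
    forall (w p n klo khi : nat) (alpha beta : R)
           (disp : Order.disp_t) (T : orderType disp) (Q : 'I_p -> seq T),
      (0 < p)%N -> 1 <= alpha -> 0 <= beta <= alpha ->
      fits c (n + p + khi) w ->
      well_formed Q -> (size (content Q) <= n)%N ->
      (0 < klo <= khi)%N -> (klo <= size (content Q))%N ->
      eps * khi%:R <= khi%:R - klo%:R ->
      deleteMin_within w alpha beta prog [:: klo; khi] Q klo khi
        (C * (alpha * ln (khi * p)%:R)))
  /\
  (* flexible batch size, khi - klo = Omega(khi / d) *)
  (exists (prog : cmd) (c : nat),
    forall eps : R, 0 < eps -> exists C : R,
    forall (w p n klo khi d : nat) (alpha beta : R)
           (disp : Order.disp_t) (T : orderType disp) (Q : 'I_p -> seq T),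
      (0 < p)%N -> 1 <= alpha -> 0 <= beta <= alpha ->
      fits c (n + p + khi + d) w ->
      well_formed Q -> (size (content Q) <= n)%N ->
      (0 < klo <= khi)%N -> (klo <= size (content Q))%N -> (0 < d)%N ->
      eps * (khi%:R / d%:R) <= khi%:R - klo%:R ->
      deleteMin_within w alpha beta prog [:: klo; khi; d] Q klo khi
        (C * (d%:R * ln khi%:R + beta * d%:R + alpha * ln p%:R))).
Proof.
have ln_ge (m : nat) : (1 < m)%N -> 2^-1 <= ln m%:R :> R.
  by move=> m1; apply: le_trans (ln2_ge R) _; rewrite ler_ln ?posrE ?ltr0n ?ler_nat // ltnW.
have ln_pos (m : nat) : (0 < m)%N -> 0 <= ln m%:R :> R by move=> m0; rewrite ln_ge0 ?ler1n.
have lnD k p : (0 < k)%N -> (0 < p)%N -> ln (k * p)%:R = ln k%:R + ln p%:R :> R.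
  by move=> k0 p0; rewrite natrM lnM ?posrE ?ltr0n.
(* A positive gap forces [khi >= 2], so [ln khi] is at least 1/2 and can absorb constants. For fixed
   batches the assumption [1 < k * p] plays this part. *)
have khi_gt1 (eps : R) klo khi d : 0 < eps -> (0 < klo <= khi)%N -> (0 < d)%N ->
    eps * (khi%:R / d%:R) <= khi%:R - klo%:R -> (1 < khi)%N.
  move=> e0 /andP[k0 kk] d0 he; apply: leq_ltn_trans (k0) _; rewrite -(ltr_nat R) -subr_gt0.
  by apply: lt_le_trans he; rewrite mulr_gt0 ?divr_gt0 ?ltr0n // (leq_trans k0).
split; last split.
(* The prelude sets [khi] to [klo] and [d] to 1. *)
- exists (Seq (Seq (Assign (Const 3) (At (Const 2))) (Assign (Const 4) (Const 1))) delete_min), 10%N, (200 * 1000).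
  move=> w p n k alpha beta disp T Q p0 a1 ba hf hq hn k0 kM kp.
  have /andP[b0 b1] := ba.
  apply: (@fixed_within R _ T w p (n + p + k) k k 1) => //; try by move: hn k0 p0; clear; lia.
    move=> i s w128 ms; apply: W_seq.
    apply: (@assign_args _ _ _ w p alpha beta i [:: k] [:: k; k] 3 _ k) => //; first by rewrite ev_var //= ms.
    apply: (@assign_args _ _ _ w p alpha beta i [:: k; k] [:: k; k; 1%N] 4 _ 1) => //; first exact: ev_const.
    rewrite setm_tick tick_tick.
    by eexists; last reflexivity; lra.
  have lk := lnD k p k0 p0; have k1 := ln_pos k k0; have p1 := ln_pos p p0.
  have l2 := ln_ge _ kp; have tk := trunc_log_le_ln R k0.
  set x := ln (k * p)%:R in lk l2 *.
  have ax : alpha <= 2 * (alpha * x) by rewrite mulrCA ler_peMr //; lra.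
  have axp : alpha * ln p%:R <= alpha * x by rewrite ler_wpM2l //; lra.
  have ax1 : x <= alpha * x by rewrite ler_peMl //; lra.
  (* The number of rounds gives the first factor: 10 + 9 log k is at most 10 + 18 ln k, and 10 is at
     most 20 x because x is at least 1/2. The second factor bounds the cost of one round, with 1 and
     [beta] replaced by [alpha]. *)
  apply: (le_trans (y := (38 * x) * (5000 * (alpha * x)))); last first.
    have : 0 <= alpha * x ^+ 2 by rewrite mulr_ge0 ?sqr_ge0 //; lra.
    by rewrite expr2; lra.
  have t0 : 0 <= (trunc_log 2 k)%:R :> R by [].
  have ap : 0 <= alpha * ln p%:R by rewrite mulr_ge0 //; lra.
  rewrite natrD mul1r mulr1; move: t0 ap tk lk l2 ax axp ax1 k1 p1 b0 b1; clear.
  move: (trunc_log 2 k)%:R (alpha * ln p%:R) (alpha * x) => y1 y2 y3 *.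
  by apply: ler_pM; lra.
- exists (Seq (Assign (Const 4) (Const 1)) delete_min), 10%N => eps e0; exists ((2 + 4 / eps) * 4000).
  move=> w p n klo khi alpha beta disp T Q p0 a1 ba hf hq hn kk kM he.
  have /andP[k0 kk'] := kk; have /andP[b0 b1] := ba.
  have he' : eps * (khi%:R / 1%:R) <= khi%:R - klo%:R by rewrite divr1.
  have k2 := khi_gt1 _ _ _ 1%N e0 kk isT he'.
  apply: (@flexible_within R _ T w p (n + p + khi) klo khi 1 _ _ _ p0 a1 ba hf _ _ hq k0 kk' kM isT
    _ _ _ _ _ e0 he'); try by move: hn k2 p0; clear; lia.
    move=> i s w128 ms; apply: (@assign_args _ _ _ w p alpha beta i [:: klo; khi] [:: klo; khi; 1%N] 4 _ 1) => //.
      exact: ev_const.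
    by exists 1; rewrite ?ler1n.
  have lk := lnD khi p (ltnW k2) p0; have p1 := ln_pos p p0; have l2 := ln_ge _ k2.
  have c0 : 0 <= 2 + 4 / eps by rewrite addr_ge0 // divr_ge0 // ltW.
  rewrite -mulrA ler_wpM2l // lk mulrDr.
  have ax : alpha <= 2 * (alpha * ln khi%:R) by rewrite mulrCA ler_peMr //; lra.
  have ax1 : ln khi%:R <= alpha * ln khi%:R by rewrite ler_peMl //; lra.
  have axp : 0 <= alpha * ln p%:R by rewrite mulr_ge0 //; lra.
  by lra.
exists (Seq Skip delete_min), 10%N => eps e0; exists ((2 + 4 / eps) * 4000).
move=> w p n klo khi d alpha beta disp T Q p0 a1 ba hf hq hn kk kM d0 he.
have /andP[k0 kk'] := kk; have /andP[b0 b1] := ba.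
have k2 := khi_gt1 _ _ _ _ e0 kk d0 he.
apply: (@flexible_within R _ T w p (n + p + khi + d) klo khi d _ _ _ p0 a1 ba hf _ _ hq k0 kk' kM d0
    _ _ _ _ _ e0 he); try by move: hn k2 p0; clear; lia.
  by move=> i s w128 ms; apply: W_skip; exists 1; rewrite ?ler1n // -ms.
have p1 := ln_pos p p0; have l2 := ln_ge _ k2.
have c0 : 0 <= 2 + 4 / eps by rewrite addr_ge0 // divr_ge0 // ltW.
rewrite -mulrA ler_wpM2l //.
have dx : d%:R <= 2 * (d%:R * ln khi%:R) :> R by rewrite mulrCA ler_peMr //; lra.
have axp : 0 <= alpha * ln p%:R by rewrite mulr_ge0 //; lra.
have d1 : 0 <= d%:R :> R by [].
have bd : 0 <= beta * d%:R by rewrite mulr_ge0.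
by lra.
Qed.
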